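(* Let $r>0$, let $V,M$ be as in the context, let $c\in[c^*,v_{\max})$, and let $f$ be a travelling wave of speed $c$. There exists a weight function $\phi:\mathbb{R}\times V\to\mathbb{R}$, $\phi=\phi(z,v)$, with the following property. Let $g^0$ satisfy $0\le g^0\le M$, let $g$ be the solution of $$\partial_tg+v\partial_xg=\big(M(v)\rho_g-g\big)+r\rho_g\big(M(v)-g\big),\qquad g(0,x,v)=g^0(x,v),$$ and let $u(t,z,v)=g(t,z+ct,v)-f(z,v)$ be the perturbation in the moving frame $z=x-ct$, $u^0=g^0-f$. Assume $u^0\in L^2(e^{-2\phi(z,v)}dz\,dv)$ and that there exists $\gamma\in(\frac12,1]$ such that $$(\forall(x,v)\in\mathbb{R}\times V)\quad g^0(x,v)\ge\gamma f(x,v).$$ Then $$(\forall t\in\mathbb{R}^+)\quad\|u(t)\|_{L^2(e^{-2\phi})}\le\|u^0\|_{L^2(e^{-2\phi})},$$ and for every $z_0\in\mathbb{R}$ the function $$t\mapsto\int_{\{z<z_0\}\times V}|u(t,z,v)|^2e^{-2\phi(z,v)}\,dz\,dv+\int_{\{z>z_0\}\times V}\rho_f(z)\,|u(t,z,v)|^2e^{-2\phi(z,v)}\,dz\,dv$$ belongs to $L^1(\mathbb{R}^+)$.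
   Context: The set $V\subset\mathbb{R}$ is compact and symmetric ($V=-V$), $V=\operatorname{supp}M$, $M:V\to[0,\infty)$ is continuous with $\int_VM\,dv=1$, $\int_VvM\,dv=0$, $\int_Vv^2M\,dv<\infty$; $v_{\max}=\sup V$; $\rho_h=\int_Vh\,dv$ for any function $h$. Minimal speed: $c^*$ is the smallest $c\in[0,v_{\max})$ for which there is $\lambda\in(0,\frac1{v_{\max}-c}]$ with $(1+r)\int_V\frac{M(v)}{1+\lambda(c-v)}\,dv=1$. A travelling wave of speed $c$ is a continuous $f:\mathbb{R}\times V\to\mathbb{R}$ solving $(v-c)\partial_zf=(M\rho_f-f)+r\rho_f(M-f)$ in the sense of distributions, with $0\le f(z,v)\le M(v)$, $\lim_{z\to-\infty}f(z,v)=M(v)$, $\lim_{z\to+\infty}f(z,v)=0$. The solution $g$ of the Cauchy problem is the unique solution in the sense of distributions with $0\le g\le M$ (equivalently, the mild solution given by Duhamel's formula along characteristics). The weight $\phi$ depends on $c$, $f$, $M$, $r$ but not on $g^0$ or $\gamma$. *)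

(* Defs.v *)
From HB Require Import structures.
From mathcomp Require Import all_boot all_order all_algebra.
From mathcomp Require Import all_classical all_reals all_analysis.

Set Implicit Arguments.
Unset Strict Implicit.
Unset Printing Implicit Defensive.

Import Order.TTheory GRing.Theory Num.Theory.
Import numFieldNormedType.Exports.

Local Open Scope classical_set_scope.
Local Open Scope ring_scope.

Notation leb1 := (@lebesgue_measure _).
Notation leb2 := (@lebesgue_measure _ \x @lebesgue_measure _)%E.

Section test_functions.
Context {R : realType} {E : normedModType R}.

(* The directions v range over the whole space; when E is finite dimensional
   this is the usual class C^n. *)
Fixpoint class_C (n : nat) (psi : E -> R) : Prop :=
  continuous psi /\
  if n is m.+1 then
    forall v : E, (forall p, derivable psi p v) /\
                  class_C m (fun p => 'D_v psi p)
  else True.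

Definition test_function (psi : E -> R) : Prop :=
  (forall n, class_C n psi) /\ compact (closure [set p | psi p != 0]).

End test_functions.

Section kinetic.
Context {R : realType}.
Implicit Types (V : set R) (M : R -> R) (r c : R).

Definition phase V : set (R * R) := [set: R] `*` V.

(* Functions of the velocity (M, f, g, phi) are total on R, but only their
   values at velocities in V are ever constrained or used. *)
Record velocity_data V M : Prop := VelocityData {
  vd_compact : compact V ;
  vd_sym : [set - v | v in V] = V ;
  vd_supp : closure [set v | V v /\ M v != 0] = V ;
  vd_cont : {within V, continuous M} ;
  vd_ge0 : forall v, V v -> 0 <= M v ;
  vd_mass : (\int[leb1]_(v in V) (M v)%:E = 1)%E ;
  vd_mean : (\int[leb1]_(v in V) (v * M v)%:E = 0)%E ;
  vd_energy : (\int[leb1]_(v in V) (v ^+ 2 * M v)%:E < +oo)%E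
}.

Definition vmax V : R := sup V.

(* For lambda at the right end of its range the denominator vanishes at
   v = vmax and the integral may be infinite, whence the extended reals. *)
Definition dispersion V M r c : Prop :=
  exists lambda : R, 0 < lambda <= (vmax V - c)^-1 /\
    ((1 + r)%:E *
      \int[leb1]_(v in V) (M v / (1 + lambda * (c - v)))%:E = 1)%E.

Definition is_minimal_speed V M r (cstar : R) : Prop :=
  [/\ 0 <= cstar < vmax V,
      dispersion V M r cstar &
      forall c, 0 <= c < vmax V -> dispersion V M r c -> cstar <= c].

Definition rho V (h : R -> R) : R := \int[leb1]_(v in V) h v.

Definition reaction V M r (h : R -> R) (v : R) : R :=
  (M v * rho V h - h v) + r * rho V h * (M v - h v).

Record travelling_wave V M r c (f : R * R -> R) : Prop := TravellingWave {
  tw_cont : {within phase V, continuous f} ;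
  (* No derivative in v occurs and V need not have interior, so D'(R x V) is
     tested with restrictions to R x V of test functions on the plane, against
     the measure dz dv on R x V. *)
  tw_eq : forall psi : R * R -> R, test_function psi ->
    - (\int[leb2]_(p in phase V) ((p.2 - c) * f p * 'D_(1, 0) psi p)) =
    \int[leb2]_(p in phase V)
       (reaction V M r (fun v => f (p.1, v)) p.2 * psi p) ;
  tw_bounds : forall z v, V v -> 0 <= f (z, v) <= M v ;
  tw_left : forall v, V v -> f (z, v) @[z --> -oo] --> M v ;
  tw_right : forall v, V v -> f (z, v) @[z --> +oo] --> (0 : R)
}.

(* The argument of g is (t, x, v) with t >= 0.  The equation and the initial
   datum are taken in the sense of distributions on [0, T] x R x V for every
   T >= 0: this is what gives g T a meaning (almost everywhere in (x, v)) at
   every time T and not only at almost every T. *)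
Record cauchy_solution V M r (g0 : R * R -> R) (g : R * R * R -> R) : Prop :=
  CauchySolution {
  cs_meas : measurable_fun (`[(0 : R), +oo[%classic `*` [set: R] `*` V) g ;
  cs_bounds : forall t x v, 0 <= t -> V v -> 0 <= g (t, x, v) <= M v ;
  cs_eq : forall (psi : R * R * R -> R) (T : R), test_function psi -> 0 <= T ->
    \int[leb2]_(p in phase V) (g (T, p.1, p.2) * psi (T, p.1, p.2)) -
    \int[leb2]_(p in phase V) (g0 p * psi (0, p.1, p.2)) =
    \int[leb1]_(t in `[(0 : R), T]%classic) \int[leb2]_(p in phase V)
       (g (t, p.1, p.2) * ('D_(1, 0, 0) psi (t, p.1, p.2) +
                           p.2 * 'D_(0, 1, 0) psi (t, p.1, p.2)) +
        reaction V M r (fun v => g (t, p.1, v)) p.2 * psi (t, p.1, p.2))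
}.

Definition weighted_sq (A : set (R * R)) (k phi u : R * R -> R) : \bar R :=
  (\int[leb2]_(p in A) (k p * `|u p| ^+ 2 * expR (- 2 * phi p))%:E)%E.

Definition wL2norm V (phi u : R * R -> R) : \bar R :=
  (weighted_sq (phase V) (cst (1 : R)%R) phi u `^ 2^-1)%E.

Definition wL2 V (phi u : R * R -> R) : Prop :=
  measurable_fun (phase V) u /\ (wL2norm V phi u < +oo)%E.

Definition moving_perturbation c (f : R * R -> R) (g : R * R * R -> R)
    (t : R) : R * R -> R :=
  fun p => g (t, p.1 + c * t, p.2) - f p.

End kinetic.

(* Main.v *)
From HB Require Import structures.
Require Import Defs.
From mathcomp Require Import all_boot all_order all_algebra.
From mathcomp Require Import all_classical all_reals all_analysis.
From mathcomp Require Import measurable_realfun.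
From mathcomp Require Import ring lra.

(** The perturbation u of the wave f, in the moving frame, is measured with the
weight e^{2 lambda z} / A where A = (1 + r) M - r f.  The factor A is dictated
by the equation: subtracting the equations of g and f gives
   u_t + (v - c) u_z = A rho_u - (1 + r rho_g) u,
so dividing by A symmetrises the only non-local term, while the wave equation
yields A' = r f - r rho_f A along characteristics.  Hence, with
B = e^{2 lambda z},
   (B u^2 / A)' = B (2 rho_u u - (u^2 / A) (2 + 2 lambda (c - v)
                      + 2 r rho_g - r rho_f + r f / A)).

Two inputs make the right-hand side dissipative.  First, gamma f is a
subsolution of the Cauchy problem, so g >= gamma f persists (comparison) and
2 r rho_g - r rho_f >= r (2 gamma - 1) rho_f.  Secondly, by Young's inequality
2 rho_u u <= rho_u^2 q + u^2 / q with q = (1 + r) M / (1 + lambda (c - v)), the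
second term is at most half of the damping because A <= (1 + r) M
(dissipation), and the first one integrates in v to at most rho_u^2, hence to
at most the integral of u^2 / q by Cauchy-Schwarz (source_le_fill), as soon as
the integral of q is at most 1.  For the rate lambda attached to the minimal
speed the dispersion relation says that this integral is 1 at c^*, and it
decreases with c (admissible_dispersion).

What is left of the damping is r (2 gamma - 1) rho_f u^2 B / A, which controls
the second claim where z > z_0; it also controls it where z < z_0 if rho_f is
bounded below there.  This holds when M charges velocities above c, because
particles faster than c bring mass from far behind the front, where f is close
to M (wave_lower_bound).  Otherwise almost no particle is faster than c, and
then a large rate lambda leaves a positive uniform damping eta
(admissible_no_fast).

Solutions are only distributional, so all this is done on characteristics.
Testing with smooth bumps carried by the free flow turns both equations into
Duhamel's formula (mild_cauchy, mild_wave); on almost every characteristic the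
unknowns are then primitives of bounded functions, for which products and
reciprocals are computed by Fubini and Gronwall arguments (primM,
reciprocal_prim) and the energy balance is an inequality between integrals in
time (energy_line).  Integrating it over characteristics uses only Tonelli and
the invariance of Lebesgue measure under the flow.  The balance is first
restricted to backward cones, which characteristics can only leave: there the
terms to be cancelled are finite (energy_cone).  Letting the cone fill
space-time (energy_bound, damping_bound) gives both claims. *)

Import Order.TTheory GRing.Theory Num.Theory.
Import numFieldNormedType.Exports.
Set Implicit Arguments.
Unset Strict Implicit.
Unset Printing Implicit Defensive.
Local Open Scope classical_set_scope.
Local Open Scope ring_scope.

(** * Smooth test functions *)

Section flat.
Context {R : realType}.
(** For fixed k this is the function x^-k exp (- 1 / x), extended by 0.  The
whole family is introduced because it is stable under differentiation, which
turns the smoothness of exp (- 1 / x) into an induction on expressions. *)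
Definition flat (k : nat) (x : R) : R :=
  if 0 < x then x^-1 ^+ k * expR (- x^-1) else 0.

(** Linear decay at 0 for every k: applied to k + 1 it gives the vanishing of
the difference quotients of flat k at 0. *)
Lemma flat_le k (x : R) : 0 <= flat k x <= k.+1%:R ^+ k.+1 * `|x|.
Proof.
rewrite /flat; case: ifPn => [x0|_]; last first.
  by rewrite lexx/= mulr_ge0// exprn_ge0.
rewrite mulr_ge0 ?expR_ge0 ?exprn_ge0 ?invr_ge0 ?(ltW x0)//=.
rewrite gtr0_norm// expRN ler_pdivrMr ?expR_gt0//.
have y0 : 0 < x^-1 by rewrite invr_gt0.
set y := x^-1 in y0 *; have -> : x = y^-1 by rewrite /y invrK.
have ek : y ^+ k.+1 <= k.+1%:R ^+ k.+1 * expR y.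
  have -> : expR y = expR (y / k.+1%:R) ^+ k.+1.
    by rewrite -expRM_natl mulrC divfK.
  rewrite -exprMn ler_pXn2r ?nnegrE ?mulr_ge0 ?expR_ge0 ?(ltW y0)//.
  have : y / k.+1%:R <= expR (y / k.+1%:R).
    by rewrite (le_trans _ (expR_ge1Dx _))// lerDr.
  by rewrite ler_pdivrMr// (mulrC (expR _)).
by rewrite mulrAC ler_pdivlMr// -exprSr.
Qed.

Lemma is_derive_flat k (x : R) :
  is_derive x 1 (flat k) (flat k.+2 x - k%:R * flat k.+1 x).
Proof.
have [x0|x0|->] := ltgtP x 0.
- apply: (@near_eq_is_derive _ _ _ (cst 0)).
    near=> y; rewrite /flat ltNge ltW//.
    by near: y; exact: lt_nbhsl.
  apply: is_derive_eq.
  by rewrite /flat !ltNge (ltW x0)/= mulr0 subrr.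
- pose g (y : R) : R := y^-1 ^+ k * expR (- y^-1).
  apply: (@near_eq_is_derive _ _ _ g).
  + near=> y; rewrite /flat ifT//.
    by near: y; exact: lt_nbhsr.
  + have xn0 : x != 0 by rewrite gt_eqF.
    have dV : is_derive x (1:R) (fun x : R => x^-1) (- x^-1 ^+ 2).
      have := @is_deriveV R id x 1 1 xn0 (is_derive_id x 1).
      by move/is_derive_eq; apply; rewrite exprVn /GRing.scale/= mulr1.
    have dE : is_derive x (1:R) (fun x : R => expR (- x^-1))
                (expR (- x^-1) * x^-1 ^+ 2).
      have := @is_derive1_comp R expR (fun y => - y^-1) x _ _ (is_derive_expR _)
        (is_deriveN dV).
      by move/is_derive_eq; apply; rewrite opprK.
    have dX : is_derive x (1:R) (fun x : R => x^-1 ^+ k) (- k%:R * x^-1 ^+ k.+1).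
      have := @is_deriveX R R (fun x : R => x^-1) k x 1 _ dV.
      rewrite exprfctE => /is_derive_eq; apply; rewrite /GRing.scale/=.
      case: (k) => [|j]; first by rewrite !mul0r oppr0 mul0r.
      by rewrite !exprS/=; ring.
    apply: is_derive_eq.
    by rewrite /flat x0/= /GRing.scale/= !exprS; ring.
- rewrite /flat !ltxx mulr0 subrr -/(flat k).
  have L : h^-1 *: (flat k (h *: 1 + 0) - flat k 0) @[h --> (0:R)^'] --> (0:R).
    apply/cvgrPdist_le => e e0; near=> h.
    have -> : h^-1 *: (flat k (h *: 1 + 0) - flat k 0) = flat k.+1 h.
      rewrite addr0 /flat ltxx subr0 /GRing.scale/= mulr1.
      by case: ifP => _; rewrite ?mulr0// exprS mulrA.
    have /andP[f0 fC] := flat_le k.+1 h.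
    rewrite sub0r normrN ger0_norm// (le_trans fC)//.
    rewrite -ler_pdivlMl ?exprn_gt0//.
    near: h; apply: dnbhs0_le.
    by rewrite mulr_gt0// invr_gt0 exprn_gt0.
  by apply: DeriveDef; [exact: cvgP L|exact: cvg_lim L].
Unshelve. all: by end_near.
Qed.
End flat.

Section smooth.
Context {R : realType} {E : normedModType R}.

(** Expressions that are visibly closed under directional derivatives
(smooth_derive), so that membership gives all orders of differentiability. *)
Inductive smooth : (E -> R) -> Prop :=
| smooth_cst a : smooth (fun _ => a)
| smooth_lin f : (forall p, differentiable f p) ->
    (forall p v, 'D_v f p = 'D_v f 0) -> smooth f
| smoothD f g : smooth f -> smooth g -> smooth (fun p => f p + g p)
| smoothM f g : smooth f -> smooth g -> smooth (fun p => f p * g p)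
| smooth_flat k f : smooth f -> smooth (fun p => flat k (f p))
| smoothV f : (forall p, f p != 0) -> smooth f -> smooth (fun p => (f p)^-1).

Lemma smooth_diff f : smooth f -> forall p, differentiable f p.
Proof.
elim=> {f}.
- by move=> a p; exact: differentiable_cst.
- by [].
- by move=> f g _ df _ dg p; exact: differentiableD.
- by move=> f g _ df _ dg p; exact: differentiableM.
- move=> k f _ df p; apply: differentiable_comp => //.
  by apply/derivable1_diffP; have [] := is_derive_flat k (f p).
- by move=> f f0 _ df p; exact: differentiableV.
Qed.

Lemma derive_flat k (f : E -> R) p v : differentiable f p ->
  'D_v (fun p => flat k (f p)) p =
  (flat k.+2 (f p) - k%:R * flat k.+1 (f p)) * 'D_v f p.
Proof.
move=> df.
have dF : differentiable (flat k) (f p).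
  by apply/derivable1_diffP; have [] := is_derive_flat k (f p).
rewrite deriveE; last exact: differentiable_comp.
rewrite diff_comp//= deriveE//.
have [_ <-] := is_derive_flat k (f p).
rewrite deriveE//.
by rewrite -[in LHS](mulr1 ('d f p v)) -[_ * 1]/(_ *: 1) linearZ/= mulrC.
Qed.

Lemma smooth_derive (f : E -> R) v : smooth f -> smooth (fun p => 'D_v f p).
Proof.
elim=> {f}.
- move=> a; rewrite (_ : (fun p => _) = fun _ : E => 0 : R); first exact: smooth_cst.
  by apply/funext => p; exact: derive_cst.
- move=> f df cf; rewrite (_ : (fun p => _) = fun _ : E => 'D_v f 0 : R).
    exact: smooth_cst.
  by apply/funext => p.
- move=> f g sf df sg dg.
  rewrite (_ : (fun p => _) = fun p => 'D_v f p + 'D_v g p).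
    exact: smoothD.
  by apply/funext => p; apply: deriveD; apply/diff_derivable/smooth_diff.
- move=> f g sf df sg dg.
  rewrite (_ : (fun p => _) = fun p => f p * 'D_v g p + g p * 'D_v f p).
    by apply: smoothD; apply: smoothM.
  by apply/funext => p; apply: deriveM; apply/diff_derivable/smooth_diff.
- move=> k f sf df.
  rewrite (_ : (fun p => _) = fun p =>
    (flat k.+2 (f p) + (- k%:R) * flat k.+1 (f p)) * 'D_v f p).
    apply: smoothM => //; apply: smoothD; first exact: smooth_flat.
    by apply: smoothM; [exact: smooth_cst|exact: smooth_flat].
  by apply/funext => p; rewrite derive_flat ?mulNr//; exact: smooth_diff.
- move=> f f0 sf df.
  rewrite (_ : (fun p => _) = fun p => (-1) * ((f p)^-1 * (f p)^-1) * 'D_v f p).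
    apply: smoothM => //; apply: smoothM; first exact: smooth_cst.
    by apply: smoothM; exact: smoothV.
  apply/funext => p; rewrite deriveV//; last exact/diff_derivable/smooth_diff.
  by rewrite mulN1r -expr2 exprVn.
Qed.

Lemma smooth_continuous f : smooth f -> continuous f.
Proof. by move=> sf p; exact/differentiable_continuous/smooth_diff. Qed.

Lemma smooth_class_C n f : smooth f -> class_C n f.
Proof.
elim: n f => [|n IH] f sf /=; split => //; try exact: smooth_continuous.
move=> v; split; first by move=> p; exact/diff_derivable/smooth_diff.
exact/IH/smooth_derive.
Qed.

Lemma smooth_test (f : E -> R) K : smooth f -> compact K -> closed K ->
  (forall p, f p != 0 -> K p) -> test_function f.
Proof.
move=> sf cK clK fK; split; first by move=> n; exact: smooth_class_C.
apply: (subclosed_compact _ cK); first exact: closed_closure.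
by rewrite closureE => p; apply; split => // q; exact: fK.
Qed.
End smooth.

Section coord.
Context {R : realType}.

Lemma smooth_linear (E : normedModType R) (l : {linear E -> R}) :
  continuous l -> smooth l.
Proof.
move=> cl; have dl p : differentiable l p by apply: linear_differentiable; exact: cl.
apply: smooth_lin => // p v.
by rewrite !deriveE// !diff_lin//; exact: cl.
Qed.

Lemma fst_continuous (U W : topologicalType) : continuous (@fst U W).
Proof. by move=> p; exact: cvg_fst. Qed.
Lemma snd_continuous (U W : topologicalType) : continuous (@snd U W).
Proof. by move=> p; exact: cvg_snd. Qed.

Lemma smooth_fst2 : smooth (fun p : R * R => p.1).
Proof. by apply: (@smooth_linear _ fst) => /= p; exact: cvg_fst. Qed.
Lemma smooth_snd2 : smooth (fun p : R * R => p.2).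
Proof. by apply: (@smooth_linear _ snd) => /= p; exact: cvg_snd. Qed.
Lemma smooth_fst3 : smooth (fun p : R * R * R => p.1.1).
Proof.
apply: (@smooth_linear _ (fst \o fst)) => /= p.
by apply: (@continuous_comp _ _ _ fst fst); exact: fst_continuous.
Qed.
Lemma smooth_mid3 : smooth (fun p : R * R * R => p.1.2).
Proof.
apply: (@smooth_linear _ (snd \o fst)) => /= p.
by apply: (@continuous_comp _ _ _ fst snd); [exact: fst_continuous|exact: snd_continuous].
Qed.
Lemma smooth_snd3 : smooth (fun p : R * R * R => p.2).
Proof. by apply: (@smooth_linear _ snd) => /= p; exact: cvg_snd. Qed.

End coord.

(** * Null sets, shears and rectangles in the plane *)

Section ae.
Context d (T : measurableType d) (R : realType) (m : {measure set T -> \bar R}).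
Lemma ae_mp (P Q : T -> Prop) :
  {ae m, forall x, P x} -> (forall x, P x -> Q x) -> {ae m, forall x, Q x}.
Proof. by move=> aeP PQ; apply: filterS aeP. Qed.
Lemma ae_mp2 (P Q S : T -> Prop) :
  {ae m, forall x, P x} -> {ae m, forall x, Q x} ->
  (forall x, P x -> Q x -> S x) -> {ae m, forall x, S x}.
Proof. by move=> aeP aeQ PQ; apply: filterS2 aeP aeQ. Qed.
End ae.

Section ae_product.
Context d1 d2 (T1 : measurableType d1) (T2 : measurableType d2) (R : realType).
Variable m1 : {sigma_finite_measure set T1 -> \bar R}.
Variable m2 : {sigma_finite_measure set T2 -> \bar R}.

Lemma integral0_ae d (T : measurableType d) (m : {measure set T -> \bar R})
    (h : T -> \bar R) : measurable_fun setT h -> (forall x, (0 <= h x)%E) ->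
  (\int[m]_x h x)%E = 0%E <-> {ae m, forall x, h x = 0%E}.
Proof.
move=> mh h0; have -> : (\int[m]_x h x = \int[m]_x `|h x|)%E.
  by apply: eq_integral => x _; rewrite gee0_abs.
rewrite (ae_eq_integral_abs m (@measurableT _ T) mh).
by split; apply: filterS => x /= H; [exact: H|move=> _; exact: H].
Qed.

Lemma product_measure_ysection (N : set (T1 * T2)) : measurable N ->
  ((m1 \x m2) N = \int[m2]_y m1 (ysection N y))%E.
Proof.
move=> mN; rewrite -[LHS]mul1e -[1%E]/(1%:E)%E -[LHS]integral_cst//.
rewrite -[LHS]/(\int[m1 \x m2]_(x in N) 1%:E)%E.
rewrite integral_mkcond.
have -> : ((fun=> 1%:E) \_ N : _ -> \bar R) = fun p => (\1_N p)%:E.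
  by apply/funext => p; rewrite patchE indicE; case: (p \in N).
have m1N : measurable_fun setT (fun p => (\1_N p)%:E : \bar R).
  exact/measurable_EFinP/measurable_indic.
rewrite (fubini_tonelli2 _ m1N); last by move=> p; rewrite lee_fin.
apply: eq_integral => y _; rewrite /fubini_G.
rewrite -[RHS]mul1e -[RHS]integral_cst; last exact: measurable_ysection.
rewrite [RHS]integral_mkcond; apply: eq_integral => x _.
rewrite patchE indicE mem_ysection; by case: ((x, y) \in N).
Qed.

Lemma ae_prod_split (P : T1 * T2 -> Prop) : {ae (m1 \x m2)%E, forall p, P p} ->
  {ae m1, forall x, {ae m2, forall y, P (x, y)}}.
Proof.
move=> [N [mN N0 PN]].
have : {ae m1, forall x, m2 (xsection N x) = 0%E}.
  by apply/integral0_ae => //; exact: measurable_fun_xsection.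
apply: filterS => x xN0; exists (xsection N x); split => //.
  exact: measurable_xsection.
by move=> y /= Pxy; rewrite /xsection/= inE; apply: PN.
Qed.

Lemma ae_prod_split2 (P : T1 * T2 -> Prop) : {ae (m1 \x m2)%E, forall p, P p} ->
  {ae m2, forall y, {ae m1, forall x, P (x, y)}}.
Proof.
move=> [N [mN N0 PN]].
have : {ae m2, forall y, m1 (ysection N y) = 0%E}.
  apply/integral0_ae => //; first exact: measurable_fun_ysection.
  by rewrite -product_measure_ysection.
apply: filterS => y yN0; exists (ysection N y); split => //.
  exact: measurable_ysection.
by move=> x /= Pxy; rewrite /ysection/= inE; apply: PN.
Qed.

Lemma ae_measure_setC0 d (T : measurableType d) (m : {measure set T -> \bar R})
    (P : T -> Prop) : measurable [set x | P x] ->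
  {ae m, forall x, P x} -> m [set x | ~ P x] = 0%E.
Proof. by move=> mP /negligibleP; apply; exact: measurableC. Qed.

(** The measurability hypothesis allows the null set of exceptional points to
be computed by Tonelli. *)
Lemma ae_prod_join (P : T1 * T2 -> Prop) : measurable [set p | P p] ->
  {ae m1, forall x, {ae m2, forall y, P (x, y)}} ->
  {ae (m1 \x m2)%E, forall p, P p}.
Proof.
move=> mP aeP; exists [set p | ~ P p]; split => //; first exact: measurableC.
have mN : measurable [set p | ~ P p] by exact: measurableC.
rewrite /product_measure1; apply/integral0_ae => //=.
  exact: measurable_fun_xsection.
apply: filterS aeP => x aex.
have -> : xsection [set p | ~ P p] x = [set y | ~ P (x, y)].
  by apply/seteqP; split => y; rewrite /xsection/= inE.
apply: ae_measure_setC0 => //.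
have := measurable_xsection x mP.
rewrite (_ : xsection _ _ = [set y | P (x, y)])//.
by apply/seteqP; split => y; rewrite /xsection/= inE.
Qed.


Lemma ae_prod_fst (P : T1 -> Prop) : {ae m1, forall x, P x} ->
  {ae (m1 \x m2)%E, forall p, P p.1}.
Proof.
move=> [N [mN N0 PN]]; exists (N `*` setT); split.
- exact: measurableX.
- by rewrite product_measure1E// [X in (X * _)%E]N0 mul0e.
- by move=> p /= Pp; split => //; exact: PN.
Qed.

Lemma ae_prod_snd (P : T2 -> Prop) : {ae m2, forall y, P y} ->
  {ae (m1 \x m2)%E, forall p, P p.2}.
Proof.
move=> [N [mN N0 PN]]; exists (setT `*` N); split.
- exact: measurableX.
- by rewrite product_measure1E// [X in (_ * X)%E]N0 mule0.
- by move=> p /= Pp; split => //; exact: PN.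
Qed.
End ae_product.

Section shear.
Context {R : realType}.
Notation mu := (@lebesgue_measure R).
Notation mu2 := (mu \x mu)%E.

Lemma lebesgue_measure_shift (a : R) (A : set R) : measurable A ->
  mu ((fun x => x + a) @^-1` A) = mu A.
Proof.
move=> mA; apply/esym.
have mS : measurable_fun setT (fun x : measurableTypeR R => x + a : measurableTypeR R).
  exact: measurable_funD.
apply: (@lebesgue_measure_unique R (pushforward mu (fun x => x + a : measurableTypeR R))) => //.
move=> _ [[b c] _ <-] /=.
rewrite -[RHS]/(mu ((fun x => x + a) @^-1` `]b, c]%classic)).
rewrite (_ : _ @^-1` _ = `]b - a, c - a]%classic); last first.
  by apply/seteqP; split => x /=; rewrite !in_itv/= ltrBlDr lerBrDr.
by rewrite !lebesgue_measure_itv/= !lte_fin ltrD2r -!EFinB opprB addrA subrK.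
Qed.

(** Free transport during a fixed time is a shear of the (x, v) plane. *)
Definition shear (s : R -> R) (p : R * R) : R * R := (p.1 + s p.2, p.2).

Lemma measurable_shear s : measurable_fun setT s ->
  measurable_fun [set: R * R] (shear s).
Proof.
move=> ms; apply: measurable_fun_pair => //=.
by apply: measurable_funD => //; exact: measurableT_comp.
Qed.

(** Each horizontal line of the plane is merely translated. *)
Lemma measure_shear s (A : set (R * R)) : measurable_fun setT s ->
  measurable A -> mu2 (shear s @^-1` A) = mu2 A.
Proof.
move=> ms mA; have mB : measurable (shear s @^-1` A).
  by rewrite -[X in measurable X]setTI; exact: measurable_shear.
rewrite !product_measure_ysection//; apply: eq_integral => y _.
have -> : ysection (shear s @^-1` A) y =
    (fun x => x + s y) @^-1` (ysection A y).
  by apply/seteqP; split => x; rewrite /ysection/= !inE/= /shear/=.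
exact: lebesgue_measure_shift (measurable_ysection y mA).
Qed.

Lemma ae_shear s (P : R * R -> Prop) : measurable_fun setT s ->
  {ae mu2, forall p, P p} -> {ae mu2, forall p, P (shear s p)}.
Proof.
move=> ms [N [mN N0 PN]]; exists (shear s @^-1` N); split.
- by rewrite -[X in measurable X]setTI; exact: measurable_shear.
- by rewrite measure_shear.
- by move=> p /= Pp; apply: PN.
Qed.

Lemma ge0_integral_shear s (h : R * R -> \bar R) : measurable_fun setT s ->
  measurable_fun setT h -> (forall p, (0 <= h p)%E) ->
  (\int[mu2]_p h (shear s p) = \int[mu2]_p h p)%E.
Proof.
move=> ms mh h0.
pose T2 := (measurableTypeR R * measurableTypeR R)%type.
have := @ge0_integral_pushforward _ _ T2 T2 R (shear s) (measurable_shear ms)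
  mu2 setT h measurableT mh (fun p _ => h0 p).
rewrite preimage_setT => <-; apply: eq_measure_integral => [|mS A mA _].
  exact: measurable_shear.
exact: measure_shear ms mA.
Qed.

Lemma integrable_shear s (h : R * R -> \bar R) : measurable_fun setT s ->
  mu2.-integrable setT h -> mu2.-integrable setT (h \o shear s).
Proof.
move=> ms /integrableP[mh ih]; apply/integrableP; split.
  by apply: measurableT_comp => //; exact: measurable_shear.
have mah : measurable_fun setT (abse \o h) by exact: measurableT_comp.
by have := ge0_integral_shear ms mah (fun p => abse_ge0 (h p)) => /= ->.
Qed.

Lemma integral_shear s (h : R * R -> \bar R) : measurable_fun setT s ->
  mu2.-integrable setT h ->
  (\int[mu2]_p h (shear s p) = \int[mu2]_p h p)%E.
Proof.
move=> ms ih; have /integrableP[mh _] := ih.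
rewrite [LHS]integralE [RHS]integralE.
congr (_ - _)%E.
- have mp : measurable_fun setT h^\+%E by exact: measurable_funepos.
  rewrite -(ge0_integral_shear ms mp (funepos_ge0 h)).
  by apply: eq_integral => p _; rewrite unlock.
- have mp : measurable_fun setT h^\-%E by exact: measurable_funeneg.
  rewrite -(ge0_integral_shear ms mp (funeneg_ge0 h)).
  by apply: eq_integral => p _; rewrite unlock.
Qed.

Lemma Rintegral_shear s (h : R * R -> R) : measurable_fun setT s ->
  mu2.-integrable setT (EFin \o h) ->
  \int[mu2]_p h (shear s p) = \int[mu2]_p h p.
Proof. by move=> ms ih; congr fine; exact: (integral_shear ms ih). Qed.
End shear.

Section density.
Context {R : realType}.
Notation mu := (@lebesgue_measure R).
Notation mu2 := (mu \x mu)%E.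

Definition rects : set (set (R * R)) :=
  [set `]q.1.1, q.1.2]%classic `*` `]q.2.1, q.2.2]%classic
    | q in [set: (R * R) * (R * R)] ].

Lemma measurable_rects : (@measurable _ (measurableTypeR R * measurableTypeR R)%type) = <<s rects >>.
Proof.
rewrite eqEsubset; split; last first.
  apply: smallest_sub; first exact: sigma_algebra_measurable.
  by move=> _ [q _ <-]; apply: measurableX.
rewrite measurable_prod_measurableType.
apply: smallest_sub; first exact: smallest_sigma_algebra.
move=> _ [A mA] [B mB] <-.
have cover : \bigcup_k `]- k%:R, k%:R]%classic = [set: R].
  apply/seteqP; split => // x _; exists (Num.truncn `|x|).+1 => //=.
  rewrite in_itv/=.
  by have := truncnS_gt `|x|; rewrite ltr_norml => /andP[-> /ltW ->].
have mAT (A' : set R) : measurable A' -> <<s rects >> (A' `*` setT).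
  pose S := [set A' | <<s rects >> (A' `*` [set: R])].
  suff : <<s @ocitv R >> `<=` S by apply.
  apply: smallest_sub; first split.
  - by rewrite /S/= set0X; exact: sigma_algebra0.
  - move=> C; rewrite /S/= => SC.
    have -> : (setT `\` C) `*` [set: R] = setT `\` (C `*` [set: R]).
      by apply/seteqP; split => -[x y]/=; tauto.
    exact: sigma_algebraCD.
  - move=> F SF; rewrite /S/=.
    have -> : (\bigcup_i F i) `*` [set: R] = \bigcup_i (F i `*` [set: R]).
      apply/seteqP; split => -[x y]/=.
        by move=> [[i _ Fi] _]; exists i.
      by move=> [i _ [Fi _]]; split => //; exists i.
    exact: sigma_algebra_bigcup.
  - move=> _ [[a b] _ <-]; rewrite /S/= -cover.
    have -> : `]a, b]%classic `*` (\bigcup_k `](- k%:R)%R, k%:R%R]%classic) =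
        \bigcup_k (`]a, b]%classic `*` `]- k%:R, k%:R]%classic) :> set (R * R).
      apply/seteqP; split => -[x y]/=.
        by move=> [xab [k _ yk]]; exists k.
      by move=> [k _ [xab yk]]; split => //; exists k.
    apply: sigma_algebra_bigcup => k; apply: sub_sigma_algebra.
    by exists ((a, b), (- k%:R, k%:R)).
have mTB (B' : set R) : measurable B' -> <<s rects >> (setT `*` B').
  pose S := [set A' | <<s rects >> ([set: R] `*` A')].
  suff : <<s @ocitv R >> `<=` S by apply.
  apply: smallest_sub; first split.
  - by rewrite /S/= setX0; exact: sigma_algebra0.
  - move=> C; rewrite /S/= => SC.
    have -> : [set: R] `*` (setT `\` C) = setT `\` ([set: R] `*` C).
      by apply/seteqP; split => -[x y]/=; tauto.
    exact: sigma_algebraCD.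
  - move=> F SF; rewrite /S/=.
    have -> : [set: R] `*` (\bigcup_i F i) = \bigcup_i ([set: R] `*` F i).
      apply/seteqP; split => -[x y]/=.
        by move=> [_ [i _ Fi]]; exists i.
      by move=> [i _ [_ Fi]]; split => //; exists i.
    exact: sigma_algebra_bigcup.
  - move=> _ [[a b] _ <-]; rewrite /S/= -cover.
    have -> : (\bigcup_k `](- k%:R)%R, k%:R%R]%classic) `*` `]a, b]%classic =
        \bigcup_k (`]- k%:R, k%:R]%classic `*` `]a, b]%classic) :> set (R * R).
      apply/seteqP; split => -[x y]/=.
        by move=> [[k _ yk] xab]; exists k.
      by move=> [k _ [yk xab]]; split => //; exists k.
    apply: sigma_algebra_bigcup => k; apply: sub_sigma_algebra.
    by exists ((- k%:R, k%:R), (a, b)).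
have -> : A `*` B = (A `*` setT) `&` (setT `*` B).
  by apply/seteqP; split => -[x y]/=; tauto.
have /sigma_algebraP : sigma_algebra setT <<s rects >>.
  exact: smallest_sigma_algebra.
by case=> // _ _ _; apply; [exact: mAT|exact: mTB].
Qed.


Section mdensity.
Context d (T : measurableType d) (m : {measure set T -> \bar R}).
Variables (k : T -> \bar R) (mk : measurable_fun setT k) (k0 : forall x, (0 <= k x)%E).

Definition mdensity of measurable_fun setT k & (forall x, (0 <= k x)%E) :=
  fun A : set T => (\int[m]_(x in A) k x)%E.

Let nu := mdensity mk k0.

Let nu0 : nu set0 = 0%E.
Proof. by rewrite /nu /mdensity integral_set0. Qed.

Let nu_ge0 A : (0 <= nu A)%E.
Proof. by apply: integral_ge0 => x _; exact: k0. Qed.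

Let nu_sigma_additive : semi_sigma_additive nu.
Proof.
move=> F mF tF mUF; rewrite /nu /mdensity ge0_integral_bigcup//.
  by apply: is_cvg_nneseries => n _ _; exact: nu_ge0.
exact: measurable_funTS.
Qed.

HB.instance Definition _ := isMeasure.Build _ _ _ nu nu0 nu_ge0 nu_sigma_additive.
End mdensity.

(** The positive and negative parts of h are the densities of two measures that
agree on half-open rectangles, a pi-system generating the Borel sets; so they
agree on the sets where h is positive, respectively negative. *)
Lemma rect_ae0 (h : R * R -> R) :
  measurable_fun setT h ->
  (forall B, rects B -> mu2.-integrable B (EFin \o h)) ->
  (forall B, rects B -> (\int[mu2]_(p in B) (h p)%:E = 0)%E) ->
  {ae mu2, forall p, h p = 0}.
Proof.
move=> mh ih h0.
have mH : measurable_fun setT (EFin \o h) by exact/measurable_EFinP.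
have mp : measurable_fun setT (EFin \o h)^\+%E by exact: measurable_funepos.
have mn : measurable_fun setT (EFin \o h)^\-%E by exact: measurable_funeneg.
have mB B : rects B -> @measurable _ (measurableTypeR R * measurableTypeR R)%type B.
  by move=> [q _ <-]; exact: measurableX.
have E A : measurable A ->
  mdensity mu2 mp (funepos_ge0 _) A = mdensity mu2 mn (funeneg_ge0 _) A.
  pose g (k : nat) := (`]- k%:R, k%:R] `*` `]- k%:R, k%:R])%classic : set (R * R).
  pose T2 := (measurableTypeR R * measurableTypeR R)%type.
  apply: (@measure_unique _ R T2 rects g _ _ _ _
    (mdensity mu2 mp (funepos_ge0 _)) (mdensity mu2 mn (funeneg_ge0 _))).
  - exact: measurable_rects.
  - move=> _ _ [[[a b] [c d]] _ <-] [[[a' b'] [c' d']] _ <-] /=.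
    have /= [q1 _ q1E] := ocitvI (is_ocitv a b) (is_ocitv a' b').
    have /= [q2 _ q2E] := ocitvI (is_ocitv c d) (is_ocitv c' d').
    exists (q1, q2) => //=; rewrite q1E q2E.
    by apply/seteqP; split => -[x y]/=; tauto.
  - by move=> k; exists ((- k%:R, k%:R), (- k%:R, k%:R)).
  - apply/seteqP; split => // -[x y] _.
    exists (Num.truncn (Num.max `|x| `|y|)).+1 => //; rewrite /g/= !in_itv/=.
    have := truncnS_gt (Num.max `|x| `|y|).
    rewrite gt_max !ltr_norml => /andP[/andP[-> /ltW->] /andP[-> /ltW->]].
    by [].
  - move=> B rB; have := h0 B rB.
    have f1 := integrable_pos_fin_num (mB _ rB) (ih _ rB).
    have f2 := integrable_neg_fin_num (mB _ rB) (ih _ rB).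
    rewrite integralE -(fineK f1) -(fineK f2) -EFinB => -[/eqP].
    rewrite subr_eq0 => /eqP fE.
    by rewrite /= /mdensity -(fineK f1) -(fineK f2) fE.
  - move=> k; apply: integral_funepos_lt_pinfty.
      by apply: mB; exists ((- k%:R, k%:R), (- k%:R, k%:R)).
    by apply: ih; exists ((- k%:R, k%:R), (- k%:R, k%:R)).
have mpos : measurable [set p | 0 < h p].
  rewrite -[X in measurable X]setTI (_ : [set p | _] = h @^-1` `]0, +oo[).
    exact: mh.
  by apply/seteqP; split => p /=; rewrite in_itv/= andbT.
have mneg : measurable [set p | h p < 0].
  rewrite -[X in measurable X]setTI (_ : [set p | _] = h @^-1` `]-oo, 0[).
    exact: mh.
  by apply/seteqP; split => p /=; rewrite in_itv.
have Ip : {ae mu2, forall p : R * R, (0 < h p)%R -> h p = 0%R}.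
  have := E _ mpos; rewrite /mdensity.
  rewrite [RHS](_ : _ = 0)%E; last first.
    rewrite -[RHS](integral0 mu2 [set p | (0 < h p)%R]); apply: eq_integral => p.
    rewrite inE/= => hp; rewrite funenegE/=; apply/max_idPr.
    by rewrite lee_fin oppr_le0 ltW.
  have -> : (\int[mu2]_(x in [set p | (0 < h p)%R]) (EFin \o h)^\+ x =
     \int[mu2]_(x in [set p | (0 < h p)%R]) `|(h x)%:E|)%E.
    apply: eq_integral => p; rewrite inE/= => hp; rewrite funeposE/= ger0_norm ?ltW//.
    by apply/max_idPl; rewrite lee_fin ltW.
  have mf := measurable_funTS (D := [set p | 0 < h p]) mH.
  move/(ae_eq_integral_abs mu2 mpos mf).
  by apply: filterS => p /= H /H [].
have In : {ae mu2, forall p : R * R, (h p < 0)%R -> h p = 0%R}.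
  have := E _ mneg; rewrite /mdensity => /esym.
  rewrite [RHS](_ : _ = 0)%E; last first.
    rewrite -[RHS](integral0 mu2 [set p | (h p < 0)%R]); apply: eq_integral => p.
    rewrite inE/= => hp; rewrite funeposE/=; apply/max_idPr.
    by rewrite lee_fin ltW.
  have -> : (\int[mu2]_(x in [set p | (h p < 0)%R]) (EFin \o h)^\- x =
     \int[mu2]_(x in [set p | (h p < 0)%R]) `|(h x)%:E|)%E.
    apply: eq_integral => p; rewrite inE/= => hp; rewrite funenegE/= ltr0_norm//.
    by apply/max_idPl; rewrite lee_fin oppr_ge0 ltW.
  have mf := measurable_funTS (D := [set p | h p < 0]) mH.
  move/(ae_eq_integral_abs mu2 mneg mf).
  by apply: filterS => p /= H /H [].
apply: (ae_mp2 Ip In) => p Hp Hn.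
by have [/Hn|/Hp|] := ltgtP (h p) 0.
Qed.
End density.

(** * Bumps approximating rectangles *)

Section bdd.
Context d (T : measurableType d) (R : realType) (m : {measure set T -> \bar R}).

Lemma bdd_integrable (f : T -> R) (D : set T) (C : R) :
  measurable_fun setT f -> measurable D -> (m D < +oo)%E ->
  (forall x, `|f x| <= C * \1_D x) -> m.-integrable setT (EFin \o f).
Proof.
move=> mf mD Dfin fC; apply/integrableP; split; first exact/measurable_EFinP.
have C0 x : D x -> 0 <= C.
  move=> Dx; have := le_trans (normr_ge0 _) (fC x).
  by rewrite indicE mem_set// mulr1.
apply: (@le_lt_trans _ _ (\int[m]_x (`|C| * \1_D x)%:E)%E).
  apply: ge0_le_integral => //.
  - by apply: measurableT_comp => //; exact/measurable_EFinP.
  - exact/measurable_EFinP/measurable_funM.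
  - by move=> x _ /=; rewrite lee_fin (le_trans (fC x))// ler_wpM2r// ler_norm.
under eq_integral do rewrite EFinM.
rewrite ge0_integralZl//=; last exact/measurable_EFinP.
by rewrite integral_indic// setIT lte_mul_pinfty// lee_fin.
Qed.
End bdd.

Section Rfubini.
Context d1 d2 (T1 : measurableType d1) (T2 : measurableType d2) (R : realType).
Variable m1 : {sigma_finite_measure set T1 -> \bar R}.
Variable m2 : {sigma_finite_measure set T2 -> \bar R}.

Lemma Rfubini (f : T1 * T2 -> R) :
  (m1 \x m2)%E.-integrable setT (EFin \o f) ->
  (forall x, m2.-integrable setT (fun y => (f (x, y))%:E)) ->
  (forall y, m1.-integrable setT (fun x => (f (x, y))%:E)) ->
  \int[m1]_x \int[m2]_y f (x, y) = \int[m2]_y \int[m1]_x f (x, y).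
Proof.
move=> intf i2 i1; rewrite /Rintegral.
under eq_integral do rewrite fineK ?(integrable_fin_num _ (i2 _))//.
under [in RHS]eq_integral do rewrite fineK ?(integrable_fin_num _ (i1 _))//.
by rewrite (Fubini intf).
Qed.

Lemma measurable_Rint2 (f : T1 * T2 -> R) : measurable_fun setT f ->
  measurable_fun setT (fun x => \int[m2]_y f (x, y)).
Proof.
move=> mf; have mF : measurable_fun setT (EFin \o f) by exact/measurable_EFinP.
have mp : measurable_fun setT (EFin \o f)^\+%E by exact: measurable_funepos.
have mn : measurable_fun setT (EFin \o f)^\-%E by exact: measurable_funeneg.
apply: measurableT_comp => //.
rewrite (_ : (fun x => _) = (fun x => fubini_F m2 (EFin \o f)^\+ x - fubini_F m2 (EFin \o f)^\- x)%E).
  by apply: emeasurable_funB; apply: measurable_fun_fubini_tonelli_F.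
by apply/funext => x; rewrite integralE /fubini_F; congr (_ - _)%E;
  apply: eq_integral => y _; rewrite ?funeposE ?funenegE.
Qed.

Lemma measurable_Rint1 (f : T1 * T2 -> R) : measurable_fun setT f ->
  measurable_fun setT (fun y => \int[m1]_x f (x, y)).
Proof.
move=> mf; have mF : measurable_fun setT (EFin \o f) by exact/measurable_EFinP.
have mp : measurable_fun setT (EFin \o f)^\+%E by exact: measurable_funepos.
have mn : measurable_fun setT (EFin \o f)^\-%E by exact: measurable_funeneg.
apply: measurableT_comp => //.
rewrite (_ : (fun x => _) = (fun x => fubini_G m1 (EFin \o f)^\+ x - fubini_G m1 (EFin \o f)^\- x)%E).
  by apply: emeasurable_funB; apply: measurable_fun_fubini_tonelli_G.
by apply/funext => x; rewrite integralE /fubini_G; congr (_ - _)%E;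
  apply: eq_integral => y _; rewrite ?funeposE ?funenegE.
Qed.
End Rfubini.

Section bump.
Context {R : realType}.
Implicit Types (a b x : R) (n k : nat).

Lemma flat_ge0 k x : 0 <= flat k x.
Proof. by have /andP[] := flat_le k x. Qed.

Lemma flat0_le1 x : flat 0 x <= 1.
Proof.
rewrite /flat; case: ifPn => // x0; rewrite expr0 mul1r.
by rewrite -expR0 ler_expR oppr_le0 invr_ge0 ltW.
Qed.

Lemma flat0_neq0 x : flat 0 x != 0 -> 0 < x.
Proof. by rewrite /flat; case: ifPn => //; rewrite eqxx. Qed.

Lemma continuous_flat k : continuous (@flat R k).
Proof.
move=> x; apply/differentiable_continuous/derivable1_diffP.
by have [] := is_derive_flat k x.
Qed.

Lemma measurable_flat k : measurable_fun setT (@flat R k).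
Proof. apply: continuous_measurable_fun; exact: continuous_flat. Qed.

(** Tends to the indicator of ]a, b] (bump_cvg): the second factor is positive
up to b + 1 / (n + 1), which keeps the end point b in the limit. *)
Definition bump n a b x : R :=
  flat 0 (n.+1%:R * (x - a)) * flat 0 (n.+1%:R * (n.+1%:R * (b - x) + 1)).

Lemma bump_ge0 n a b x : 0 <= bump n a b x.
Proof. by rewrite mulr_ge0 ?flat_ge0. Qed.

Lemma bump_le1 n a b x : bump n a b x <= 1.
Proof. by rewrite mulr_ile1 ?flat_ge0 ?flat0_le1. Qed.

Lemma bump_supp n a b x : bump n a b x != 0 -> a < x < b + 1.
Proof.
rewrite mulf_eq0 negb_or => /andP[/flat0_neq0 + /flat0_neq0].
rewrite !pmulr_rgt0// subr_gt0 => -> /= h.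
rewrite -ltrBlDl; have [//|h1] := ltP (x - b) 1; exfalso; move: h.
apply/negP; rewrite -leNgt.
have : x - b <= n.+1%:R * (x - b) by rewrite ler_peMl ?ler1n// (le_trans _ h1).
by lra.
Qed.

Lemma measurable_bump n a b : measurable_fun setT (bump n a b).
Proof.
apply: measurable_funM; apply: measurableT_comp (measurable_flat 0) _;
  apply: measurable_funM => //; apply: measurable_funD => //.
apply: measurable_funM => //.
exact: measurable_funB.
Qed.

Lemma bump_le n a b x : `|bump n a b x| <= 1 * \1_(`[a, b + 1]%classic) x.
Proof.
rewrite ger0_norm ?bump_ge0// mul1r indicE; case: (boolP (x \in _)).
  by rewrite bump_le1.
rewrite notin_setE/= in_itv/= => H.
have [->//|/bump_supp/andP[h1 h2]] := eqVneq (bump n a b x) 0.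
by exfalso; apply: H; rewrite (ltW h1) (ltW h2).
Qed.

Lemma flat0_cvg (y : nat -> R) : (y n @[n --> \oo] --> +oo) ->
  flat 0 (y n) @[n --> \oo] --> (1 : R).
Proof.
move=> yoo.
have iy : (y n)^-1 @[n --> \oo] --> (0 : R).
  by apply/gtr0_cvgV0 => //; exact: (cvgryPgt _).1.
have : expR (- (y n)^-1) @[n --> \oo] --> (1 : R).
  rewrite -expR0 -oppr0; apply: continuous_cvg; first exact: continuous_expR.
  exact: cvgN.
apply: cvg_trans; apply: near_eq_cvg.
have : \forall n \near \oo, 0 < y n by exact: (cvgryPgt _).1.
by apply: filterS => n yn; rewrite /flat yn expr0 mul1r.
Qed.

Lemma bump_cvg a b x : bump n a b x @[n --> \oo] --> (\1_(`]a, b]%classic) x : R).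
Proof.
have mulyy (u : nat -> R) (e : R) : 0 < e -> (forall n, e <= u n) ->
    n.+1%:R * u n @[n --> \oo] --> +oo.
  move=> e0 eu; apply/cvgryPge => A.
  have : \forall n \near \oo, A / e <= n%:R by exact: nbhs_infty_ger.
  apply: filterS => n; rewrite ler_pdivrMr// => /le_trans; apply.
  by rewrite ler_pM// ?(ltW e0)// ler_nat.
rewrite indicE; case: (boolP (x \in _)) => [|].
  rewrite inE/= in_itv/= => /andP[ax xb].
  rewrite -[X in _ --> X](mulr1 (1 : R)); apply: cvgM; apply: flat0_cvg.
    by apply: (mulyy _ (x - a)) => //; rewrite subr_gt0.
  apply: (mulyy _ 1) => // n.
  by rewrite lerDr mulr_ge0// subr_ge0.
rewrite notin_setE/= in_itv/= => /negP; rewrite negb_and -!leNgt -ltNge => /orP[xa|bx].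
  rewrite (_ : (fun n => _) = fun=> 0); first exact: cvg_cst.
  apply/funext => n; rewrite /bump /flat ifF ?mul0r//.
  by apply/negbTE; rewrite -leNgt pmulr_rle0// subr_le0.
have /cvgryPge/(_ 1) n1 : n.+1%:R * (x - b) @[n --> \oo] --> +oo.
  by apply: (mulyy _ (x - b)) => //; rewrite subr_gt0.
have : (fun _ : nat => 0 : R) @ \oo --> (0 : R) by exact: cvg_cst.
apply: cvg_trans; apply: near_eq_cvg.
apply: filterS n1 => n n1.
rewrite /bump mulrC /flat ifF ?mul0r//.
by apply/negbTE; rewrite -leNgt pmulr_rle0//; lra.
Qed.
End bump.

Section weak_to_mild.
Context {R : realType}.
Notation mu := (@lebesgue_measure R).
Notation mu2 := (mu \x mu)%E.

Definition bump2 n a b c d (p : R * R) := bump n a b p.1 * bump n c d p.2.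


Lemma bump2_le n a b c d p :
  `|bump2 n a b c d p| <= \1_(`[a, b + 1]%classic `*` `[c, d + 1]%classic) p.
Proof.
case: p => x y; rewrite normrM indicE in_setX -mulnb natrM/=.
rewrite ler_pM//; [have := bump_le n a b x|have := bump_le n c d y];
 by rewrite mul1r indicE.
Qed.

Lemma measurable_bump2 n a b c d : measurable_fun setT (bump2 n a b c d).
Proof.
by apply: measurable_funM; apply: measurableT_comp => //; exact: measurable_bump.
Qed.

Lemma bump2_cvg a b c d p : bump2 n a b c d p @[n --> \oo] -->
  (\1_(`]a, b]%classic `*` `]c, d]%classic) p : R).
Proof.
case: p => x y; rewrite indicE in_setX -mulnb natrM/=.
by apply: cvgM; have := bump_cvg; rewrite /= => /(_ R); [move/(_ a b x)|move/(_ c d y)]; rewrite indicE.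
Qed.

Lemma box_fin (a b c d : R) : (mu2 (`[a, b]%classic `*` `[c, d]%classic) < +oo)%E.
Proof.
have f (u v : R) : (mu `[u, v]%classic < +oo)%E.
  by rewrite lebesgue_measure_itv/=; case: ifP => _; rewrite ?ltry.
rewrite product_measure1E//; apply: lte_mul_pinfty; last exact: f.
  exact: measure_ge0.
by rewrite ge0_fin_numE; [exact: f|exact: measure_ge0].
Qed.

Lemma bump_ae0 (h : R * R -> R) C : measurable_fun setT h ->
  (forall p, `|h p| <= C) ->
  (forall n a b c d, \int[mu2]_p (h p * bump2 n a b c d p) = 0) ->
  {ae mu2, forall p, h p = 0}.
Proof.
move=> mh hC h0.
pose T2 := (measurableTypeR R * measurableTypeR R)%type.
have C0 : 0 <= C := le_trans (normr_ge0 _) (hC (0, 0)).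
have mB a b c d : @measurable _ T2 (`[a, b]%classic `*` `[c, d]%classic).
  exact: measurableX.
apply: rect_ae0 => // B [[[a b] [c d]] _ <-]/=.
  apply: (@integrableS _ T2 R mu2 (`[a, b]%classic `*` `[c, d]%classic)) => //.
  - exact: measurableX.
  - move=> [x y] [/=]; rewrite !in_itv/= => /andP[/ltW -> ->] /andP[/ltW -> ->].
    by [].
  apply: measurable_bounded_integrable => //.
  - exact: box_fin.
  - exact: measurable_funTS.
  - exists C; split; first exact: num_real.
    by move=> K CK p _ /=; rewrite (le_trans (hC p))// ltW.
have ihb n : mu2.-integrable setT (EFin \o (fun p => h p * bump2 n a b c d p)).
  apply: (@bdd_integrable _ T2 R mu2 (fun p => h p * bump2 n a b c d p) (`[a, b + 1]%classic `*` `[c, d + 1]%classic) C).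
  - by apply: measurable_funM => //; exact: measurable_bump2.
  - exact: mB.
  - exact: box_fin.
  - by move=> p; rewrite normrM ler_pM// bump2_le.
have mo : @measurable _ T2 (`]a, b]%classic `*` `]c, d]%classic) by exact: measurableX.
rewrite integral_mkcond.
have cv : (\int[mu2]_p (h p * bump2 n a b c d p)%:E @[n --> \oo] -->
    \int[mu2]_p (h p * \1_(`]a, b]%classic `*` `]c, d]%classic) p)%:E)%E.
  apply: (@dominated_cvg _ T2 R mu2 setT measurableT _ _ (fun p => (C * \1_(`[a, b + 1]%classic `*` `[c, d + 1]%classic) p)%:E)) => //.
  - move=> n; apply/measurable_EFinP; apply: measurable_funM => //.
    exact: measurable_bump2.
  - move=> p _; apply: cvg_EFin; first exact: nearW.
    by apply: cvgMl_tmp; exact: bump2_cvg.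
  - apply: (@bdd_integrable _ T2 R mu2 (fun p => C * \1_(`[a, b + 1]%classic `*` `[c, d + 1]%classic) p) (`[a, b + 1]%classic `*` `[c, d + 1]%classic) C).
    + exact: measurable_funM.
    + exact: mB.
    + exact: box_fin.
    + by move=> p; rewrite ger0_norm// mulr_ge0.
  - by move=> n p _; rewrite lee_fin normrM ler_pM// bump2_le.
rewrite (_ : (fun n => _) = fun=> 0%E) in cv; last first.
  apply/funext => n; rewrite -(fineK (integrable_fin_num _ (ihb n)))//.
  by congr EFin; exact: h0.
have := cvg_unique _ cv (cvg_cst 0%E) => <- //.
apply: eq_integral => p _.
by rewrite patchE indicE; case: ifP => _; rewrite ?mulr1 ?mulr0.
Qed.

End weak_to_mild.

(** * From weak balance laws to Duhamel's formula *)

Section plane_measure.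
Context {R : realType}.

(** The product measure under a name of its own, on which sigma-finiteness is
declared; this makes Fubini's theorem apply between time and the plane. *)
Definition plane : set (measurableTypeR R * measurableTypeR R)%type -> \bar R :=
  (@lebesgue_measure R \x @lebesgue_measure R)%E.

HB.instance Definition _ := Measure.on plane.

Let plane_sigma_finite : sigma_finite setT plane.
Proof.
exists (fun n => `[- n%:R, n%:R]%classic `*` `[- n%:R, n%:R]%classic).
  apply/esym/seteqP; split => // -[x y] _.
  exists (Num.truncn (Num.max `|x| `|y|)).+1 => //=; rewrite !in_itv/=.
  have := truncnS_gt (Num.max `|x| `|y|).
  by rewrite gt_max !ltr_norml => /andP[/andP[/ltW-> /ltW->] /andP[/ltW-> /ltW->]].
by move=> n; split; [exact: measurableX|exact: box_fin].
Qed.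

HB.instance Definition _ := @Measure_isSigmaFinite.Build _ _ _ plane plane_sigma_finite.
End plane_measure.

Section mild_of_weak.
Context {R : realType}.
Notation mu := (@lebesgue_measure R).
Notation mu2 := (mu \x mu)%E.
Let T2 := (measurableTypeR R * measurableTypeR R)%type.
Let T3 := (measurableTypeR R * T2)%type.

Lemma Rint_indic d (T : measurableType d) (m : {measure set T -> \bar R})
  (D : set T) (F : T -> R) :
  \int[m]_(t in D) F t = \int[m]_t (F t * \1_D t).
Proof.
rewrite Rintegral_mkcond; apply: eq_Rintegral => t _.
by rewrite patchE indicE; case: ifP => _; rewrite ?mulr1 ?mulr0.
Qed.

Lemma mu_itv_lty (a b : R) : (mu `[a, b]%classic < +oo)%E.
Proof. by rewrite lebesgue_measure_itv/=; case: ifP => _; rewrite ?ltry. Qed.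

Lemma normr_Rint_le d (T : measurableType d) (m : {measure set T -> \bar R})
  (f : T -> R) (D : set T) C :
  measurable_fun setT f -> measurable D -> (m D < +oo)%E -> (forall x, `|f x| <= C * \1_D x) ->
  `|\int[m]_x f x| <= C * fine (m D).
Proof.
move=> mf mD Dfin fC.
have fi := bdd_integrable mf mD Dfin fC.
apply: (le_trans (le_normr_Rintegral _ fi)) => //.
have mC : measurable_fun setT (fun x => C * \1_D x : R).
  exact: measurable_funM.
have := @le_Rintegral _ T R m setT (fun x => `|f x|) (fun x => C * \1_D x) measurableT.
move=> /(_ (integrable_norm fi)) H.
apply: (le_trans (H _ _)).
- apply: (bdd_integrable (D := D) (C := `|C|)) => // x.
  by rewrite normrM [`|\1_D x|]ger0_norm.
- by move=> x _; exact: fC.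
rewrite RintegralZl//; last first.
  by apply: (bdd_integrable (D := D) (C := 1)) => // x; rewrite mul1r ger0_norm.
by rewrite /Rintegral integral_indic// setIT.
Qed.

(** Exchanging time and space on the right shows that the difference between
the two sides of the conclusion is orthogonal to all products of bumps. *)
Lemma mild_of_weak (h0 hT : R * R -> R) (k : R * (R * R) -> R) C T :
  measurable_fun setT h0 -> measurable_fun setT hT -> measurable_fun setT k ->
  (forall p, `|h0 p| <= C) -> (forall p, `|hT p| <= C) ->
  (forall q, `|k q| <= C) ->
  (forall n a b c d,
    \int[mu2]_p (hT p * bump2 n a b c d p) -
    \int[mu2]_p (h0 p * bump2 n a b c d p) =
    \int[mu]_(t in `[0, T]) \int[mu2]_p (k (t, p) * bump2 n a b c d p)) ->
  {ae mu2, forall p, hT p = h0 p + \int[mu]_(t in `[0, T]) k (t, p)}.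
Proof.
move=> mh0 mhT mk b0 bT bk weak.
have C0 : 0 <= C := le_trans (normr_ge0 _) (b0 (0, 0)).
have {}mh0 : measurable_fun setT (h0 : T2 -> R) := mh0.
have {}mhT : measurable_fun setT (hT : T2 -> R) := mhT.
have {}mk : measurable_fun setT (k : T3 -> R) := mk.
pose kI q := k q * \1_(`[0, T]%classic) q.1.
have mkI : measurable_fun setT (kI : T3 -> R).
  apply: measurable_funM => //.
  by apply: (measurableT_comp (f := \1_(`[0, T]%classic) : R -> R)).
pose K p := \int[mu]_t kI (t, p).
have mK : measurable_fun setT (K : T2 -> R).
  exact: (@measurable_Rint1 _ _ (measurableTypeR R) T2 R mu kI).
have kC q : `|kI q| <= C * \1_(`[0, T]%classic) q.1.
  by rewrite normrM ler_pM// ger0_norm.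
have bK p : `|K p| <= C * fine (mu `[0, T]%classic).
  apply: (@normr_Rint_le _ (measurableTypeR R) mu (fun t => kI (t, p)) _ C) => //.
  - exact: (measurableT_comp mkI (pair2_measurable p)).
  - exact: mu_itv_lty.
have H0 : {ae mu2, forall p, hT p - h0 p - K p = 0}.
  apply: (@bump_ae0 R _ (C + C + C * fine (mu `[0, T]%classic))).
  - apply: measurable_funB; last exact: mK.
    by apply: measurable_funB; [exact: mhT|exact: mh0].
  - move=> p; rewrite (le_trans (ler_normB _ _))// lerD//.
    by rewrite (le_trans (ler_normB _ _))// lerD.
  move=> n a b c d.
  set D : set T2 := `[a, b + 1]%classic `*` `[c, d + 1]%classic.
  have mD : measurable D by exact: measurableX.
  have mb : measurable_fun setT (bump2 n a b c d : T2 -> R) by exact: measurable_bump2.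
  have ib h C' : 0 <= C' -> measurable_fun setT (h : T2 -> R) -> (forall p, `|h p| <= C') ->
      mu2.-integrable setT (EFin \o (fun p => h p * bump2 n a b c d p)).
    move=> C'0 mh hC; apply: (@bdd_integrable _ T2 R mu2 _ D C') => //.
    - exact: measurable_funM.
    - exact: box_fin.
    - by move=> p; rewrite normrM ler_pM// bump2_le.
  have C'0 : 0 <= C * fine (mu `[0, T]%classic) by rewrite mulr_ge0// fine_ge0//; exact: measure_ge0.
  have -> : \int[mu2]_p ((hT p - h0 p - K p) * bump2 n a b c d p) =
     \int[mu2]_p (hT p * bump2 n a b c d p) - \int[mu2]_p (h0 p * bump2 n a b c d p)
     - \int[mu2]_p (K p * bump2 n a b c d p).
    rewrite -RintegralB//; [|exact: (ib _ C)|exact: (ib _ C)].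
    rewrite -RintegralB//; last 2 first.
    - exact: (integrableB measurableT (ib _ _ C0 mhT bT) (ib _ _ C0 mh0 b0)).
    - exact: (ib _ _ C'0).
    by apply: eq_Rintegral => p _; rewrite !mulrBl.
  rewrite weak; apply/eqP; rewrite subr_eq0; apply/eqP.
  rewrite Rint_indic.
  pose F q := kI q * bump2 n a b c d q.2.
  have mF : measurable_fun setT (F : T3 -> R).
    apply: measurable_funM => //.
    exact: (measurableT_comp (f := bump2 n a b c d : T2 -> R)).
  have FC q : `|F q| <= C * \1_(`[0, T]%classic `*` D) q.
    case: q => t p.
    have -> : \1_(`[0, T]%classic `*` D) (t, p) = \1_(`[0, T]%classic) t * \1_D p :> R.
      by rewrite !indicE in_setX -mulnb natrM.
    rewrite mulrA normrM.
    exact: ler_pM (normr_ge0 _) (normr_ge0 _) (kC (t, p)) (bump2_le n a b c d p).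
  have -> : \int[mu]_t (\int[mu2]_p (k (t, p) * bump2 n a b c d p) * \1_(`[0, T]%classic) t) =
            \int[mu]_t \int[mu2]_p F (t, p).
    apply: eq_Rintegral => t _.
    transitivity (\int[mu2]_p (\1_(`[0, T]%classic) t * (k (t, p) * bump2 n a b c d p))).
      rewrite RintegralZl 1?mulrC//.
      exact: (ib (fun p => k (t, p)) _ C0 (measurableT_comp mk (pair1_measurable t)) (fun p => bk (t, p))).
    by apply: eq_Rintegral => p _; rewrite /F /kI/= mulrA (mulrC (\1_ _ _)).
  have tbox_lty : ((mu \x plane) (`[0%R, T]%classic `*` D) < +oo)%E.
    rewrite product_measure1E//; apply: lte_mul_pinfty.
    - exact: measure_ge0.
    - by rewrite ge0_fin_numE; [exact: mu_itv_lty|exact: measure_ge0].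
    - exact: box_fin.
  rewrite (@Rfubini _ _ (measurableTypeR R) T2 R mu plane F).
  - apply: eq_Rintegral => p _; rewrite /F/=.
    rewrite RintegralZr//.
    apply: (@bdd_integrable _ _ R mu (fun t => kI (t, p)) `[0, T]%classic C) => //.
      exact: (measurableT_comp mkI (pair2_measurable p)).
    exact: mu_itv_lty.
  - apply: (@bdd_integrable _ T3 R _ _ (`[0, T]%classic `*` D) C) => //.
    + exact: measurableX.
  - move=> t; apply: (@bdd_integrable _ T2 R mu2 (fun p => F (t, p)) D C) => //.
    + exact: (measurableT_comp mF (pair1_measurable t)).
    + exact: box_fin.
    + move=> p; rewrite (le_trans (FC _))// ler_wpM2l// !indicE in_setX/=.
      by case: (p \in D); rewrite ?andbT ?andbF// lern1; case: (_ \in _).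
  - move=> p; apply: (@bdd_integrable _ _ R mu (fun t => F (t, p)) `[0, T]%classic C) => //.
    + exact: (measurableT_comp mF (pair2_measurable p)).
    + exact: mu_itv_lty.
    + move=> t; rewrite (le_trans (FC _))// ler_wpM2l// !indicE in_setX/=.
      by case: (t \in _) => //=; rewrite lern1; case: (_ \in _).
apply: (ae_mp H0) => p /eqP; rewrite subr_eq0 subr_eq => /eqP ->.
by rewrite Rint_indic addrC.
Qed.
End mild_of_weak.

(** * Products of primitives *)

Section prim.
Context {R : realType}.
Notation mu := (@lebesgue_measure R).
Let T1 := measurableTypeR R.

Definition prim (a : R -> R) (t : R) : R := \int[mu]_(s in `[0, t]) a s.

Lemma itv_integrable (a : R -> R) T C : measurable_fun setT a ->
  (forall s, 0 <= s <= T -> `|a s| <= C) ->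
  mu.-integrable setT (fun s => (a s * \1_(`[0, T]%classic) s)%:E).
Proof.
move=> ma aC.
apply: (@bdd_integrable _ T1 R mu (fun s => a s * \1_(`[0, T]%classic) s) `[0, T]%classic C) => //.
- exact: measurable_funM.
- exact: mu_itv_lty.
- move=> s; rewrite indicE; case: (boolP (s \in _)) => h; last by rewrite !mulr0 normr0.
  by rewrite !mulr1; apply: aC; move: h; rewrite inE/= in_itv.
Qed.

(** Integration by parts for primitives of bounded functions.  The product of
the two integrals is an integral over the square [0, T]^2, split along its
diagonal into two triangles. *)
Lemma primM (a b : R -> R) (C T F0 G0 : R) :
  measurable_fun setT a -> measurable_fun setT b ->
  (forall s, 0 <= s <= T -> `|a s| <= C) ->
  (forall s, 0 <= s <= T -> `|b s| <= C) ->
  (F0 + prim a T) * (G0 + prim b T) =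
  F0 * G0 + prim (fun s => a s * (G0 + prim b s) + b s * (F0 + prim a s)) T.
Proof.
move=> ma mb aC bC.
set I := \1_(`[0, T]%classic) : R -> R.
have mI : measurable_fun setT I by exact: measurable_indic.
pose a' s := a s * I s; pose b' s := b s * I s.
have ia : mu.-integrable setT (EFin \o a') by exact: (itv_integrable ma aC).
have ib : mu.-integrable setT (EFin \o b') by exact: (itv_integrable mb bC).
have ma' : measurable_fun setT (a' : T1 -> R) by exact: measurable_funM.
have mb' : measurable_fun setT (b' : T1 -> R) by exact: measurable_funM.
have bdd (h : R -> R) : (forall s, 0 <= s <= T -> `|h s| <= C) -> forall s, `|h s * I s| <= C * I s.
  move=> hC s; rewrite /I indicE; case: (boolP (s \in _)) => h'; last by rewrite !mulr0 normr0.
  by rewrite !mulr1; apply: hC; move: h'; rewrite inE/= in_itv.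
have a'C := bdd a aC; have b'C := bdd b bC.
have C0 s : I s != 0 -> 0 <= C.
  rewrite /I indicE; case: (boolP (s \in _)); rewrite ?eqxx// inE/= in_itv/= => /aC h _.
  exact: le_trans h.
pose le12 (q : R * R) : R := (q.2 <= q.1)%R%:R.
have mle12 : measurable_fun setT (le12 : T1 * T1 -> R).
  rewrite (_ : le12 = \1_[set q : R * R | 0 <= q.1 - q.2]); last first.
    apply/funext => q; rewrite indicE /le12 -subr_ge0.
    by congr ((nat_of_bool _)%:R); apply/idP/idP => [h|]; rewrite ?inE//.
  apply: measurable_indic.
  rewrite -[X in measurable X]setTI (_ : [set q | _] = (fun q => q.1 - q.2) @^-1` `[0, +oo[).
    apply: measurable_funB => //.
  by apply/seteqP; split => q /=; rewrite in_itv/= andbT.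
pose f q := a' q.1 * b' q.2 * le12 q.
pose g q := a' q.1 * b' q.2 * (1 - le12 q).
have le12_01 q : 0 <= le12 q <= 1 by rewrite /le12; case: (q.2 <= q.1); rewrite ?lexx ?ler01.
have mab : measurable_fun setT (fun q : T1 * T1 => a' q.1 * b' q.2).
  apply: measurable_funM; apply: measurableT_comp => //.
have mf : measurable_fun setT (f : T1 * T1 -> R) by exact: measurable_funM.
have mg : measurable_fun setT (g : T1 * T1 -> R).
  by apply: measurable_funM => //; exact: measurable_funB.
have abC q : `|a' q.1 * b' q.2| <= C * C * \1_(`[0, T]%classic `*` `[0, T]%classic) q.
  case: q => s t /=.
  have -> : \1_(`[0, T]%classic `*` `[0, T]%classic) (s, t) = I s * I t.
    by rewrite /I !indicE in_setX -mulnb natrM.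
  rewrite [leRHS]mulrACA normrM.
  exact: ler_pM (normr_ge0 _) (normr_ge0 _) (a'C s) (b'C t).
have fC q : `|f q| <= C * C * \1_(`[0, T]%classic `*` `[0, T]%classic) q.
  rewrite normrM (le_trans _ (abC q))// ler_piMr//.
  by have /andP[h1 h2] := le12_01 q; rewrite ger0_norm.
have gC q : `|g q| <= C * C * \1_(`[0, T]%classic `*` `[0, T]%classic) q.
  rewrite normrM (le_trans _ (abC q))// ler_piMr//.
  by have /andP[h1 h2] := le12_01 q; rewrite ger0_norm ?subr_ge0// gerBl.
have sec1 (h : R * R -> R) s : measurable_fun setT (h : T1 * T1 -> R) ->
   (forall q, `|h q| <= C * C * \1_(`[0, T]%classic `*` `[0, T]%classic) q) ->
   mu.-integrable setT (fun t => (h (s, t))%:E).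
  move=> mh hC; apply: (@bdd_integrable _ T1 R mu (fun t => h (s, t)) `[0, T]%classic (C * C)) => //.
    exact: (measurableT_comp mh (pair1_measurable s)).
    exact: mu_itv_lty.
  move=> t; rewrite (le_trans (hC _))// !indicE in_setX/=.
  by apply: ler_wpM2l; [rewrite -expr2 sqr_ge0|]; case: (s \in `[0, T]%classic); case: (t \in `[0, T]%classic); rewrite //= ?ler01.
have sec2 (h : R * R -> R) t : measurable_fun setT (h : T1 * T1 -> R) ->
   (forall q, `|h q| <= C * C * \1_(`[0, T]%classic `*` `[0, T]%classic) q) ->
   mu.-integrable setT (fun s => (h (s, t))%:E).
  move=> mh hC; apply: (@bdd_integrable _ T1 R mu (fun s => h (s, t)) `[0, T]%classic (C * C)) => //.
    exact: (measurableT_comp mh (pair2_measurable t)).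
    exact: mu_itv_lty.
  move=> s; rewrite (le_trans (hC _))// !indicE in_setX/=.
  by apply: ler_wpM2l; [rewrite -expr2 sqr_ge0|]; case: (s \in `[0, T]%classic); case: (t \in `[0, T]%classic); rewrite //= ?ler01.
have primE (h : R -> R) s : 0 <= s <= T -> prim h s = \int[mu]_t (h t * I t * le12 (s, t)).
  move=> /andP[s0 sT]; rewrite /prim Rint_indic; apply: eq_Rintegral => t _.
  rewrite -mulrA; congr (_ * _); rewrite /I !indicE -natrM mulnb; congr ((nat_of_bool _)%:R).
  apply/idP/idP.
    rewrite inE/= in_itv/= => /andP[t0 ts]; rewrite ts andbT; apply/mem_set => /=.
    by rewrite in_itv/= t0 (le_trans ts).
  move=> /andP[]; rewrite inE/= in_itv/= => /andP[t0 _] ts; apply/mem_set => /=.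
  by rewrite in_itv/= t0.
have primE' s : 0 <= s <= T ->
    prim a s = \int[mu]_t (a t * I t * (1 - le12 (t, s))).
  move=> /andP[s0 sT].
  have ias : mu.-integrable `[0, s[%classic (EFin \o a).
    have := @integrableS _ T1 R mu setT `[0, s[%classic _ measurableT (measurable_itv `[0, s[) (@subsetT _ _) ia.
    apply: eq_integrable => // t; rewrite inE/= in_itv/= => /andP[t0 ts].
    by rewrite /a' /I indicE mem_set ?mulr1//= in_itv/= t0 (le_trans (ltW ts)).
  rewrite /prim -Rintegral_itv_bndo_bndc//.
  rewrite Rint_indic; apply: eq_Rintegral => t _.
  have -> : 1 - le12 (t, s) = (t < s)%R%:R.
    by rewrite /le12/= ltNge; case: (s <= t); rewrite ?subrr ?subr0.
  rewrite -mulrA; congr (_ * _); rewrite /I !indicE -natrM mulnb; congr ((nat_of_bool _)%:R).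
  apply/idP/idP.
    rewrite inE/= in_itv/= => /andP[t0 ts]; rewrite ts andbT; apply/mem_set => /=.
    by rewrite in_itv/= t0 (le_trans (ltW ts)).
  move=> /andP[]; rewrite inE/= in_itv/= => /andP[t0 _] ts; apply/mem_set => /=.
  by rewrite in_itv/= t0.
have aE : prim a T = \int[mu]_s a' s by rewrite /prim Rint_indic.
have bE : prim b T = \int[mu]_s b' s by rewrite /prim Rint_indic.
pose pb s := \int[mu]_t (b' t * le12 (s, t)).
pose pa s := \int[mu]_t (a' t * (1 - le12 (t, s))).
pose K := C * fine (mu `[0, T]%classic).
have mbl : measurable_fun setT (fun q : T1 * T1 => b' q.2 * le12 q).
  by apply: measurable_funM => //; apply: measurableT_comp.
have mal : measurable_fun setT (fun q : T1 * T1 => a' q.1 * (1 - le12 q)).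
  apply: measurable_funM => //; first exact: measurableT_comp.
  exact: measurable_funB.
have mpb : measurable_fun setT (pb : T1 -> R) by exact: (measurable_Rint2 _ mbl).
have mpa : measurable_fun setT (pa : T1 -> R) by exact: (measurable_Rint1 _ mal).
have ble q : `|b' q.2 * le12 q| <= C * I q.2.
  rewrite normrM (le_trans _ (b'C q.2))// ler_piMr//.
  by have /andP[h1 h2] := le12_01 q; rewrite ger0_norm.
have ale q : `|a' q.1 * (1 - le12 q)| <= C * I q.1.
  rewrite normrM (le_trans _ (a'C q.1))// ler_piMr//.
  by have /andP[h1 h2] := le12_01 q; rewrite ger0_norm ?subr_ge0// gerBl.
have pbK s : `|pb s| <= K.
  apply: (@normr_Rint_le _ _ T1 mu (fun t => b' t * le12 (s, t)) `[0, T]%classic C) => //.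
  - exact: (measurableT_comp mbl (pair1_measurable s)).
  - exact: mu_itv_lty.
  - by move=> t; exact: (ble (s, t)).
have paK s : `|pa s| <= K.
  apply: (@normr_Rint_le _ _ T1 mu (fun t => a' t * (1 - le12 (t, s))) `[0, T]%classic C) => //.
  - exact: (measurableT_comp mal (pair2_measurable s)).
  - exact: mu_itv_lty.
  - by move=> t; exact: (ale (t, s)).
have iapb : mu.-integrable setT (fun s => (a' s * pb s)%:E).
  apply: (@bdd_integrable _ T1 R mu (fun s => a' s * pb s) `[0, T]%classic (C * K)) => //.
  - exact: measurable_funM.
  - exact: mu_itv_lty.
  - by move=> s; rewrite [leRHS]mulrAC normrM; exact: ler_pM (normr_ge0 _) (normr_ge0 _) (a'C s) (pbK s).
have ibpa : mu.-integrable setT (fun s => (b' s * pa s)%:E).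
  apply: (@bdd_integrable _ T1 R mu (fun s => b' s * pa s) `[0, T]%classic (C * K)) => //.
  - exact: measurable_funM.
  - exact: mu_itv_lty.
  - by move=> s; rewrite [leRHS]mulrAC normrM; exact: ler_pM (normr_ge0 _) (normr_ge0 _) (b'C s) (paK s).
have -> : prim (fun s => a s * (G0 + prim b s) + b s * (F0 + prim a s)) T =
   \int[mu]_s ((a' s * G0 + a' s * pb s) + (b' s * F0 + b' s * pa s)).
  rewrite [LHS]Rint_indic; apply: eq_Rintegral => s _.
  have [sT|sT] := boolP (0 <= s <= T); last first.
    have I0 : I s = 0 by rewrite /I indicE memNset// /= in_itv/=; exact/negP.
    by rewrite -/I I0 /a' /b' I0 !mulr0 !mul0r !addr0.
  by rewrite (primE b)// primE'// -/(pb s) -/(pa s) -/I /a' /b'; ring.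
have iaG : mu.-integrable setT (fun s => (a' s * G0)%:E).
  exact: (@integrableZr _ T1 R mu setT measurableT G0 (EFin \o a') ia).
have ibF : mu.-integrable setT (fun s => (b' s * F0)%:E).
  exact: (@integrableZr _ T1 R mu setT measurableT F0 (EFin \o b') ib).
rewrite RintegralD//; last 2 first.
- exact: (integrableD measurableT iaG iapb).
- exact: (integrableD measurableT ibF ibpa).
rewrite (RintegralD measurableT iaG iapb) (RintegralD measurableT ibF ibpa).
rewrite (RintegralZr _ measurableT ia) (RintegralZr _ measurableT ib) -aE -bE.
have key : prim a T * prim b T = \int[mu]_s (a' s * pb s) + \int[mu]_s (b' s * pa s).
  have -> : \int[mu]_s (a' s * pb s) = \int[mu]_s \int[mu]_t f (s, t).
    apply: eq_Rintegral => s _; rewrite /pb -RintegralZl//.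
      by apply: eq_Rintegral => t _; rewrite /f mulrA.
    apply: (@bdd_integrable _ T1 R mu (fun t => b' t * le12 (s, t)) `[0, T]%classic C) => //.
    + exact: (measurableT_comp mbl (pair1_measurable s)).
    + exact: mu_itv_lty.
    + by move=> t; exact: (ble (s, t)).
  have -> : \int[mu]_s (b' s * pa s) = \int[mu]_s \int[mu]_t g (s, t).
    rewrite (@Rfubini _ _ T1 T1 R mu mu g).
    + apply: eq_Rintegral => s _; rewrite /pa -RintegralZl//.
        by apply: eq_Rintegral => t _; rewrite /g/=; ring.
      apply: (@bdd_integrable _ T1 R mu (fun t => a' t * (1 - le12 (t, s))) `[0, T]%classic C) => //.
      * exact: (measurableT_comp mal (pair2_measurable s)).
      * exact: mu_itv_lty.
      * by move=> t; exact: (ale (t, s)).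
    + apply: (@bdd_integrable _ (T1 * T1)%type R (mu \x mu)%E g (`[0, T]%classic `*` `[0, T]%classic) (C * C)) => //.
      * exact: measurableX.
      * exact: box_fin.
    + by move=> s; exact: sec1.
    + by move=> t; exact: sec2.
  have Fi (h : R * R -> R) : measurable_fun setT (h : T1 * T1 -> R) ->
      (forall q, `|h q| <= C * C * \1_(`[0, T]%classic `*` `[0, T]%classic) q) ->
      mu.-integrable setT (fun s => (\int[mu]_t h (s, t))%:E).
    move=> mh hC; apply: (@bdd_integrable _ T1 R mu (fun s => \int[mu]_t h (s, t)) `[0, T]%classic (C * K)) => //.
    + exact: measurable_Rint2.
    + exact: mu_itv_lty.
    + move=> s; rewrite /K mulrA mulrAC.
      apply: (@normr_Rint_le _ _ T1 mu (fun t => h (s, t)) `[0, T]%classic (C * C * I s)) => //.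
      * exact: (measurableT_comp mh (pair1_measurable s)).
      * exact: mu_itv_lty.
      * move=> t; rewrite (le_trans (hC _))//.
        by rewrite -[leRHS]mulrA /I !indicE in_setX -mulnb natrM.
  rewrite -RintegralD//; [|exact: Fi|exact: Fi].
  rewrite aE bE -RintegralZr//; apply: eq_Rintegral => s _.
  rewrite -RintegralD//; [|exact: sec1|exact: sec1].
  rewrite -RintegralZl//; apply: eq_Rintegral => t _.
  by rewrite /f /g/=; ring.
rewrite mulrDl !mulrDr key.
move: (prim a T) (prim b T) (\int[mu]_s (a' s * pb s)) (\int[mu]_s (b' s * pa s)) => *; ring.
Qed.
End prim.

(** * Test functions carried by the free flow *)

Section smooth_more.
Context {R : realType} {E : normedModType R}.
Implicit Types f g : E -> R.

Lemma smoothN f : smooth f -> smooth (fun p => - f p).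
Proof.
move=> sf; rewrite (_ : (fun p => _) = fun p => (-1) * f p).
  by apply: smoothM => //; exact: smooth_cst.
by apply/funext => p; rewrite mulN1r.
Qed.

Lemma smoothB f g : smooth f -> smooth g -> smooth (fun p => f p - g p).
Proof. by move=> sf sg; apply: smoothD => //; exact: smoothN. Qed.

Lemma smooth_bump n a b f : smooth f -> smooth (fun p => bump n a b (f p)).
Proof.
move=> sf; apply: smoothM; apply: smooth_flat; apply: smoothM; try exact: smooth_cst.
  by apply: smoothB => //; exact: smooth_cst.
apply: smoothD; last exact: smooth_cst.
apply: smoothM; first exact: smooth_cst.
by apply: smoothB => //; exact: smooth_cst.
Qed.

(** A smooth transition from 0 on ]-oo, 0] to 1 on [1, +oo[. *)
Definition step (x : R) : R := flat 0 x * (flat 0 x + flat 0 (1 - x))^-1.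

Lemma step_den (x : R) : flat 0 x + flat 0 (1 - x) != 0.
Proof.
apply: lt0r_neq0; have f0 y : 0 < y -> 0 < flat 0 y :> R.
  by move=> y0; rewrite /flat y0 mulr_gt0 ?expR_gt0// exprn_gt0 ?invr_gt0.
have [x0|x0] := ltP 0 x; first by rewrite ltr_wpDr ?flat_ge0 ?f0.
by rewrite ltr_wpDl ?flat_ge0 ?f0//; lra.
Qed.

Lemma step1 (x : R) : 1 <= x -> step x = 1.
Proof.
move=> x1; rewrite /step.
have e : flat 0 (1 - x) = 0 by rewrite /flat ifF//; apply/negbTE; rewrite -leNgt; lra.
by have := step_den x; rewrite e addr0 => /divff.
Qed.

Lemma step_neq0 (x : R) : step x != 0 -> 0 < x.
Proof. by rewrite /step mulf_eq0 negb_or => /andP[/flat0_neq0]. Qed.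

Lemma smooth_step f : smooth f -> smooth (fun p => step (f p)).
Proof.
move=> sf; apply: smoothM; first exact: smooth_flat.
apply: smoothV; first by move=> p; exact: step_den.
apply: smoothD; apply: smooth_flat => //.
by apply: smoothB => //; exact: smooth_cst.
Qed.

(** Equal to 1 in a neighbourhood of [0, T], so that it does not affect
derivatives taken there, and compactly supported. *)
Definition time_cut (T t : R) : R := step (t + 2) * step (T + 2 - t).

Lemma smooth_time_cut T f : smooth f -> smooth (fun p => time_cut T (f p)).
Proof.
move=> sf; apply: smoothM; apply: smooth_step.
  by apply: smoothD => //; exact: smooth_cst.
by apply: smoothB => //; exact: smooth_cst.
Qed.

Lemma time_cut1 T t : -1 <= t <= T + 1 -> time_cut T t = 1.
Proof. by move=> /andP[h1 h2]; rewrite /time_cut !step1 ?mulr1//; lra. Qed.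

Lemma time_cut_supp T t : time_cut T t != 0 -> -2 <= t <= T + 2.
Proof.
by rewrite mulf_eq0 negb_or => /andP[/step_neq0 h1 /step_neq0 h2]; apply/andP; split; lra.
Qed.

Lemma derive_locally_cst f p v :
  (\forall h \near (0 : R), f (h *: v + p) = f p) -> 'D_v f p = 0.
Proof.
move=> fE; rewrite /derive; apply: cvg_lim => //.
have : (fun _ : R => 0 : R) @ (0 : R)^' --> (0 : R) by exact: cvg_cst.
apply: cvg_trans; apply: near_eq_cvg; apply: cvg_within.
by apply: filterS fE => h fh /=; rewrite fh subrr scaler0.
Qed.

Lemma deriveDv f p v w (a : R) : differentiable f p ->
  'D_v f p + a * 'D_w f p = 'D_(v + a *: w) f p.
Proof. by move=> df; rewrite !deriveE// linearD linearZ. Qed.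

End smooth_more.

Section moving_bump3.
Context {R : realType}.
Variables (n : nat) (a b c d T : R).

(** On [0, T] a function of x - v t and v only: the transport operator
annihilates it (moving_bump3_transport), and the weak formulation of the Cauchy
problem retains only the reaction term. *)
Definition moving_bump3 (p : R * R * R) : R :=
  bump n a b (p.1.2 - p.2 * p.1.1) * bump n c d p.2 * time_cut T p.1.1.

Lemma smooth_moving_bump3 : smooth moving_bump3.
Proof.
apply: smoothM; last exact/smooth_time_cut/smooth_fst3.
apply: smoothM; last exact/smooth_bump/smooth_snd3.
apply/smooth_bump/smoothB; first exact: smooth_mid3.
by apply: smoothM; [exact: smooth_snd3|exact: smooth_fst3].
Qed.

Lemma test_moving_bump3 : test_function moving_bump3.
Proof.
pose Q := `|a| + `|b + 1| + (`|c| + `|d + 1|) * (2 + `|T + 2|).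
apply: (@smooth_test _ _ _ (`[-2, T + 2] `*` `[- Q, Q] `*` `[c, d + 1])%classic).
- exact: smooth_moving_bump3.
- by apply: compact_setX; [apply: compact_setX|]; exact: segment_compact.
- apply: compact_closed; first exact: norm_hausdorff.
  by apply: compact_setX; [apply: compact_setX|]; exact: segment_compact.
- move=> [[t x] v]; rewrite /moving_bump3/= mulf_eq0 negb_or => /andP[].
  rewrite mulf_eq0 negb_or => /andP[/bump_supp/andP[h1 h2] /bump_supp/andP[h3 h4]] /time_cut_supp h5.
  rewrite !in_itv/= h5 (ltW h3) (ltW h4).
  have tb : `|t| <= 2 + `|T + 2|.
    move: h5 => /andP[h6 h7]; rewrite ler_norml.
    have := ler_norm (T + 2); have := normr_ge0 (T + 2) => ? ?; apply/andP; split; lra.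
  have vb : `|v| <= `|c| + `|d + 1|.
    have := ler_norm (d + 1); have := normr_ge0 (d + 1).
    have := normr_ge0 c; have := ler_norm (- c); rewrite normrN => ? ? ? ?.
    rewrite ler_norml; apply/andP; split; lra.
  have vt : `|v * t| <= (`|c| + `|d + 1|) * (2 + `|T + 2|).
    by rewrite normrM ler_pM.
  suff : `|x| <= Q by rewrite ler_norml.
  rewrite -(subrK (v * t) x) (le_trans (ler_normD _ _))// lerD//.
  have := ler_norm (b + 1); have := normr_ge0 (b + 1).
  have := normr_ge0 a; have := ler_norm (- a); rewrite normrN => ? ? ? ?.
  rewrite ler_norml; apply/andP; split; lra.
Qed.

Lemma moving_bump3_bump2 t x v : 0 <= t <= T ->
  moving_bump3 (t, x, v) = bump2 n a b c d (x - v * t, v).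
Proof.
by move=> /andP[? ?]; rewrite /moving_bump3/= time_cut1 ?mulr1//; apply/andP; split; lra.
Qed.

Lemma moving_bump3_transport t x v : 0 <= t <= T ->
  'D_(1, 0, 0) moving_bump3 (t, x, v) + v * 'D_(0, 1, 0) moving_bump3 (t, x, v) = 0.
Proof.
move=> /andP[t0 tT]; rewrite deriveDv; last exact/smooth_diff/smooth_moving_bump3.
apply: derive_locally_cst.
have := nbhs0_le (V := R) (ltr01 : 0 < 1 :> R).
apply: filterS => h; rewrite ler_norml => /andP[h0 h1].
rewrite /moving_bump3/= !scaler0 !addr0 !add0r /GRing.scale/= !mulr1 !mulr0 !add0r.
rewrite !time_cut1; [|apply/andP; split; lra|apply/andP; split; lra].
by congr (bump n a b _ * _ * _); ring.
Qed.
End moving_bump3.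

Section moving_bump2.
Context {R : realType}.
Variables (n : nat) (a b c d : R).

(** The wave equation is stationary.  Its test functions are made to depend on
a time parameter along the flow of relative velocity v - w, so that the
transport term becomes a derivative in time (moving_bump2_ftc). *)
Definition moving_bump2 (w t : R) (p : R * R) : R :=
  bump n a b (p.1 - (p.2 - w) * t) * bump n c d p.2.

Lemma moving_bump2_bump2 w t p : moving_bump2 w t p = bump2 n a b c d (p.1 - (p.2 - w) * t, p.2).
Proof. by []. Qed.

Lemma smooth_moving_bump2 w t : smooth (moving_bump2 w t).
Proof.
apply: smoothM; last exact/smooth_bump/smooth_snd2.
apply/smooth_bump/smoothB; first exact: smooth_fst2.
apply: smoothM; last exact: smooth_cst.
by apply: smoothB; [exact: smooth_snd2|exact: smooth_cst].
Qed.

Lemma test_moving_bump2 w t : test_function (moving_bump2 w t).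
Proof.
pose Q := `|a| + `|b + 1| + (`|c| + `|d + 1| + `|w|) * `|t|.
apply: (@smooth_test _ _ _ (`[- Q, Q] `*` `[c, d + 1])%classic).
- exact: smooth_moving_bump2.
- by apply: compact_setX; exact: segment_compact.
- apply: compact_closed; first exact: norm_hausdorff.
  by apply: compact_setX; exact: segment_compact.
- move=> [x v]; rewrite /moving_bump2/= mulf_eq0 negb_or => /andP[].
  move=> /bump_supp/andP[h1 h2] /bump_supp/andP[h3 h4].
  rewrite !in_itv/= (ltW h3) (ltW h4).
  have vb : `|v - w| <= `|c| + `|d + 1| + `|w|.
    rewrite (le_trans (ler_normB _ _))// lerD//.
    have := ler_norm (d + 1); have := normr_ge0 (d + 1).
    have := normr_ge0 c; have := ler_norm (- c); rewrite normrN => ? ? ? ?.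
    rewrite ler_norml; apply/andP; split; lra.
  have vt : `|(v - w) * t| <= (`|c| + `|d + 1| + `|w|) * `|t|.
    by rewrite normrM ler_pM.
  suff : `|x| <= Q by rewrite ler_norml.
  rewrite -(subrK ((v - w) * t) x) (le_trans (ler_normD _ _))// lerD//.
  have := ler_norm (b + 1); have := normr_ge0 (b + 1).
  have := normr_ge0 a; have := ler_norm (- a); rewrite normrN => ? ? ? ?.
  rewrite ler_norml; apply/andP; split; lra.
Qed.

Definition dbump (x : R) : R := 'D_1 (bump n a b) x.

Lemma smooth_id : smooth (id : R -> R).
Proof.
apply: smooth_lin => [p|p v]; first by apply/derivable1_diffP; exact: derivable_id.
by rewrite !derive_id.
Qed.

Lemma smooth_bump1 : smooth (bump n a b : R -> R).
Proof. exact: (smooth_bump n a b smooth_id). Qed.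

Lemma continuous_dbump : continuous dbump.
Proof. exact/smooth_continuous/smooth_derive/smooth_bump1. Qed.

Lemma dbump_supp x : dbump x != 0 -> a <= x <= b + 1.
Proof.
apply: contraNT; rewrite negb_and -!ltNge => H; apply/eqP.
rewrite /dbump (near_eq_derive (g := cst 0)) ?derive_cst//.
case/orP: H => H; near=> y; apply/eqP.
  apply/negPn/negP => /bump_supp/andP[ay _].
  suff : y < a by rewrite ltNge (ltW ay).
  by near: y; exact: lt_nbhsl.
apply/negPn/negP => /bump_supp/andP[_ yb].
suff : b + 1 < y by rewrite ltNge (ltW yb).
by near: y; exact: lt_nbhsr.
Unshelve. all: by end_near.
Qed.

Lemma dbump_bounded : exists B, forall x, `|dbump x| <= B.
Proof.
have [ab|ab] := leP a (b + 1); last first.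
  exists 0 => x; have [->|/dbump_supp/andP[h1 h2]] := eqVneq (dbump x) 0.
    by rewrite normr0.
  by have := le_lt_trans (le_trans h1 h2) ab; rewrite ltxx.
have [|||u _ uM] := @compact_EVT_max R R (fun x => `|dbump x|) `[a, b + 1]%classic.
- by exists a; rewrite /= in_itv/= lexx.
- exact: segment_compact.
- apply: continuous_subspaceT => x; apply: cvg_norm.
  exact: continuous_dbump.
exists `|dbump u| => x; have [->|/dbump_supp h] := eqVneq (dbump x) 0.
  by rewrite normr0.
by apply: uM; rewrite inE/= in_itv.
Qed.

Lemma is_derive_bump (x : R) : is_derive x 1 (bump n a b) (dbump x).
Proof. by apply: derivableP; exact/diff_derivable/smooth_diff/smooth_bump1. Qed.

Lemma derive_moving_bump2 w t p : 'D_(1, 0) (moving_bump2 w t) p =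
  dbump (p.1 - (p.2 - w) * t) * bump n c d p.2.
Proof.
pose k (y : R) : R := bump n c d p.2 * bump n a b y.
have -> : 'D_(1, 0) (moving_bump2 w t) p = 'D_1 k (p.1 - (p.2 - w) * t).
  pose f1 (h : R) : R := h^-1 *: ((moving_bump2 w t \o shift p) (h *: (1, 0)) - moving_bump2 w t p).
  pose f2 (h : R) : R := h^-1 *: ((k \o shift (p.1 - (p.2 - w) * t)) (h *: 1) - k (p.1 - (p.2 - w) * t)).
  transitivity (lim (f1 @ (0 : R)^')) => //.
  suff -> : f1 = f2 by [].
  apply/funext => h; rewrite /f1 /f2 /k /moving_bump2/= scaler0 add0r /GRing.scale/= mulr1.
  rewrite -addrA ![_ * bump n c d p.2]mulrC.
  by congr (_ * (_ * bump _ _ _ _ - _)); ring.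
have dk := is_derive_bump (p.1 - (p.2 - w) * t).
rewrite /k (_ : (fun y => _) = bump n c d p.2 *: bump n a b)//.
have [_ ->] := is_deriveZ (bump n c d p.2) dk.
by rewrite /GRing.scale/= mulrC.
Qed.

Lemma moving_bump2_ftc w T p : 0 <= T -> moving_bump2 w T p - moving_bump2 w 0 p =
  \int[lebesgue_measure]_(t in `[0, T]) (- (p.2 - w) * 'D_(1, 0) (moving_bump2 w t) p).
Proof.
move=> T0.
have dl (t : R) : is_derive t (1 : R) (fun t : R => p.1 - (p.2 - w) * t) (- (p.2 - w)).
  by apply: is_derive_eq; rewrite /GRing.scale/=; ring.
have dF (t : R) : is_derive t 1 (fun t => moving_bump2 w t p) (- (p.2 - w) * 'D_(1, 0) (moving_bump2 w t) p).
  rewrite derive_moving_bump2.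
  have := @is_derive1_comp R (bump n a b) _ t _ _ (is_derive_bump _) (dl t).
  move/(is_deriveZ (bump n c d p.2)).
  rewrite (_ : _ *: _ = - (p.2 - w) * (dbump (p.1 - (p.2 - w) * t) * bump n c d p.2)); last first.
    by rewrite /GRing.scale/=; ring.
  rewrite (_ : _ \*: _ = fun t => moving_bump2 w t p)//.
  by apply/funext => s; rewrite /moving_bump2 mulrC.
have cF (t : R) : {for t, continuous (fun t => moving_bump2 w t p)}.
  by apply: differentiable_continuous; apply/derivable1_diffP; have [] := dF t.
move: T0; rewrite le_eqVlt => /orP[/eqP <-|T0].
  by rewrite subrr set_itv1 Rintegral_set1.
have ct : continuous (fun t => - (p.2 - w) * 'D_(1, 0) (moving_bump2 w t) p).
  have -> : (fun t => - (p.2 - w) * 'D_(1, 0) (moving_bump2 w t) p) =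
      (fun t => (- (p.2 - w) * bump n c d p.2) * dbump (p.1 - (p.2 - w) * t)).
    by apply/funext => s; rewrite derive_moving_bump2 [dbump _ * _]mulrC mulrA.
  move=> t; have h2 : {for t, continuous (dbump \o (fun t0 => p.1 - (p.2 - w) * t0))}.
    apply: continuous_comp; last exact: continuous_dbump.
    by apply: differentiable_continuous; apply/derivable1_diffP; have [] := dl t.
  have := @cvgM R R (nbhs t) _ (fun=> - (p.2 - w) * bump n c d p.2) _ _ _ (cvg_cst _) h2.
  by apply; exact: nbhs_filter.
rewrite /Rintegral (continuous_FTC2 T0 (F := fun t => moving_bump2 w t p)).
- by rewrite -EFinB.
- exact: continuous_subspaceT.
- split=> [t _||].
  + by have [] := dF t.
  + exact: (cvg_at_right_filter (cF 0)).
  + exact: (cvg_at_left_filter (cF T)).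
- by move=> t _; rewrite derive1E; have [_ ->] := dF t.
Qed.
End moving_bump2.

(** * Mild form of the Cauchy problem *)

Section profile.
Context {R : realType}.
Notation mu := (@lebesgue_measure R).
Notation mu2 := (mu \x mu)%E.
Let T1 := measurableTypeR R.
Let T2 := (T1 * T1)%type.
Let T3 := (T1 * T2)%type.

(** The velocity distribution extended by 0 to the whole line.  A bound and a
bounded interval are all that remains of the continuity of M and of the
compactness of its support. *)
Record profile (m : R -> R) (Mx L : R) : Prop := Profile {
  pf_meas : measurable_fun setT m ;
  pf_ge0 : forall v, 0 <= m v ;
  pf_le : forall v, m v <= Mx * \1_(`[- L, L]%classic) v ;
  pf_mass : \int[mu]_v m v = 1 }.

Definition reac (m : R -> R) r (h : R -> R) (v : R) : R :=
  (m v * \int[mu]_w h w - h v) + r * \int[mu]_w h w * (m v - h v).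

Variables (m : R -> R) (Mx L : R).
Hypothesis pm : profile m Mx L.

Lemma pf_Mx v : m v <= Mx.
Proof.
have Mx0 : 0 <= Mx.
  apply: contraT; rewrite -ltNge => Mx0.
  have m0 w : m w = 0.
    apply/eqP; rewrite eq_le (pf_ge0 pm) andbT (le_trans (pf_le pm w))//.
    by rewrite nmulr_rle0.
  have := pf_mass pm; rewrite (_ : m = cst 0) ?Rintegral_cst//; last exact/funext.
  by rewrite mul0r => /eqP; rewrite eq_sym oner_eq0.
by rewrite (le_trans (pf_le pm v))// ler_piMr// indicE lern1; case: (_ \in _).
Qed.

Lemma pf_bdd (h : R -> R) : measurable_fun setT h -> (forall v, `|h v| <= m v) ->
  mu.-integrable setT (EFin \o h).
Proof.
move=> mh hm; apply: (@bdd_integrable _ T1 R mu h `[- L, L]%classic Mx) => //.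
  exact: mu_itv_lty.
by move=> v; rewrite (le_trans (hm v))// (pf_le pm).
Qed.

Lemma pf_int : mu.-integrable setT (EFin \o m).
Proof. by apply: pf_bdd => [|v]; [exact: pf_meas pm|rewrite ger0_norm ?(pf_ge0 pm)]. Qed.

Lemma rho_bound (h : R -> R) : measurable_fun setT h -> (forall v, 0 <= h v <= m v) ->
  0 <= \int[mu]_v h v <= 1.
Proof.
move=> mh hm; have h0 v : 0 <= h v by have /andP[] := hm v.
have hle v : h v <= m v by have /andP[] := hm v.
rewrite Rintegral_ge0//= -(pf_mass pm); apply: le_Rintegral => //.
  by apply: pf_bdd => // v; rewrite ger0_norm.
exact: pf_int.
Qed.

Lemma reac_bound r (h : R -> R) v : 0 <= r -> measurable_fun setT h -> (forall v, 0 <= h v <= m v) ->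
  `|reac m r h v| <= (1 + r) * m v.
Proof.
move=> r0 mh hm; have /andP[q0 q1] := rho_bound mh hm.
rewrite /reac; set q := Rintegral _ _ _ in q0 q1 *.
have /andP[h0 h1] := hm v.
rewrite mulrDl mul1r (le_trans (ler_normD _ _))// lerD//.
  rewrite ler_norml; apply/andP; split; nra.
rewrite -mulrA normrM ger0_norm// ler_wpM2l// ger0_norm ?mulr_ge0 ?subr_ge0//.
nra.
Qed.

Definition field (G : R * (R * R) -> R) : Prop :=
  measurable_fun setT G /\ forall q, 0 <= G q <= m q.2.2.

Definition rhoG (G : R * (R * R) -> R) (t z : R) : R := \int[mu]_w G (t, (z, w)).

Definition Rg r (G : R * (R * R) -> R) (q : R * (R * R)) : R :=
  reac m r (fun w => G (q.1, (q.2.1, w))) q.2.2.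

Lemma measurable_slice (G : R * (R * R) -> R) t z : measurable_fun setT G ->
  measurable_fun setT (fun w => G (t, (z, w))).
Proof.
move=> mG; apply: (measurableT_comp mG).
by apply: measurable_fun_pair => //; exact: measurable_fun_pair.
Qed.

Lemma measurable_rhoG (G : R * (R * R) -> R) : measurable_fun setT G ->
  measurable_fun setT (fun q : T1 * T1 => rhoG G q.1 q.2).
Proof.
move=> mG.
have mG' : measurable_fun setT (fun q : (T1 * T1) * T1 => G (q.1.1, (q.1.2, q.2))).
  apply: (measurableT_comp mG); apply: measurable_fun_pair; first exact: measurableT_comp.
  by apply: measurable_fun_pair => //; exact: measurableT_comp.
exact: (@measurable_Rint2 _ _ _ _ _ mu _ mG').
Qed.

Lemma rhoG_bound G t z : field G -> 0 <= rhoG G t z <= 1.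
Proof.
by move=> [mG Gm]; apply: rho_bound; [exact: measurable_slice|move=> v; exact: Gm].
Qed.

Lemma measurable_Rg r G : field G -> measurable_fun setT (Rg r G : T3 -> R).
Proof.
move=> [mG _].
have mr : measurable_fun setT (fun q : T3 => rhoG G q.1 q.2.1).
  have mp : measurable_fun setT (fun q : T3 => (q.1, q.2.1) : T1 * T1).
    by apply: measurable_fun_pair => //; exact: measurableT_comp.
  exact: (measurableT_comp (measurable_rhoG mG) mp).
have mm : measurable_fun setT (fun q : T3 => m q.2.2).
  by apply: (measurableT_comp (pf_meas pm)); exact: measurableT_comp.
rewrite (_ : Rg r G = fun q => (m q.2.2 * rhoG G q.1 q.2.1 - G q) +
    r * rhoG G q.1 q.2.1 * (m q.2.2 - G q)); last first.
  by apply/funext => -[t [z v]].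
apply: measurable_funD; first by apply: measurable_funB => //; exact: measurable_funM.
by apply: measurable_funM; [exact: measurable_funM|exact: measurable_funB].
Qed.

Lemma Rg_bound r G q : 0 <= r -> field G -> `|Rg r G q| <= (1 + r) * m q.2.2.
Proof.
move=> r0 [mG Gm]; apply: reac_bound => //; exact: measurable_slice.
Qed.

(** Position reached from p after the time t, seen in the frame of speed w. *)
Definition char (w t : R) (p : R * R) : R * R := (p.1 + (p.2 - w) * t, p.2).


Lemma measurable_char3 w : measurable_fun setT (fun q : T3 => (q.1, char w q.1 q.2) : T3).
Proof.
apply: measurable_fun_pair => //; apply: measurable_fun_pair => /=; last exact: measurableT_comp.
apply: measurable_funD; first exact: measurableT_comp.
apply: measurable_funM => //; apply: measurable_funB => //.
exact: measurableT_comp.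
Qed.

(** Duhamel's formula, at each time and for almost every starting point. *)
Definition mild r w (h0 : R * R -> R) (G : R * (R * R) -> R) : Prop :=
  forall T, 0 <= T -> {ae mu2, forall p,
    G (T, char w T p) = h0 p + \int[mu]_(t in `[0, T]) Rg r G (t, char w t p)}.

End profile.

Section velocity.
Context {R : realType}.
Notation mu := (@lebesgue_measure R).
Notation mu2 := (mu \x mu)%E.
Let T1 := measurableTypeR R.
Let T2 := (T1 * T1)%type.
Let T3 := (T1 * T2)%type.

Variables (V : set R) (M : R -> R).
Hypothesis vd : velocity_data V M.

Lemma measurable_V : measurable V.
Proof. by rewrite -(vd_supp vd); apply: closed_measurable; exact: closed_closure. Qed.

Lemma V_neq0 : V !=set0.
Proof.
apply: contrapT => /set0P/negP/negPn/eqP V0; have := vd_mass vd.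
by rewrite V0 integral_set0 => /eqP; rewrite eq_sym onee_eq0.
Qed.

Lemma V_bounded : exists L, V `<=` `[- L, L]%classic.
Proof.
have [L [_ VL]] := compact_bounded (vd_compact vd).
exists (L + 1) => v Vv; rewrite /= in_itv/= -ler_norml.
by apply: VL => //; rewrite ltrDl.
Qed.

Lemma profileM : exists Mx L, 0 < L /\ V `<=` `[- L, L]%classic /\ profile (M \_ V) Mx L.
Proof.
have [L VL] := V_bounded.
have [u Vu Mu] := compact_EVT_max V_neq0 (vd_compact vd) (vd_cont vd).
have VL' : V `<=` `[- (`|L| + 1), `|L| + 1]%classic.
  move=> v /VL; rewrite /= !in_itv/= => /andP[h1 h2].
  by have := ler_norm L => ?; apply/andP; split; lra.
exists (M u), (`|L| + 1); split; first by rewrite ltr_pwDr.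
split => //; split.
- apply/(measurable_restrict _ measurable_V measurableT).
  rewrite setTI; apply: subspace_continuous_measurable_fun; first exact: measurable_V.
  exact: vd_cont vd.
- move=> v; rewrite patchE; case: ifP => // /set_mem; exact: vd_ge0 vd _.
- move=> v; rewrite patchE; case: ifPn => [Vv|_].
    by rewrite indicE mem_set ?mulr1 ?Mu//; exact/VL'/set_mem.
  by rewrite mulr_ge0//; apply: (vd_ge0 vd); exact/set_mem.
- have := congr1 fine (vd_mass vd); rewrite integral_mkcond/= => <-; congr fine.
  by apply: eq_integral => v _; rewrite !patchE; case: ifP.
Qed.

Notation m := (M \_ V).

Lemma mem_phase (p : R * R) : (p \in phase V) = (p.2 \in V).
Proof. by apply/idP/idP; rewrite !inE /phase/=; tauto. Qed.

Lemma measurable_phase : @measurable _ T2 (phase V).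
Proof. by apply: measurableX => //; exact: measurable_V. Qed.

Lemma Rint_phase (F H : R * R -> R) :
  (forall z v, V v -> F (z, v) = H (z, v)) -> (forall z v, ~ V v -> H (z, v) = 0) ->
  \int[mu2]_(p in phase V) F p = \int[mu2]_p H p.
Proof.
move=> FH H0; rewrite Rintegral_mkcond; apply: eq_Rintegral => -[z v] _.
rewrite patchE mem_phase/=; case: ifPn => [/set_mem/FH//|/negP nV].
by rewrite H0// => Vv; apply: nV; exact/mem_set.
Qed.

Lemma reaction_tot r (h : R -> R) v : V v ->
  reaction V M r h v = reac m r (h \_ V) v.
Proof.
move=> Vv; have hv : v \in V by exact/mem_set.
by rewrite /reaction /reac /rho Rintegral_mkcond !patchE hv.
Qed.

Lemma reac0 r (h : R -> R) v : ~ V v -> reac m r (h \_ V) v = 0.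
Proof.
move=> Vv; have hv : v \in V = false by apply/negbTE/negP => /set_mem.
by rewrite /reac !patchE hv !mul0r !subrr mulr0 addr0.
Qed.

(** Testing against a transported bump amounts to testing the function pulled
back by the flow, which preserves the measure, against a fixed bump. *)
Lemma Rint_flow (F : R * R -> R) C n a b c d (s : R -> R) :
  measurable_fun setT F -> (forall p, `|F p| <= C) -> measurable_fun setT s ->
  \int[mu2]_p (F p * bump2 n a b c d (p.1 - s p.2, p.2)) =
  \int[mu2]_p (F (shear s p) * bump2 n a b c d p).
Proof.
move=> mF FC ms.
have C0 : 0 <= C := le_trans (normr_ge0 _) (FC (0, 0)).
have mF2 : measurable_fun setT (F : T2 -> R) := mF.
have mFs : measurable_fun setT (F \o shear s : T2 -> R).
  exact: (measurableT_comp mF2 (measurable_shear ms)).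
rewrite -[RHS](@Rintegral_shear _ (fun v => - s v)).
- apply: eq_Rintegral => -[z v] _; congr (F _ * _).
  by rewrite /shear/= subrK.
- exact: measurable_funN.
- apply: (@bdd_integrable _ T2 R mu2 (fun p => F (shear s p) * bump2 n a b c d p)
    (`[a, b + 1]%classic `*` `[c, d + 1]%classic) C).
  + by apply: measurable_funM => //; exact: measurable_bump2.
  + exact: measurableX.
  + exact: box_fin.
  + by move=> p; rewrite normrM ler_pM// bump2_le.
Qed.

End velocity.

Section cauchy.
Context {R : realType}.
Notation mu := (@lebesgue_measure R).
Notation mu2 := (mu \x mu)%E.
Let T1 := measurableTypeR R.
Let T2 := (T1 * T1)%type.
Let T3 := (T1 * T2)%type.

Variables (V : set R) (M : R -> R) (r c : R) (g0 : R * R -> R) (g : R * R * R -> R).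
Hypothesis vd : velocity_data V M.
Hypothesis r0 : 0 < r.
Hypothesis cs : cauchy_solution V M r g0 g.
Hypothesis mg0 : measurable_fun (phase V) g0.
Hypothesis g0M : forall x v, V v -> 0 <= g0 (x, v) <= M v.
Notation m := (M \_ V).

Definition gtot (q : R * (R * R)) : R :=
  (g \_ (`[0, +oo[%classic `*` [set: R] `*` V)) (q.1, q.2.1, q.2.2).

Lemma gtotE t x v : gtot (t, (x, v)) = if (0 <= t) && (v \in V) then g (t, x, v) else 0.
Proof.
rewrite /gtot patchE/=; congr (if _ then _ else _).
apply/idP/idP.
  by rewrite inE/= in_itv/= andbT => -[[-> _] /mem_set].
by move=> /andP[t0 /set_mem Vv]; apply/mem_set; rewrite /= in_itv/= t0.
Qed.

Lemma gtot_slice t z : 0 <= t ->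
  (fun w => gtot (t, (z, w))) = (fun w => g (t, z, w)) \_ V.
Proof. by move=> t0; apply/funext => w; rewrite gtotE t0 patchE. Qed.

Lemma field_gtot : field m gtot.
Proof.
split.
  have mp : measurable_fun setT (fun q : T3 => (q.1, q.2.1, q.2.2) : (T1 * T1) * T1).
    apply: measurable_fun_pair; last exact: measurableT_comp.
    by apply: measurable_fun_pair => //; exact: measurableT_comp.
  have mD : @measurable _ ((T1 * T1) * T1)%type (`[0, +oo[%classic `*` [set: R] `*` V).
    apply: measurableX; last exact: measurable_V vd.
    by apply: measurableX.
  have mgD : measurable_fun setT ((g \_ (`[0, +oo[%classic `*` [set: R] `*` V)) : (T1 * T1) * T1 -> R).
    apply/(measurable_restrict _ mD measurableT); rewrite setTI; exact: (cs_meas cs).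
  exact: (measurableT_comp mgD mp).
move=> [t [x v]]; rewrite gtotE patchE/=.
case: (boolP (v \in V)) => [/set_mem Vv|_]; last by rewrite andbF lexx.
by case: (boolP (0 <= t)) => [t0|_]/=; [exact: (cs_bounds cs)|rewrite lexx (vd_ge0 vd)].
Qed.

(** The solution in the frame moving at speed c. *)
Definition gmov (q : R * (R * R)) : R := gtot (q.1, (q.2.1 + c * q.1, q.2.2)).

Lemma field_gmov : field m gmov.
Proof.
have [mg gb] := field_gtot; split; last by move=> [t [x v]]; exact: gb.
have mp : measurable_fun setT (fun q : T3 => (q.1, (q.2.1 + c * q.1, q.2.2)) : T3).
  apply: measurable_fun_pair => //; apply: measurable_fun_pair => /=; last exact: measurableT_comp.
  apply: measurable_funD; first exact: measurableT_comp.
  exact: measurable_funM.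
exact: (measurableT_comp mg mp).
Qed.

Lemma Rg_gmov t p : Rg m r gmov (t, char c t p) = Rg m r gtot (t, (p.1 + p.2 * t, p.2)).
Proof.
rewrite /Rg /gmov /char/=; have -> : p.1 + (p.2 - c) * t + c * t = p.1 + p.2 * t by ring.
by [].
Qed.

Lemma gmov_char t p : gmov (t, char c t p) = gtot (t, (p.1 + p.2 * t, p.2)).
Proof. by rewrite /gmov /char/=; congr (gtot (_, (_, _))); ring. Qed.

(** The weak equation tested with a bump carried by the free flow is a balance
between the times 0 and T in which only the reaction remains; pulled back by the
flow it is the hypothesis of mild_of_weak. *)
Lemma mild_cauchy : mild m r c (g0 \_ (phase V)) gmov.
Proof.
move=> T T0.
have [Mx [L [L0 [VL pm]]]] := profileM vd.
have fg := field_gmov; have ft := field_gtot.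
have [mg gb] := fg.
have Mx0 : 0 <= Mx by rewrite (le_trans (pf_ge0 pm 0))// (pf_Mx pm).
have bE (C x : R) : `|x| <= Mx -> C = (1 + r) * Mx -> `|x| <= C.
  by move=> xM ->; rewrite (le_trans xM)// ler_peMl// lerDl ltW.
have mh0 : measurable_fun setT (g0 \_ (phase V) : T2 -> R).
  by apply/(measurable_restrict _ (measurable_phase vd) measurableT); rewrite setTI.
have mc (t : R) : measurable_fun setT (fun v : R => v * t) by exact: measurable_funM.
have bg q : `|gmov q| <= Mx.
  by have /andP[h1 h2] := gb q; rewrite ger0_norm// (le_trans h2)// (pf_Mx pm).
have bgt q : `|gtot q| <= Mx.
  by have /andP[h1 h2] := ft.2 q; rewrite ger0_norm// (le_trans h2)// (pf_Mx pm).
have bR G q : field m G -> `|Rg m r G q| <= (1 + r) * Mx.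
  move=> fG; rewrite (le_trans (Rg_bound pm q (ltW r0) fG))// ler_wpM2l ?(pf_Mx pm)//.
  by rewrite addr_ge0// ltW.
apply: (@mild_of_weak R (g0 \_ (phase V)) (fun p => gmov (T, char c T p))
   (fun q => Rg m r gmov (q.1, char c q.1 q.2)) ((1 + r) * Mx) T).
- exact: mh0.
- exact: (measurableT_comp mg (measurableT_comp (measurable_char3 c) (pair1_measurable T))).
- exact: (measurableT_comp (measurable_Rg pm r fg) (measurable_char3 c)).
- move=> [z v]; apply: bE => //; rewrite patchE mem_phase/=.
  case: ifP => [/set_mem Vv|_]; last by rewrite normr0.
  have /andP[h1 h2] := g0M z Vv; rewrite ger0_norm// (le_trans h2)//.
  by have := pf_Mx pm v; rewrite patchE mem_set.
- by move=> p; exact: bE (bg _) _.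
- by move=> q; exact: bR.
move=> n a b a' b'.
have TT : 0 <= T <= T by rewrite T0 lexx.
have := cs_eq cs (test_moving_bump3 n a b a' b' T) T0.
rewrite (Rint_phase (H := fun p => gtot (T, p) * bump2 n a b a' b' (p.1 - p.2 * T, p.2))); last 2 first.
- by move=> z v Vv; rewrite gtotE T0 mem_set//= moving_bump3_bump2.
- by move=> z v Vv; rewrite gtotE memNset// andbF mul0r.
rewrite (Rint_phase (H := fun p => (g0 \_ (phase V)) p * bump2 n a b a' b' p)); last 2 first.
- move=> z v Vv; rewrite patchE mem_phase mem_set//= moving_bump3_bump2 ?mulr0 ?subr0//.
  by rewrite lexx.
- by move=> z v Vv; rewrite patchE mem_phase memNset// mul0r.
rewrite (@Rint_flow _ (fun p => gtot (T, p)) Mx _ _ _ _ _ (fun v => v * T))//; last first.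
  exact: (measurableT_comp ft.1 (pair1_measurable T)).
have -> : \int[mu2]_p (gtot (T, shear (fun v => v * T) p) * bump2 n a b a' b' p) =
    \int[mu2]_p (gmov (T, char c T p) * bump2 n a b a' b' p).
  by apply: eq_Rintegral => p _; rewrite gmov_char.
move=> ->; apply: eq_Rintegral => t; rewrite inE/= in_itv/= => tT; have /andP[t0 _] := tT.
rewrite (Rint_phase (H := fun p => Rg m r gtot (t, p) * bump2 n a b a' b' (p.1 - p.2 * t, p.2))); last 2 first.
- move=> z v Vv; rewrite moving_bump3_transport// mulr0 add0r moving_bump3_bump2//; congr (_ * _).
  by rewrite reaction_tot// /Rg/= gtot_slice.
- by move=> z v Vv; rewrite /Rg/= gtot_slice// reac0 ?mul0r.
rewrite (@Rint_flow _ (fun p => Rg m r gtot (t, p)) ((1 + r) * Mx) _ _ _ _ _ (fun v => v * t))//.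
- by apply: eq_Rintegral => p _; rewrite Rg_gmov.
- exact: (measurableT_comp (measurable_Rg pm r ft) (pair1_measurable t)).
- by move=> p; exact: bR.
Qed.
End cauchy.

(** * Mild form of the travelling wave equation *)

Section open_plane.
Context {R : realType}.
Let T1 := measurableTypeR R.
Let T2 := (T1 * T1)%type.

(** Continuity on the phase space refers to the topology of the plane,
measurability to the product of the Borel sets of the line: they are reconciled
by covering an open set with countably many rational squares. *)
Lemma open_plane_measurable (O : set (R * R)) : open O -> @measurable _ T2 O.
Proof.
move=> oO.
pose B (k : rat * rat * nat) : set (R * R) :=
  `](ratr k.1.1 - k.2.+1%:R^-1), (ratr k.1.1 + k.2.+1%:R^-1)[%classic `*`
  `](ratr k.1.2 - k.2.+1%:R^-1), (ratr k.1.2 + k.2.+1%:R^-1)[%classic.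
pose B' k := if `[< B k `<=` O >] then B k else set0.
have -> : O = \bigcup_k B' k.
  apply/seteqP; split => [[x y] Oxy|p [k _]]; last first.
    by rewrite /B'; case: asboolP => // BO /BO.
  have [e /= e0 eO] : exists2 e : R, 0 < e & ball (x, y) e `<=` O.
    by have /nbhs_ballP[e e0 eO] := open_nbhs_nbhs (conj oO Oxy); exists e.
  have [n ne] : exists n : nat, n.+1%:R^-1 < e / 2.
    exists (Num.truncn (e / 2)^-1); rewrite invf_plt ?posrE ?divr_gt0//.
    exact: truncnS_gt.
  have n0 : 0 < n.+1%:R^-1 :> R by rewrite invr_gt0.
  have [q1 q1x] : exists q : rat, x < ratr q < x + n.+1%:R^-1.
    have := @rat_in_itvoo R x (x + n.+1%:R^-1).
    by rewrite ltrDl n0 => /(_ isT)[q]; rewrite in_itv/= => ?; exists q.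
  have [q2 q2y] : exists q : rat, y < ratr q < y + n.+1%:R^-1.
    have := @rat_in_itvoo R y (y + n.+1%:R^-1).
    by rewrite ltrDl n0 => /(_ isT)[q]; rewrite in_itv/= => ?; exists q.
  exists (q1, q2, n) => //; rewrite /B' asboolT.
    move: q1x q2y => /andP[? ?] /andP[? ?].
    by split; rewrite /B/= in_itv/= ?ltrBlDr; apply/andP; split => //; rewrite ltr_pwDr ?ltW//.
  move=> [u v] [/=]; rewrite !in_itv/= => /andP[u1 u2] /andP[v1 v2].
  move: q1x q2y u1 u2 v1 v2 ne; set d := n.+1%:R^-1.
  move=> /andP[? ?] /andP[? ?] ? ? ? ? ?.
  by apply: eO; split; rewrite /ball/= ltr_norml; apply/andP; split; lra.
apply: countable_bigcupT_measurable => // k; rewrite /B'.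
by case: ifP => _ //; apply: measurableX.
Qed.

Lemma continuous_phase_measurable (V : set R) (f : R * R -> R) :
  measurable V -> closed V -> {within phase V, continuous f} ->
  @measurable_fun _ _ T2 R (phase V) f.
Proof.
move=> mV cV cf.
have mP : @measurable _ T2 (phase V) by exact: measurableX.
apply: (measurability _ (RGenOpens.measurableE R)).
move=> _ [_ [a [b ->] <-]].
have /continuousP cf' := cf.
have oU : open (`]a, b[%classic : set R) by exact: interval_open.
have /open_subspaceP [W oW WE] := cf' _ oU.
rewrite setIC -WE; apply: measurableI => //.
exact: open_plane_measurable.
Qed.
End open_plane.

Section wave.
Context {R : realType}.
Notation mu := (@lebesgue_measure R).
Notation mu2 := (mu \x mu)%E.
Let T1 := measurableTypeR R.
Let T2 := (T1 * T1)%type.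
Let T3 := (T1 * T2)%type.

Variables (V : set R) (M : R -> R) (r c : R) (f : R * R -> R).
Hypothesis vd : velocity_data V M.
Hypothesis r0 : 0 < r.
Hypothesis tw : travelling_wave V M r c f.
Notation m := (M \_ V).

Definition ftot (p : R * R) : R := (f \_ (phase V)) p.

Lemma ftotE z v : ftot (z, v) = if v \in V then f (z, v) else 0.
Proof. by rewrite /ftot patchE mem_phase. Qed.

Lemma ftot_slice z : (fun w => ftot (z, w)) = (fun w => f (z, w)) \_ V.
Proof. by apply/funext => w; rewrite ftotE patchE. Qed.

Lemma Rg_fG t z v : Rg m r (fun q => ftot q.2) (t, (z, v)) = reac m r ((fun w => f (z, w)) \_ V) v.
Proof. by rewrite -ftot_slice. Qed.

Lemma closed_V : closed V.
Proof. by rewrite -(vd_supp vd); exact: closed_closure. Qed.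

Lemma measurable_ftot : measurable_fun setT (ftot : T2 -> R).
Proof.
apply/(measurable_restrict _ (measurable_phase vd) measurableT); rewrite setTI.
apply: continuous_phase_measurable; first exact: measurable_V vd.
- exact: closed_V.
- exact: tw_cont tw.
Qed.

Lemma ftot_bound p : 0 <= ftot p <= m p.2.
Proof.
case: p => z v; rewrite ftotE patchE/=; case: ifP => [/set_mem Vv|]; last by rewrite lexx.
exact: tw_bounds tw _ _ Vv.
Qed.

(** The wave as a stationary field. *)
Definition fG (q : R * (R * R)) : R := ftot q.2.

Lemma field_fG : field m fG.
Proof.
split; last by move=> q; exact: ftot_bound.
exact: (measurableT_comp measurable_ftot (@measurable_snd _ _ T1 T2)).
Qed.

(** The stationary equation is tested with a bump carried along the flow for a
time t, then integrated in t over [0, T]; the transport term becomes the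
difference between the values at T and at 0. *)
Lemma mild_wave : mild m r c ftot fG.
Proof.
move=> T T0.
have [Mx [L [L0 [VL pm]]]] := profileM vd.
have ff := field_fG; have mf := measurable_ftot.
have Mx0 : 0 <= Mx by rewrite (le_trans (pf_ge0 pm 0))// (pf_Mx pm).
have bf p : `|ftot p| <= Mx.
  by have /andP[h1 h2] := ftot_bound p; rewrite ger0_norm// (le_trans h2)// (pf_Mx pm).
have bR q : `|Rg m r fG q| <= (1 + r) * Mx.
  rewrite (le_trans (Rg_bound pm q (ltW r0) ff))// ler_wpM2l ?(pf_Mx pm)//.
  by rewrite addr_ge0// ltW.
have MC : Mx <= (1 + r) * Mx by rewrite ler_peMl// lerDl ltW.
have mc (t : R) : measurable_fun setT (fun v : R => (v - c) * t).
  by apply: measurable_funM => //; exact: measurable_funB.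
apply: (@mild_of_weak R ftot (fun p => fG (T, char c T p))
   (fun q => Rg m r fG (q.1, char c q.1 q.2)) ((1 + r) * Mx) T).
- exact: mf.
- exact: (measurableT_comp ff.1 (measurableT_comp (measurable_char3 c) (pair1_measurable T))).
- exact: (measurableT_comp (measurable_Rg pm r ff) (measurable_char3 c)).
- by move=> p; exact: le_trans (bf _) MC.
- by move=> p; exact: le_trans (bf _) MC.
- by move=> q; exact: bR.
move=> n a b a' b'.
have flowE (t : R) : \int[mu2]_p (ftot p * moving_bump2 n a b a' b' c t p) =
    \int[mu2]_p (ftot (char c t p) * bump2 n a b a' b' p).
  exact: (@Rint_flow _ ftot Mx _ _ _ _ _ (fun v => (v - c) * t)).
have -> : \int[mu2]_p (fG (T, char c T p) * bump2 n a b a' b' p) =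
    \int[mu2]_p (ftot p * moving_bump2 n a b a' b' c T p) by rewrite flowE.
have -> : \int[mu2]_p (ftot p * bump2 n a b a' b' p) =
    \int[mu2]_p (ftot p * moving_bump2 n a b a' b' c 0 p).
  by apply: eq_Rintegral => -[z v] _; rewrite moving_bump2_bump2/= mulr0 subr0.
have ib t : mu2.-integrable setT (EFin \o (fun p => ftot p * moving_bump2 n a b a' b' c t p)).
  have ih : mu2.-integrable setT (EFin \o (fun p => ftot (char c t p) * bump2 n a b a' b' p)).
    apply: (@bdd_integrable _ T2 R mu2 (fun p => ftot (char c t p) * bump2 n a b a' b' p)
      (`[a, b + 1]%classic `*` `[a', b' + 1]%classic) Mx).
    - apply: measurable_funM; last exact: measurable_bump2.
      exact: (measurableT_comp mf (measurable_shear (mc t))).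
    - exact: measurableX.
    - exact: box_fin.
    - by move=> p; rewrite normrM ler_pM// bump2_le.
  have mN : measurable_fun setT (fun v : R => - ((v - c) * t)).
    by apply: measurableT_comp => //; exact: mc.
  have := integrable_shear mN ih.
  apply: (@eq_integrable _ T2 R mu2 setT measurableT) => -[z v] _.
  by rewrite /= moving_bump2_bump2 /shear /char/= subrK.
rewrite -RintegralB//.
have [B dB] := dbump_bounded n a b.
have B0 : 0 <= B := le_trans (normr_ge0 _) (dB 0).
pose Q := `|a| + `|b + 1| + (L + `|c|) * T.
pose D : set T2 := `[- Q, Q]%classic `*` `[- L, L]%classic.
pose F (q : R * (R * R)) := ftot q.2 * (- (q.2.2 - c)) *
   (dbump n a b (q.2.1 - (q.2.2 - c) * q.1) * bump n a' b' q.2.2) * \1_(`[0, T]%classic) q.1.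
have mdb : measurable_fun setT (dbump n a b).
  apply: continuous_measurable_fun; exact: continuous_dbump.
have m2 : measurable_fun setT (fun q : T3 => q.2.2 : R).
  exact: (measurableT_comp (@measurable_snd _ _ T1 T1) (@measurable_snd _ _ T1 T2)).
have m1 : measurable_fun setT (fun q : T3 => q.2.1 : R).
  exact: (measurableT_comp (@measurable_fst _ _ T1 T1) (@measurable_snd _ _ T1 T2)).
have mF : measurable_fun setT (F : T3 -> R).
  apply: measurable_funM; last first.
    by apply: (measurableT_comp (f := \1_(`[0, T]%classic) : R -> R)).
  apply: measurable_funM.
    apply: measurable_funM; first exact: (measurableT_comp mf (@measurable_snd _ _ T1 T2)).
    by apply: measurableT_comp => //; exact: measurable_funB.
  apply: measurable_funM; last exact: (measurableT_comp (measurable_bump n a' b') m2).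
  apply: (measurableT_comp mdb); apply: measurable_funB; first exact: m1.
  by apply: measurable_funM => //; exact: measurable_funB.
have K0 : 0 <= L + `|c| by rewrite addr_ge0// ltW.
have FC q : `|F q| <= Mx * (L + `|c|) * B * \1_(`[0, T]%classic `*` D) q.
  have [->|] := eqVneq (F q) 0; first by rewrite normr0 !mulr_ge0.
  case: q => t [z v]; rewrite /F/= 4!mulf_eq0 !negb_or.
  move=> /andP[/andP[/andP[fn _] /andP[dn bn]] tn].
  have tT : t \in `[0, T]%classic by move: tn; rewrite indicE; case: (_ \in _) => //; rewrite eqxx.
  have Vv : V v by move: fn; rewrite ftotE; case: ifP => [/set_mem//|]; rewrite eqxx.
  have vL : - L <= v <= L by have := VL _ Vv; rewrite /= in_itv.
  have vc : `|v - c| <= L + `|c|.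
    by rewrite (le_trans (ler_normB _ _))// lerD// ler_norml.
  have vt : `|(v - c) * t| <= (L + `|c|) * T.
    move: tT; rewrite inE/= in_itv/= => /andP[t0 tT'].
    by rewrite normrM ler_pM// ger0_norm.
  have /andP[d1 d2] := dbump_supp dn.
  have zQ : - Q <= z <= Q.
    rewrite -ler_norml -(subrK ((v - c) * t) z) (le_trans (ler_normD _ _))// lerD//.
    have := ler_norm (b + 1); have := normr_ge0 (b + 1).
    have := normr_ge0 a; have := ler_norm (- a); rewrite normrN => ? ? ? ?.
    by rewrite ler_norml; apply/andP; split; lra.
  rewrite !indicE tT mem_set/=; last first.
    by split; [move: tT; rewrite inE|split; rewrite /= in_itv].
  rewrite !mulr1 3!normrM normrN -[leRHS]mulr1 -[leRHS]mulrA.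
  rewrite ler_pM ?mulr_ge0//.
    by rewrite ler_pM// ; exact: bf.
  have nb : `|bump n a' b' v| <= 1 by rewrite ger0_norm ?bump_le1 ?bump_ge0.
  by apply: ler_pM.
have MK0 : 0 <= Mx * (L + `|c|) * B by rewrite !mulr_ge0.
have Fp p : mu.-integrable setT (fun t => (F (t, p))%:E).
  apply: (@bdd_integrable _ T1 R mu (fun t => F (t, p)) `[0, T]%classic (Mx * (L + `|c|) * B)) => //.
  - exact: (measurableT_comp mF (pair2_measurable p)).
  - exact: mu_itv_lty.
  - move=> t; rewrite (le_trans (FC _))// ler_wpM2l// !indicE in_setX/=.
    by case: (t \in `[0, T]%classic); case: (p \in D); rewrite //= ?ler01.
have Ft t : mu2.-integrable setT (fun p => (F (t, p))%:E).
  apply: (@bdd_integrable _ T2 R mu2 (fun p => F (t, p)) D (Mx * (L + `|c|) * B)) => //.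
  - exact: (measurableT_comp mF (pair1_measurable t)).
  - exact: measurableX.
  - exact: box_fin.
  - move=> p; rewrite (le_trans (FC _))// ler_wpM2l// !indicE in_setX/=.
    by case: (t \in `[0, T]%classic); case: (p \in D); rewrite //= ?ler01.
transitivity (\int[mu2]_p \int[mu]_t F (t, p)).
  apply: eq_Rintegral => p _; rewrite -mulrBr moving_bump2_ftc// Rint_indic.
  pose G t : R := - (p.2 - c) * 'D_(1, 0) (moving_bump2 n a b a' b' c t) p * \1_(`[0, T]%classic) t.
  have FE t : F (t, p) = ftot p * G t by rewrite /F /G derive_moving_bump2/=; ring.
  have [f0|f0] := eqVneq (ftot p) 0.
    rewrite f0 mul0r; transitivity (\int[mu]_t (cst 0 t : R)).
      by rewrite Rintegral_cst// mul0r.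
    by apply: eq_Rintegral => t _; rewrite FE f0 mul0r.
  have iG : mu.-integrable setT (EFin \o G).
    have := @integrableZl _ T1 R mu setT measurableT (ftot p)^-1 _ (Fp p).
    apply: (@eq_integrable _ T1 R mu setT measurableT) => t _.
    by rewrite /= FE -EFinM mulKf.
  under [RHS]eq_Rintegral do rewrite FE.
  by rewrite RintegralZl.
transitivity (\int[mu]_t \int[mu2]_p F (t, p)).
  apply/esym/(@Rfubini _ _ T1 T2 R mu plane F).
  - have tD : ((mu \x plane) (`[0%R, T]%classic `*` D) < +oo)%E.
      rewrite product_measure1E//; last exact: measurableX.
      apply: lte_mul_pinfty.
      + exact: measure_ge0.
      + by rewrite ge0_fin_numE; [exact: mu_itv_lty|exact: measure_ge0].
      + exact: box_fin.
    apply: (@bdd_integrable _ T3 R _ _ (`[0, T]%classic `*` D) (Mx * (L + `|c|) * B)) => //.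
    by apply: measurableX => //; exact: measurableX.
  - exact: Ft.
  - exact: Fp.
rewrite [RHS]Rint_indic; apply: eq_Rintegral => t _.
have [tT|tT] := boolP (t \in `[0, T]%classic); last first.
  transitivity (\int[mu2]_p (cst 0 p : R)).
    by apply: eq_Rintegral => p _; rewrite /F/= indicE (negbTE tT) mulr0.
  by rewrite Rintegral_cst// mul0r indicE (negbTE tT) mulr0.
rewrite indicE tT mulr1.
transitivity (\int[mu2]_p (Rg m r fG (t, p) * moving_bump2 n a b a' b' c t p)); last first.
  apply: (@Rint_flow _ (fun p => Rg m r fG (t, p)) ((1 + r) * Mx) _ _ _ _ _ (fun v => (v - c) * t)).
  - exact: (measurableT_comp (measurable_Rg pm r ff) (pair1_measurable t)).
  - by move=> p; exact: bR.
  - exact: mc.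
rewrite -[RHS](Rint_phase (V := V) (F := fun p => reaction V M r (fun v => f (p.1, v)) p.2 * moving_bump2 n a b a' b' c t p)); last 2 first.
- move=> z v Vv; congr (_ * _).
  rewrite -[RHS]/(Rg m r (fun q => ftot q.2) (t, (z, v))) Rg_fG.
  exact: reaction_tot.
- move=> z v Vv.
  rewrite -[Rg _ _ _ _]/(Rg m r (fun q => ftot q.2) (t, (z, v))) Rg_fG.
  by rewrite reac0 ?mul0r.
rewrite -(tw_eq tw (test_moving_bump2 n a b a' b' c t)).
rewrite (Rint_phase (V := V) (H := fun p => (p.2 - c) * ftot p * 'D_(1, 0) (moving_bump2 n a b a' b' c t) p)); last 2 first.
- by move=> z v Vv /=; rewrite ftotE (mem_set Vv).
- by move=> z v Vv; rewrite ftotE memNset// mulr0 mul0r.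
have FE p : F (t, p) = -1 * ((p.2 - c) * ftot p * 'D_(1, 0) (moving_bump2 n a b a' b' c t) p).
  by rewrite /F/= derive_moving_bump2 indicE tT mulr1; ring.
rewrite -mulN1r -RintegralZl//.
  by apply: eq_Rintegral => p _; rewrite FE.
have := @integrableZl _ T2 R mu2 setT measurableT (-1) _ (Ft t).
apply: eq_integrable => // p _.
by rewrite FE -EFinM mulrA mulrNN !mul1r.
Qed.
End wave.

(** * Calculus along characteristics *)

Section sets.
Context d (T : measurableType d) (R : realType).

Lemma measurable_leset (F H : T -> R) : measurable_fun setT F ->
  measurable_fun setT H -> measurable [set q | F q <= H q].
Proof.
move=> mF mH; rewrite -[X in measurable X]setTI.
rewrite (_ : [set q | _] = (fun q => H q - F q) @^-1` `[0, +oo[).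
  exact: measurable_funB.
by apply/seteqP; split => q /=; rewrite in_itv/= andbT subr_ge0.
Qed.

Lemma measurable_eqset (F H : T -> R) : measurable_fun setT F ->
  measurable_fun setT H -> measurable [set q | F q = H q].
Proof.
move=> mF mH; rewrite (_ : [set q | _] = [set q | F q <= H q] `&` [set q | H q <= F q]).
  by apply: measurableI; exact: measurable_leset.
apply/seteqP; split => q /=; first by move=> ->.
by move=> [h1 h2]; apply/eqP; rewrite eq_le h1.
Qed.
End sets.

Section exchange.
Context {R : realType}.
Notation mu := (@lebesgue_measure R).
Notation mu2 := (mu \x mu)%E.
Let T1 := measurableTypeR R.
Let T2 := (T1 * T1)%type.
Let T3 := (T1 * T2)%type.

(** What holds at each time for almost every characteristic holds on almost
every characteristic at almost every time; all later computations take place on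
one such characteristic. *)
Lemma ae_exchange (S : R -> R * R -> Prop) :
  @measurable _ T3 [set q | S q.1 q.2] ->
  (forall t, 0 <= t -> {ae mu2, forall p, S t p}) ->
  {ae mu2, forall p, {ae mu, forall t, 0 <= t -> S t p}}.
Proof.
move=> mS aeS.
have mS' : @measurable _ T3 [set q | 0 <= q.1 -> S q.1 q.2].
  rewrite (_ : [set q | _] = ~` [set q | 0 <= q.1] `|` [set q | S q.1 q.2]).
    apply: measurableU => //; apply: measurableC.
    exact: (@measurable_leset _ T3 R (cst 0) fst).
  apply/seteqP; split => q /=; last by case.
  move=> H; have [h|h] := pselect (0 <= q.1); [right; exact: H|by left].
apply: (@ae_prod_split2 _ _ T1 T2 R mu plane (fun q => 0 <= q.1 -> S q.1 q.2)).
apply: (@ae_prod_join _ _ T1 T2 R mu plane _ mS').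
apply: aeW => t; have [t0|t0] := pselect (0 <= t); last by apply: aeW.
by apply: (ae_mp (aeS t t0)).
Qed.

Lemma prim_FTC (F f : R -> R) T : 0 <= T ->
  (forall t : R, is_derive t 1 F (f t)) -> continuous f -> prim f T = F T - F 0.
Proof.
move=> T0 dF cf.
have cF (t : R) : {for t, continuous F}.
  by apply: differentiable_continuous; apply/derivable1_diffP; have [] := dF t.
move: T0; rewrite le_eqVlt => /orP[/eqP <-|T0].
  by rewrite subrr /prim set_itv1 Rintegral_set1.
rewrite /prim /Rintegral (continuous_FTC2 T0 (F := F)).
- by rewrite -EFinB.
- exact: continuous_subspaceT.
- split=> [t _||].
  + by have [] := dF t.
  + exact: (cvg_at_right_filter (cF 0)).
  + exact: (cvg_at_left_filter (cF T)).
- by move=> t _; rewrite derive1E; have [_ ->] := dF t.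
Qed.

Lemma is_derive_expRM (a t : R) : is_derive t 1 (fun t => expR (a * t)) (a * expR (a * t)).
Proof.
have dl : is_derive t (1 : R) (fun t : R => a * t) a.
  by apply: is_derive_eq; rewrite /GRing.scale/=; ring.
have := @is_derive1_comp R expR (fun t => a * t) t _ _ (is_derive_expR _) dl.
by move/is_derive_eq; apply; rewrite mulrC.
Qed.

Lemma prim_expR (a t : R) : 0 <= t -> prim (fun s => a * expR (a * s)) t = expR (a * t) - 1.
Proof.
have ce : continuous (fun s : R => expR (a * s)).
  move=> s; apply: differentiable_continuous; apply/derivable1_diffP.
  by have [] := is_derive_expRM a s.
have ca : continuous (fun s : R => a * expR (a * s)).
  move=> s; have := @cvgM R R (nbhs s) _ (fun=> a) (fun s => expR (a * s)) a (expR (a * s)) (cvg_cst _).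
  by apply; exact: ce.
move=> t0.
rewrite (@prim_FTC (fun s => expR (a * s)) (fun s => a * expR (a * s)) t t0 (is_derive_expRM a) ca).
by rewrite mulr0 expR0.
Qed.

Lemma prim_ae (a b : R -> R) T : measurable_fun setT a -> measurable_fun setT b ->
  {ae mu, forall t, 0 <= t <= T -> a t = b t} -> prim a T = prim b T.
Proof.
move=> ma mb ab; congr fine; apply: (@ae_eq_integral _ T1 R mu `[0, T]%classic) => //.
- exact/measurable_EFinP/measurable_funTS.
- exact/measurable_EFinP/measurable_funTS.
- by apply: (ae_mp ab) => t abt; rewrite /= in_itv/= => tT; rewrite abt.
Qed.

Lemma prim_int (a : R -> R) T C : measurable_fun setT a ->
  (forall s, 0 <= s <= T -> `|a s| <= C) ->
  mu.-integrable `[0, T]%classic (EFin \o a).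
Proof.
move=> ma aC; apply: (@measurable_bounded_integrable _ T1 R mu) => //.
- exact: mu_itv_lty.
- exact: measurable_funTS.
- exists C; split; first exact: num_real.
  by move=> K CK s; rewrite /= in_itv/= => /aC/le_trans; apply; exact: ltW.
Qed.

Lemma prim_le (a b : R -> R) T C : measurable_fun setT a -> measurable_fun setT b ->
  (forall s, 0 <= s <= T -> `|a s| <= C) -> (forall s, 0 <= s <= T -> `|b s| <= C) ->
  {ae mu, forall t, 0 <= t <= T -> a t <= b t} -> prim a T <= prim b T.
Proof.
move=> ma mb aC bC ab.
have -> : prim b T = prim (fun t => Num.max (a t) (b t)) T.
  apply: prim_ae => //; first exact: measurable_maxr.
  by apply: (ae_mp ab) => t abt t0; apply/esym/max_idPr; exact: abt.
apply: le_Rintegral => //.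
- exact: (prim_int ma aC).
- apply: (@prim_int _ _ C) => [|s sT]; first exact: measurable_maxr.
  by rewrite /Num.max; case: ifP => _; [exact: bC|exact: aC].
- by move=> s _; rewrite le_max lexx.
Qed.

Lemma primZ k (a : R -> R) T C : measurable_fun setT a ->
  (forall s, 0 <= s <= T -> `|a s| <= C) ->
  prim (fun s => k * a s) T = k * prim a T.
Proof. by move=> ma aC; rewrite /prim RintegralZl//; exact: (prim_int ma aC). Qed.

Lemma primB (a b : R -> R) T C : measurable_fun setT a -> measurable_fun setT b ->
  (forall s, 0 <= s <= T -> `|a s| <= C) -> (forall s, 0 <= s <= T -> `|b s| <= C) ->
  prim (fun s => a s - b s) T = prim a T - prim b T.
Proof.
move=> ma mb aC bC; rewrite /prim RintegralB//.
  exact: (prim_int ma aC).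
exact: (prim_int mb bC).
Qed.
End exchange.

Section representative.
Context {R : realType}.
Notation mu := (@lebesgue_measure R).
Notation mu2 := (mu \x mu)%E.
Let T1 := measurableTypeR R.
Let T2 := (T1 * T1)%type.
Let T3 := (T1 * T2)%type.
Variables (m : R -> R) (Mx L r c : R).
Hypothesis pm : profile m Mx L.
Hypothesis r0 : 0 < r.

Definition along (F : R * (R * R) -> R) (p : R * R) (t : R) : R := F (t, char c t p).

Lemma measurable_along3 F : measurable_fun setT (F : T3 -> R) ->
  measurable_fun setT (fun q : T3 => along F q.2 q.1).
Proof. by move=> mF; exact: (measurableT_comp mF (measurable_char3 c)). Qed.

Lemma measurable_along F p : measurable_fun setT (F : T3 -> R) ->
  measurable_fun setT (along F p).
Proof.
by move=> mF; exact: (measurableT_comp (measurable_along3 mF) (pair2_measurable p)).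
Qed.

(** The right-hand side of Duhamel's formula: a Lipschitz representative of G
along the characteristic from p. *)
Definition rep (h0 : R * R -> R) (G : R * (R * R) -> R) (p : R * R) (t : R) : R :=
  h0 p + prim (along (Rg m r G) p) t.

Lemma measurable_rep3 h0 G : measurable_fun setT (h0 : T2 -> R) -> field m G ->
  measurable_fun setT (fun q : T3 => rep h0 G q.2 q.1).
Proof.
move=> mh fG; apply: measurable_funD; first exact: (measurableT_comp mh (@measurable_snd _ _ T1 T2)).
pose k (w : R * (R * (R * R))) : R := along (Rg m r G) w.2.2 w.1 *
  (\1_[set w : T1 * T3 | 0 <= w.1] w * \1_[set w : T1 * T3 | w.1 <= w.2.1] w).
have mk : measurable_fun setT (k : T1 * T3 -> R).
  apply: measurable_funM.
    have m12 : measurable_fun setT (fun w : T1 * T3 => (w.1, w.2.2) : T3).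
      apply: measurable_fun_pair => //.
      exact: (measurableT_comp (@measurable_snd _ _ T1 T2) (@measurable_snd _ _ T1 T3)).
    exact: (measurableT_comp (measurable_along3 (measurable_Rg pm r fG)) m12).
  apply: measurable_funM; apply: measurable_indic; apply: measurable_leset => //.
  exact: (measurableT_comp (@measurable_fst _ _ T1 T2) (@measurable_snd _ _ T1 T3)).
rewrite (_ : (fun q => _) = fun q : T3 => \int[mu]_s k (s, q)).
  exact: measurable_Rint1.
apply/funext => q; rewrite /prim Rint_indic; apply: eq_Rintegral => s _.
rewrite /k/=; congr (_ * _); rewrite !indicE -natrM mulnb; congr ((nat_of_bool _)%:R).
apply/idP/idP.
  by rewrite inE/= in_itv/= => /andP[h1 h2]; apply/andP; split; apply/mem_set.
by move=> /andP[]; rewrite !inE/= in_itv/= => -> ->.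
Qed.

Lemma rep_ae h0 G : measurable_fun setT (h0 : T2 -> R) -> field m G ->
  mild m r c h0 G ->
  {ae mu2, forall p, {ae mu, forall t, 0 <= t -> along G p t = rep h0 G p t}}.
Proof.
move=> mh fG mG; apply: ae_exchange; last by move=> t t0; exact: mG.
apply: (@measurable_eqset _ T3); last exact: measurable_rep3.
exact: measurable_along3 fG.1.
Qed.

Lemma along_Rg_bound G p t : field m G -> `|along (Rg m r G) p t| <= (1 + r) * Mx.
Proof.
move=> fG; rewrite (le_trans (Rg_bound pm _ (ltW r0) fG))// ler_wpM2l ?(pf_Mx pm)//.
by rewrite addr_ge0// ltW.
Qed.

Lemma measurable_prim (a : R -> R) : measurable_fun setT a -> measurable_fun setT (prim a).
Proof.
move=> ma.
pose k (w : R * R) : R := a w.1 *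
  (\1_[set w : T1 * T1 | 0 <= w.1] w * \1_[set w : T1 * T1 | w.1 <= w.2] w).
have mk : measurable_fun setT (k : T1 * T1 -> R).
  apply: measurable_funM; first exact: (measurableT_comp ma (@measurable_fst _ _ T1 T1)).
  by apply: measurable_funM; apply: measurable_indic; apply: measurable_leset.
rewrite (_ : prim a = fun t : T1 => \int[mu]_s k (s, t)).
  exact: measurable_Rint1.
apply/funext => q; rewrite /prim Rint_indic; apply: eq_Rintegral => s _.
rewrite /k/=; congr (_ * _); rewrite !indicE -natrM mulnb; congr ((nat_of_bool _)%:R).
apply/idP/idP.
  by rewrite inE/= in_itv/= => /andP[h1 h2]; apply/andP; split; apply/mem_set.
by move=> /andP[]; rewrite !inE/= in_itv/= => -> ->.
Qed.


Lemma prim_bound (a : R -> R) C t : measurable_fun setT a ->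
  (forall s, 0 <= s <= t -> `|a s| <= C) -> 0 <= t -> `|prim a t| <= C * t.
Proof.
move=> ma aC t0; rewrite /prim Rint_indic.
have tE : fine (mu `[0, t]%classic) = t.
  rewrite lebesgue_measure_itv/= lte_fin; move: t0; rewrite le_eqVlt => /orP[/eqP<-|t0].
    by rewrite ltxx.
  by rewrite t0/= subr0.
rewrite -[X in C * X]tE.
apply: (@normr_Rint_le _ _ T1 mu (fun s => a s * \1_(`[0, t]%classic) s) `[0, t]%classic C) => //.
- exact: measurable_funM.
- exact: mu_itv_lty.
- move=> s; rewrite indicE; case: (boolP (s \in _)) => h; last by rewrite !mulr0 normr0.
  by rewrite !mulr1; apply: aC; move: h; rewrite inE/= in_itv.
Qed.

End representative.

(** * Comparison with a multiple of the wave *)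

Lemma le_Rint_ae d (T : measurableType d) (R : realType) (m : {measure set T -> \bar R})
    (a b : T -> R) :
  m.-integrable setT (EFin \o a) -> m.-integrable setT (EFin \o b) ->
  {ae m, forall t, a t <= b t} -> \int[m]_t a t <= \int[m]_t b t.
Proof.
move=> ia ib ab; have /integrableP[/measurable_EFinP ma _] := ia.
have /integrableP[/measurable_EFinP mb _] := ib.
have mM : measurable_fun setT (fun t => Num.max (a t) (b t)) by exact: measurable_maxr.
have iM : m.-integrable setT (fun t => (Num.max (a t) (b t))%:E).
  apply: (@le_integrable _ T R m setT measurableT _ (fun t => (`|a t| + `|b t|)%:E)).
  - exact/measurable_EFinP.
  - move=> t _; rewrite /= lee_fin [leRHS]ger0_norm ?addr_ge0// /Num.max.
    by case: ifP => _; rewrite ?lerDr ?lerDl.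
  - exact: (integrableD measurableT (integrable_norm ia) (integrable_norm ib)).
have -> : \int[m]_t b t = \int[m]_t Num.max (a t) (b t).
  congr fine; apply: ae_eq_integral => //; try exact/measurable_EFinP.
  by apply: (ae_mp ab) => t abt _; congr EFin; apply/esym/max_idPr.
by apply: le_Rintegral => // t _; rewrite le_max lexx.
Qed.

Section comparison.
Context {R : realType}.
Notation mu := (@lebesgue_measure R).
Notation mu2 := (mu \x mu)%E.
Let T1 := measurableTypeR R.
Let T2 := (T1 * T1)%type.
Let T3 := (T1 * T2)%type.
Variables (m : R -> R) (Mx L r c gamma : R).
Hypothesis pm : profile m Mx L.
Hypothesis r0 : 0 < r.
Hypothesis g01 : 0 <= gamma <= 1.
Variables (h0 F0 : R * R -> R) (G F : R * (R * R) -> R).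
Hypothesis mh0 : measurable_fun setT (h0 : T2 -> R).
Hypothesis mF0 : measurable_fun setT (F0 : T2 -> R).
Hypothesis fG : field m G.
Hypothesis fF : field m F.
Hypothesis mG : mild m r c h0 G.
Hypothesis mF : mild m r c F0 F.
Hypothesis h0F0 : forall p, gamma * F0 p <= h0 p.

Let P q := G q - gamma * F q.
Let rP (q : R * (R * R)) := rhoG G q.1 q.2.1 - gamma * rhoG F q.1 q.2.1.
Let K := 3 * (1 + r).

Let mP : measurable_fun setT (P : T3 -> R).
Proof.
apply: measurable_funB; first exact: fG.1.
by apply: measurable_funM => //; exact: fF.1.
Qed.

Let mrho (H : R * (R * R) -> R) : field m H ->
  measurable_fun setT (fun q : T3 => rhoG H q.1 q.2.1).
Proof.
move=> fH.
have mp : measurable_fun setT (fun q : T3 => (q.1, q.2.1) : T1 * T1).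
  apply: measurable_fun_pair => //.
  exact: (measurableT_comp (@measurable_fst _ _ T1 T1) (@measurable_snd _ _ T1 T2)).
exact: (measurableT_comp (measurable_rhoG fH.1) mp).
Qed.

Let mrP : measurable_fun setT (rP : T3 -> R).
Proof. by apply: measurable_funB; [exact: mrho|apply: measurable_funM => //; exact: mrho]. Qed.

Let slice_int (H : R * (R * R) -> R) t z : field m H ->
  mu.-integrable setT (EFin \o (fun v => H (t, (z, v)))).
Proof.
move=> fH; apply: (pf_bdd pm); first exact: measurable_slice fH.1.
by move=> v; have /andP[h1 h2] := fH.2 (t, (z, v)); rewrite ger0_norm.
Qed.

(** A lower bound of G - gamma F by a multiple of the profile passes to the
densities because the profile has mass 1. *)
Let rP_lower k t : {ae mu2, forall p, - k * m p.2 <= P (t, p)} ->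
  {ae mu2, forall p, - k <= rP (t, p)}.
Proof.
move=> /(@ae_prod_split _ _ T1 T1 R mu mu) H.
apply: (@ae_prod_fst _ _ T1 T1 R mu mu (fun z => - k <= rhoG G t z - gamma * rhoG F t z)).
apply: (ae_mp H) => z Hz.
have iG := slice_int t z fG; have iF := slice_int t z fF.
have igF := @integrableZl _ T1 R mu setT measurableT gamma _ iF.
have iP : mu.-integrable setT (EFin \o (fun v => P (t, (z, v)))).
  exact: (integrableB measurableT iG igF).
have -> : rhoG G t z - gamma * rhoG F t z = \int[mu]_v P (t, (z, v)).
  by rewrite /rhoG /P -RintegralZl// RintegralB.
have -> : - k = \int[mu]_v (- k * m v).
  by rewrite RintegralZl ?(pf_mass pm) ?mulr1//; exact: pf_int pm.
apply: le_Rint_ae => //.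
exact: (@integrableZl _ T1 R mu setT measurableT (- k) _ (pf_int pm)).
Qed.

(** In the equation of G - gamma F the difference of the densities carries the
coefficient (1 + r) m - r gamma F >= 0 and the remainder r gamma (1 - gamma) F rho_F
is nonnegative: gamma F is a subsolution. *)
Let dissip (q : R * (R * R)) k : 0 <= k -> - k * m q.2.2 <= P q -> - k <= rP q ->
  - (2 * (1 + r) * k * m q.2.2) <= Rg m r G q - gamma * Rg m r F q + (1 + r) * P q.
Proof.
case: q => t [z v] /= k0; rewrite /P /rP /Rg /reac/= -/(rhoG G t z) -/(rhoG F t z).
have /andP[g0 g1] := rhoG_bound pm t z fG; have /andP[f0 f1] := rhoG_bound pm t z fF.
have /andP[G0 G1] := fG.2 (t, (z, v)); have /andP[F0' F1] := fF.2 (t, (z, v)).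
move: (rhoG G t z) (rhoG F t z) (G (t, (z, v))) (F (t, (z, v))) g0 g1 f0 f1 G0 G1 F0' F1 => /=.
move: (m v) (pf_ge0 pm v) g01 => mv mv0 /andP[ga0 ga1].
move=> rg rf g f rg0 rg1 rf0 rf1 gg0 gg1 ff0 ff1 hP hr.
have -> : mv * rg - g + r * rg * (mv - g) - gamma * (mv * rf - f + r * rf * (mv - f)) + (1 + r) * (g - gamma * f)
  = ((1 + r) * mv - r * gamma * f) * (rg - gamma * rf) + r * (1 - rg) * (g - gamma * f)
    + r * gamma * (1 - gamma) * f * rf by ring.
have A0 : 0 <= (1 + r) * mv - r * gamma * f.
  have : gamma * f <= mv by rewrite (le_trans _ ff1)// ler_piMl.
  by have := r0; nra.
have h1 : - ((1 + r) * mv * k) <= ((1 + r) * mv - r * gamma * f) * (rg - gamma * rf).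
  apply: (@le_trans _ _ (((1 + r) * mv - r * gamma * f) * (- k))); last exact: ler_wpM2l.
  rewrite mulrN lerN2 ler_wpM2r// gerBl !mulr_ge0//; exact: ltW.
have h2 : - (r * k * mv) <= r * (1 - rg) * (g - gamma * f).
  apply: (@le_trans _ _ (r * (1 - rg) * (- k * mv))); last first.
    by apply: ler_wpM2l => //; rewrite mulr_ge0 ?(ltW r0)// subr_ge0.
  rewrite mulNr mulrN lerN2 !mulrA; apply: ler_wpM2r => //; apply: ler_wpM2r => //.
  by rewrite ler_piMr ?(ltW r0)// gerBl.
have h3 : 0 <= r * gamma * (1 - gamma) * f * rf.
  by rewrite !mulr_ge0 ?(ltW r0)// subr_ge0.
have h4 : 0 <= k * mv by rewrite mulr_ge0.
have := r0; nra.
Qed.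

(** In the equation of e^{(1 + r) t} (G - gamma F) every negative contribution
is at most 2 (1 + r) k e^{4 (1 + r) t} m, since K + (1 + r) = 4 (1 + r).
Integrating in time yields the factor 1 / 2. *)
Let step_comparison k : 0 <= k ->
  (forall t, 0 <= t -> {ae mu2, forall p, - (k * expR (K * t)) * m p.2 <= P (t, p)}) ->
  forall t, 0 <= t -> {ae mu2, forall p, - (k / 2 * expR (K * t)) * m p.2 <= P (t, p)}.
Proof.
move=> k0 Hk T T0.
pose S t p := (- (k * expR (K * t)) * m p.2 <= along c P p t) /\
              (- (k * expR (K * t)) <= along c rP p t).
have mexp (a : R) : measurable_fun setT (fun s : R => expR (a * s)).
  by apply: measurableT_comp => //; exact: measurable_funM.
have aeS : {ae mu2, forall p, {ae mu, forall t, 0 <= t -> S t p}}.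
  apply: ae_exchange.
    have mE : measurable_fun setT (fun q : T3 => - (k * expR (K * q.1))).
      apply: measurableT_comp => //; apply: measurable_funM => //.
      exact: (measurableT_comp (mexp K) (@measurable_fst _ _ T1 T2)).
    apply: measurableI.
      apply: (@measurable_leset _ T3); last exact: measurable_along3.
      apply: measurable_funM => //; apply: (measurableT_comp (pf_meas pm)).
      exact: (measurableT_comp (@measurable_snd _ _ T1 T1) (@measurable_snd _ _ T1 T2)).
    apply: (@measurable_leset _ T3) => //; exact: measurable_along3.
  move=> t t0.
  have mc : measurable_fun setT (fun v : R => (v - c) * t).
    by apply: measurable_funM => //; exact: measurable_funB.
  have H1 := ae_shear mc (Hk t t0).
  have H2 := ae_shear mc (rP_lower (Hk t t0)).
  by apply: (ae_mp2 H1 H2) => p; split.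
have main : {ae mu2, forall p, - (k / 2 * expR (K * T)) * m p.2 <= P (T, char c T p)}.
  have aeG := rep_ae pm mh0 fG mG; have aeF := rep_ae pm mF0 fF mF.
  have aeGT := mG T0; have aeFT := mF T0.
  have aeA := ae_mp2 aeG aeF (fun p a b => conj a b).
  have aeB := ae_mp2 aeGT aeFT (fun p a b => conj a b).
  have aeAB := ae_mp2 aeA aeB (fun p a b => conj a b).
  apply: (ae_mp2 aeAB aeS) => p [[aG aF] [GT FT]] aS.
  rewrite /P GT FT -/(along c (Rg m r G) p) -/(along c (Rg m r F) p).
  set D := 1 + r; have D0 : 0 <= D by rewrite /D addr_ge0// ltW.
  pose sg s := along c (Rg m r G) p s - gamma * along c (Rg m r F) p s.
  have mRG := measurable_along c p (measurable_Rg pm r fG).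
  have mRF := measurable_along c p (measurable_Rg pm r fF).
  have msg : measurable_fun setT sg by apply: measurable_funB => //; exact: measurable_funM.
  pose C := (1 + r) * Mx.
  have C0 : 0 <= C := le_trans (normr_ge0 _) (along_Rg_bound c pm r0 p 0 fG).
  have sgC s : `|sg s| <= C + C.
    rewrite (le_trans (ler_normB _ _))// lerD//; first exact: (along_Rg_bound c pm r0 p s fG).
    have /andP[ga0 ga1] := g01.
    rewrite normrM (ger0_norm ga0) (le_trans _ (along_Rg_bound c pm r0 p s fF))//.
    by rewrite ler_piMl.
  pose P0 := h0 p - gamma * F0 p.
  have P00 : 0 <= P0 by rewrite subr_ge0.
  have ppE t : rep m r c h0 G p t - gamma * rep m r c F0 F p t = P0 + prim sg t.
    rewrite /rep /P0 /sg (primB (C := C)) ?(primZ _ (C := C))//.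
    - by rewrite mulrDr; ring.
    - by move=> s _; exact: (along_Rg_bound c pm r0 p s fF).
    - exact: measurable_funM.
    - by move=> s _; exact: (along_Rg_bound c pm r0 p s fG).
    - move=> s _; have /andP[ga0 ga1] := g01.
      rewrite normrM (ger0_norm ga0) (le_trans _ (along_Rg_bound c pm r0 p s fF))//.
      by rewrite ler_piMl.
  rewrite -/(rep m r c h0 G p T) -/(rep m r c F0 F p T) ppE.
  pose B := C + C + D * expR (D * T).
  have sgB s : 0 <= s <= T -> `|sg s| <= B.
    by move=> _; rewrite (le_trans (sgC s))// lerDl mulr_ge0// expR_ge0.
  have eB s : 0 <= s <= T -> `|D * expR (D * s)| <= B.
    move=> /andP[s0 sT]; rewrite ger0_norm ?mulr_ge0 ?expR_ge0//.
    rewrite (@le_trans _ _ (D * expR (D * T)))//; last by rewrite lerDr addr_ge0.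
    by apply: ler_wpM2l => //; rewrite ler_expR ler_wpM2l.
  have mDe : measurable_fun setT (fun s : R => D * expR (D * s)) by exact: measurable_funM.
  have eprod : (P0 + prim sg T) * expR (D * T) =
      P0 + prim (fun s => expR (D * s) * (sg s + D * (P0 + prim sg s))) T.
    have -> : expR (D * T) = 1 + prim (fun s => D * expR (D * s)) T by rewrite prim_expR// addrC subrK.
    rewrite (primM P0 1 msg mDe sgB eB) mulr1; congr (_ + _).
    apply: eq_Rintegral => s; rewrite inE/= in_itv/= => /andP[s0 _].
    by rewrite prim_expR//; ring.
  have mpp : measurable_fun setT (fun s => P0 + prim sg s).
    by apply: measurable_funD => //; exact: measurable_prim.
  have le : P0 - prim (fun s => k / 2 * m p.2 * (4 * (1 + r) * expR (4 * (1 + r) * s))) T <=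
     (P0 + prim sg T) * expR (D * T).
    rewrite eprod lerD2l -mulN1r.
    pose B2 := `|k / 2 * m p.2 * (4 * (1 + r) * expR (4 * (1 + r) * T))| +
      expR (D * T) * (C + C + D * (`|P0| + (C + C) * T)).
    have X0 s : 0 <= k / 2 * m p.2 * (4 * (1 + r) * expR (4 * (1 + r) * s)).
      by rewrite !mulr_ge0 ?expR_ge0// ?(pf_ge0 pm)// divr_ge0.
    have XB s : 0 <= s <= T -> `|k / 2 * m p.2 * (4 * (1 + r) * expR (4 * (1 + r) * s))| <= B2.
      move=> /andP[s0 sT]; rewrite (@le_trans _ _ `|k / 2 * m p.2 * (4 * (1 + r) * expR (4 * (1 + r) * T))|)//.
        rewrite !ger0_norm//; apply: ler_wpM2l; first by rewrite mulr_ge0 ?(pf_ge0 pm)// divr_ge0.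
        by apply: ler_wpM2l; [rewrite mulr_ge0|rewrite ler_expR ler_wpM2l// mulr_ge0].
      by rewrite lerDl mulr_ge0 ?expR_ge0// !addr_ge0// mulr_ge0// addr_ge0// mulr_ge0// addr_ge0.
    have mX : measurable_fun setT (fun s : R => k / 2 * m p.2 * (4 * (1 + r) * expR (4 * (1 + r) * s))).
      by apply: measurable_funM => //; exact: measurable_funM.
    rewrite -(primZ (-1) mX XB); apply: (@prim_le _ _ _ _ B2).
    - exact: measurable_funM.
    - apply: measurable_funM => //; apply: measurable_funD => //; exact: measurable_funM.
    - by move=> s sT; rewrite mulN1r normrN XB.
    - move=> s /andP[s0 sT]; rewrite normrM (ger0_norm (expR_ge0 _)).
      rewrite (@le_trans _ _ (expR (D * T) * (C + C + D * (`|P0| + (C + C) * T))))//; last by rewrite lerDr.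
      apply: ler_pM; [exact: expR_ge0|exact: normr_ge0| |].
        by rewrite ler_expR ler_wpM2l.
      rewrite (le_trans (ler_normD _ _))// lerD// normrM ger0_norm//.
      apply: ler_wpM2l => //; rewrite (le_trans (ler_normD _ _))// lerD//.
      apply: (le_trans (prim_bound msg (fun u _ => sgC u) s0)).
      by apply: ler_wpM2l => //; rewrite addr_ge0.
    - apply: (ae_mp2 (ae_mp2 aG aF (fun t a b => conj a b)) aS) => s [ags afs] Ss /andP[s0 _].
      have [h1 h2] := Ss s0.
      have ppP : P0 + prim sg s = P (s, char c s p).
        by rewrite -ppE -(ags s0) -(afs s0).
      have e0 : 0 <= k * expR (K * s) by rewrite mulr_ge0 ?expR_ge0.
      have := @dissip (s, char c s p) _ e0 h1 h2 => /= h3.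
      rewrite ppP mulN1r.
      have -> : - (k / 2 * m p.2 * (4 * (1 + r) * expR (4 * (1 + r) * s))) =
         expR (D * s) * - (2 * (1 + r) * (k * expR (K * s)) * m p.2).
        have -> : 4 * (1 + r) * s = D * s + K * s by rewrite /D /K; ring.
        by rewrite expRD; field.
      apply: ler_wpM2l; [exact: expR_ge0|exact: h3].
  have r4 : 0 <= 4 * (1 + r) by rewrite mulr_ge0.
  have eE : prim (fun s => k / 2 * m p.2 * (4 * (1 + r) * expR (4 * (1 + r) * s))) T =
      k / 2 * m p.2 * (expR (4 * (1 + r) * T) - 1).
    rewrite (primZ _ (C := 4 * (1 + r) * expR (4 * (1 + r) * T))) ?prim_expR//.
      exact: measurable_funM.
    move=> s /andP[s0 sT]; rewrite ger0_norm ?mulr_ge0 ?expR_ge0//.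
    by apply: ler_wpM2l => //; rewrite ler_expR ler_wpM2l.
  move: le; rewrite eE.
  have -> : 4 * (1 + r) * T = K * T + D * T by rewrite /D /K; ring.
  rewrite expRD => le.
  rewrite -(ler_pM2r (expR_gt0 (D * T))); apply: le_trans le.
  have km : 0 <= k / 2 * m p.2 by rewrite mulr_ge0 ?(pf_ge0 pm)// divr_ge0.
  lra.
pose mc := (fun v : R => - ((v - c) * T)).
have mmc : measurable_fun setT mc.
  by apply: measurableT_comp => //; apply: measurable_funM => //; exact: measurable_funB.
apply: (ae_mp (ae_shear mmc main)) => p.
by rewrite /shear /char/= subrK; case: p.
Qed.

(** The negative part of G - gamma F is halved indefinitely by
step_comparison, starting from the trivial bound given by 0 <= F, G <= m. *)
Lemma comparison t : 0 <= t -> {ae mu2, forall p, gamma * rhoG F t p.1 <= rhoG G t p.1}.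
Proof.
move=> t0.
have H n : forall t, 0 <= t -> {ae mu2, forall p, - (2^-1 ^+ n * expR (K * t)) * m p.2 <= P (t, p)}.
  elim: n => [|n IH].
    move=> s s0; apply: aeW => p; rewrite expr0 mul1r.
    have /andP[G0 G1] := fG.2 (s, p); have /andP[F0' F1] := fF.2 (s, p).
    have /andP[ga0 ga1] := g01.
    have e1 : 1 <= expR (K * s).
      by rewrite -expR0 ler_expR mulr_ge0// /K mulr_ge0// addr_ge0// ltW.
    have := pf_ge0 pm p.2; rewrite /P/= in G0 G1 F0' F1 *; nra.
  move=> s s0; have := @step_comparison (2^-1 ^+ n) _ IH s s0.
  by rewrite exprSr; apply; rewrite exprn_ge0.
have Hr n := rP_lower (H n t t0).
apply: (ae_mp (ae_foralln Hr)) => p Hp.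
rewrite -subr_ge0 -[X in 0 <= X]/(rP (t, p)).
apply: contraT; rewrite -ltNge => x0.
pose n := Num.truncn (expR (K * t) / - rP (t, p)).
have := Hp n.+1; rewrite lerNl leNgt => /negP[].
rewrite exprVn [X in X < _]mulrC ltr_pdivrMr ?exprn_gt0//.
have x0' : 0 < - rP (t, p) by rewrite oppr_gt0.
rewrite [X in _ < X]mulrC -ltr_pdivrMr// (lt_le_trans (truncnS_gt _))//.
by rewrite -natrX ler_nat ltnW// ltn_expl.
Qed.
End comparison.

(** * Reciprocals of primitives *)

Section ode.
Context {R : realType}.
Notation mu := (@lebesgue_measure R).
Let T1 := measurableTypeR R.

Lemma prim_lip (a : R -> R) C s t : measurable_fun setT a ->
  (forall u, `|a u| <= C) -> 0 <= s <= t -> `|prim a t - prim a s| <= C * (t - s).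
Proof.
move=> ma aC /andP[s0 st].
have ib u : mu.-integrable setT (fun s => (a s * \1_(`[0, u]%classic) s)%:E).
  exact: (itv_integrable ma (fun u _ => aC u)).
have E : prim a t - prim a s = \int[mu]_u (a u * \1_(`]s, t]%classic) u).
  rewrite /prim (Rint_indic mu `[0, t]%classic) (Rint_indic mu `[0, s]%classic) -(RintegralB measurableT (ib t) (ib s)). apply: eq_Rintegral => u _.
  rewrite -mulrBr !indicE; congr (_ * _).
  have -> : (u \in `[0, t]%classic) = (u \in `[0, s]%classic) || (u \in `]s, t]%classic).
    apply/idP/idP.
      rewrite inE/= in_itv/= => /andP[u0 ut]; have [us|us] := leP u s.
        by apply/orP; left; apply/mem_set; rewrite /= in_itv/= u0.
      by apply/orP; right; apply/mem_set; rewrite /= in_itv/= us.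
    case/orP; rewrite !inE/= !in_itv/= => /andP[h1 h2].
      by rewrite h1 (le_trans h2).
    by rewrite h2 (le_trans s0 (ltW h1)).
  case: (boolP (u \in `[0, s]%classic)) => h1; case: (boolP (u \in `]s, t]%classic)) => h2;
    rewrite ?subrr ?subr0//=.
  move: h1 h2; rewrite !inE/= !in_itv/= => /andP[_ h1] /andP[h2 _].
  by have := lt_le_trans h2 h1; rewrite ltxx.
have tsE : fine (mu `]s, t]%classic) = t - s.
  rewrite lebesgue_measure_itv/= lte_fin; move: st; rewrite le_eqVlt => /orP[/eqP<-|st].
    by rewrite ltxx subrr.
  by rewrite st/=.
have fin : (mu `]s, t]%classic < +oo)%E.
  by rewrite lebesgue_measure_itv/=; case: ifP => _; rewrite ?ltry.
rewrite E -tsE.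
apply: (@normr_Rint_le _ _ T1 mu (fun u => a u * \1_(`]s, t]%classic) u) `]s, t]%classic C) => //; first exact: measurable_funM.
by move=> u; rewrite normrM ler_pM// ger0_norm.
Qed.

(** A negative value at t would persist on an interval to the right of t, by
the Lipschitz bound. *)
Lemma ae_ge_right (h : R -> R) C t : 0 <= C ->
  (forall s, t <= s -> `|h s - h t| <= C * (s - t)) ->
  {ae mu, forall s, t <= s -> 0 <= h s} -> 0 <= h t.
Proof.
move=> C0 hC [N [mN N0 hN]]; apply: contraT; rewrite -ltNge => ht.
pose e := - h t / (C + 1).
have C1 : 0 < C + 1 by lra.
have e0 : 0 < e by rewrite divr_gt0// oppr_gt0.
have sub : `]t, (t + e)[%classic `<=` N.
  move=> s; rewrite /= in_itv/= => /andP[ts se]; apply: hN => /= /(_ (ltW ts)) hs.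
  have := hC s (ltW ts); apply/negP; rewrite -ltNge (lt_le_trans _ (ler_norm _))//.
  have h1 : (C + 1) * (s - t) < - h t.
    by rewrite mulrC -ltr_pdivlMr// -/e; lra.
  have h2 : 0 <= s - t by lra.
  nra.
have : (mu `]t, (t + e)%R[%classic <= mu N)%E by apply: le_measure; rewrite ?inE.
by rewrite N0 lebesgue_measure_itv/= lte_fin ltrDl e0 -EFinB addrAC subrr add0r lee_fin leNgt e0.
Qed.

(** The equation Y' = - a' Y^2 of the reciprocal of a = a0 + prim al, in integral
form.  Here X is the reciprocal where it is known, almost everywhere; the
difference y = a Y - 1 satisfies y' = a' X y and y (0) = 0, hence vanishes by
Gronwall's argument. *)
Lemma reciprocal_prim (a0 Y0 : R) (al X : R -> R) C T : 0 <= T ->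
  measurable_fun setT al -> measurable_fun setT X ->
  (forall s, `|al s| <= C) -> (forall s, `|X s| <= C) ->
  {ae mu, forall s, 0 <= s -> X s * (a0 + prim al s) = 1} ->
  a0 * Y0 = 1 ->
  (a0 + prim al T) * (Y0 + prim (fun s => - al s * X s ^+ 2) T) = 1.
Proof.
move=> T0 mal mX alC XC aX aY0.
have C0 : 0 <= C := le_trans (normr_ge0 _) (alC 0).
pose b s := - al s * X s ^+ 2.
have mb : measurable_fun setT b.
  by apply: measurable_funM; [exact: measurableT_comp|exact: measurable_funX].
have bC s : `|b s| <= C * C ^+ 2.
  by rewrite normrM normrN normrX ler_pM// lerXn2r// nnegrE.
pose y t := (a0 + prim al t) * (Y0 + prim b t) - 1.
have my : measurable_fun setT y.
  apply: measurable_funB => //; apply: measurable_funM; apply: measurable_funD => //;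
    exact: measurable_prim.
have yE t : 0 <= t -> y t = prim (fun s => al s * X s * y s) t.
  move=> t0; pose D := C + C * C ^+ 2.
  rewrite /y (@primM _ al b D t)//.
  - rewrite aY0 addrC addKr; apply: prim_ae.
    + apply: measurable_funD; apply: measurable_funM => //; apply: measurable_funD => //;
        exact: measurable_prim.
    + by apply: measurable_funM => //; exact: measurable_funM.
    + apply: (ae_mp aX) => s Xs /andP[s0 _]; have {}Xs := Xs s0.
      rewrite /b /y; set a := a0 + _ in Xs *; set Y := Y0 + _.
      have -> : al s * X s * (a * Y - 1) = al s * (X s * a) * Y - al s * X s by ring.
      have -> : - al s * X s ^+ 2 * a = - al s * X s * (X s * a) by ring.
      by rewrite Xs; ring.
  - by move=> s _; rewrite (le_trans (alC s))// lerDl mulr_ge0// exprn_ge0.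
  - by move=> s _; rewrite (le_trans (bC s))// lerDr.
pose K := (`|a0| + C * T) * (`|Y0| + C * C ^+ 2 * T) + 1.
have yK t : 0 <= t <= T -> `|y t| <= K.
  move=> /andP[t0 tT]; rewrite (le_trans (ler_normB _ _))// normr1 lerD2r normrM.
  apply: ler_pM => //.
    rewrite (le_trans (ler_normD _ _))// lerD2l.
    rewrite (le_trans (prim_bound mal (fun s _ => alC s) t0))//.
    by apply: ler_wpM2l.
  rewrite (le_trans (ler_normD _ _))// lerD2l.
  rewrite (le_trans (prim_bound mb (fun s _ => bC s) t0))//.
  by apply: ler_wpM2l => //; rewrite mulr_ge0// exprn_ge0.
have K0 : 0 <= K by rewrite addr_ge0// mulr_ge0// addr_ge0// mulr_ge0// mulr_ge0// exprn_ge0.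
(* With this exponent one iteration of the integral equation halves the bound. *)
pose be := 2 * C ^+ 2.
have be0 : 0 <= be by rewrite mulr_ge0// exprn_ge0.
have H n t : 0 <= t <= T -> `|y t| <= 2^-1 ^+ n * K * expR (be * t).
  elim: n t => [|n IH] t tT.
    rewrite expr0 mul1r (le_trans (yK _ tT))// ler_peMr// -expR0 ler_expR mulr_ge0//.
    by case/andP: tT.
  have /andP[t0 tT'] := tT.
  pose Z s := al s * X s * y s.
  have mZ : measurable_fun setT Z by apply: measurable_funM => //; exact: measurable_funM.
  pose Q s := 2^-1 ^+ n.+1 * K * (be * expR (be * s)).
  have mQ : measurable_fun setT Q.
    apply: measurable_funM => //; apply: measurable_funM => //.
    by apply: measurableT_comp => //; exact: measurable_funM.
  have ZQ s : 0 <= s <= T -> `|Z s| <= Q s.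
    move=> sT; rewrite /Z 2!normrM.
    have -> : Q s = C * C * (2^-1 ^+ n * K * expR (be * s)).
      by rewrite /Q /be exprSr; field.
    apply: ler_pM; [exact: mulr_ge0|exact: normr_ge0| |exact: IH].
    by apply: ler_pM.
  have QB s : 0 <= s <= t -> `|Q s| <= Q T.
    move=> /andP[s0 st]; have h : 0 <= 2^-1 ^+ n.+1 * K by rewrite mulr_ge0// exprn_ge0.
    rewrite ger0_norm; last by rewrite mulr_ge0// mulr_ge0// expR_ge0.
    apply: ler_wpM2l => //; apply: ler_wpM2l => //; rewrite ler_expR.
    by apply: ler_wpM2l => //; exact: le_trans tT'.
  have ZB s : 0 <= s <= t -> `|Z s| <= Q T.
    move=> st; rewrite (le_trans (ZQ _ _))//.
      by case/andP: st => -> /le_trans; apply.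
    by rewrite (le_trans (ler_norm _))// QB.
  have pQ : prim Q t = 2^-1 ^+ n.+1 * K * (expR (be * t) - 1).
    rewrite (primZ _ (C := be * expR (be * T))) ?prim_expR//.
      by apply: measurable_funM => //; apply: measurableT_comp => //; exact: measurable_funM.
    move=> s /andP[s0 st]; rewrite ger0_norm ?mulr_ge0 ?expR_ge0//.
    by apply: ler_wpM2l => //; rewrite ler_expR; apply: ler_wpM2l => //; exact: le_trans tT'.
  have E2 : 2^-1 ^+ n.+1 * K * (expR (be * t) - 1) <= 2^-1 ^+ n.+1 * K * expR (be * t).
    by apply: ler_wpM2l; [rewrite mulr_ge0// exprn_ge0|rewrite gerBl].
  have cond s : 0 <= s <= t -> 0 <= s <= T by case/andP => -> /le_trans; apply.
  rewrite yE// ler_norml; apply/andP; split.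
    rewrite (@le_trans _ _ (- prim Q t))//; first by rewrite lerN2 pQ.
    rewrite -mulN1r -(primZ (-1) mQ QB); apply: (prim_le _ mZ _ ZB); first exact: measurable_funM.
      by move=> s st; rewrite mulN1r normrN QB.
    apply: aeW => s st; rewrite mulN1r lerNl (le_trans _ (ZQ _ (cond _ st)))//.
    by rewrite -normrN ler_norm.
  rewrite (@le_trans _ _ (prim Q t))//; last by rewrite pQ.
  apply: (prim_le mZ mQ ZB QB); apply: aeW => s st.
  by rewrite (le_trans _ (ZQ _ (cond _ st)))// ler_norm.
have y0 : y T = 0.
  apply/eqP; rewrite -normr_le0; apply: contraT; rewrite -ltNge => yT0.
  pose n := Num.truncn (K * expR (be * T) / `|y T|).
  have TT : 0 <= T <= T by rewrite T0 lexx.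
  have := H n.+1 T TT; rewrite leNgt => /negP[].
  rewrite exprVn -mulrA [X in X < _]mulrC ltr_pdivrMr ?exprn_gt0//.
  rewrite [X in _ < X]mulrC -ltr_pdivrMr// (lt_le_trans (truncnS_gt _))//.
  by rewrite -natrX ler_nat ltnW// ltn_expl.
by move/eqP: y0; rewrite subr_eq0 => /eqP.
Qed.
End ode.

(** * Local dissipation *)

Section lbdd.
Context {R : realType}.
Notation mu := (@lebesgue_measure R).
Implicit Types f g : R -> R.

(** The integrands of all primitives below: a class stable under products and
under prim itself, in which the rules of calculus need no side condition. *)
Definition lbdd f := measurable_fun setT f /\
  forall T, exists C, forall s, 0 <= s <= T -> `|f s| <= C.

Lemma lbdd_cst a : lbdd (fun=> a).
Proof. by split => // T; exists `|a|. Qed.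

Lemma lbddD f g : lbdd f -> lbdd g -> lbdd (fun s => f s + g s).
Proof.
move=> [mf bf] [mg bg]; split; first exact: measurable_funD.
move=> T; have [C fC] := bf T; have [D gD] := bg T; exists (C + D) => s sT.
by rewrite (le_trans (ler_normD _ _))// lerD ?fC ?gD.
Qed.

Lemma lbddM f g : lbdd f -> lbdd g -> lbdd (fun s => f s * g s).
Proof.
move=> [mf bf] [mg bg]; split; first exact: measurable_funM.
move=> T; have [C fC] := bf T; have [D gD] := bg T; exists (C * D) => s sT.
by rewrite normrM ler_pM ?fC ?gD.
Qed.

Lemma lbddN f : lbdd f -> lbdd (fun s => - f s).
Proof.
move=> [mf bf]; split; first exact: measurableT_comp.
by move=> T; have [C fC] := bf T; exists C => s sT; rewrite normrN fC.
Qed.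

Lemma lbddB f g : lbdd f -> lbdd g -> lbdd (fun s => f s - g s).
Proof. by move=> lf lg; apply: lbddD => //; exact: lbddN. Qed.

Lemma lbdd_bnd f C : measurable_fun setT f -> (forall s, `|f s| <= C) -> lbdd f.
Proof. by move=> mf fC; split => // T; exists C => s _. Qed.

Lemma lbdd_prim f : lbdd f -> lbdd (prim f).
Proof.
move=> [mf bf]; split; first exact: measurable_prim.
move=> T; have [C fC] := bf T; exists (`|C| * `|T|) => s /andP[s0 sT].
rewrite (le_trans (@prim_bound _ _ C s mf _ s0))//.
  by move=> u /andP[u0 us]; apply: fC; rewrite u0 (le_trans us).
rewrite (le_trans (ler_norm _))// normrM ler_wpM2l//.
by rewrite ger0_norm// (le_trans sT)// ler_norm.
Qed.

Lemma lbdd_expR a : lbdd (fun s => expR (a * s)).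
Proof.
split; first by apply: measurableT_comp => //; exact: measurable_funM.
move=> T; exists (expR (`|a| * `|T|)) => s /andP[s0 sT].
rewrite ger0_norm ?expR_ge0// ler_expR (le_trans (ler_norm _))// normrM ler_wpM2l//.
by rewrite ger0_norm// (le_trans sT)// ler_norm.
Qed.

Lemma lbdd2 f g T : lbdd f -> lbdd g ->
  exists C, (forall s, 0 <= s <= T -> `|f s| <= C) /\ (forall s, 0 <= s <= T -> `|g s| <= C).
Proof.
move=> [_ bf] [_ bg]; have [C fC] := bf T; have [D gD] := bg T.
exists (`|C| + `|D|); split => s sT.
  by rewrite (le_trans (fC _ sT))// (le_trans (ler_norm _))// lerDl.
by rewrite (le_trans (gD _ sT))// (le_trans (ler_norm _))// lerDr.
Qed.

Lemma primM_lb f g T F0 G0 : lbdd f -> lbdd g ->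
  (F0 + prim f T) * (G0 + prim g T) =
  F0 * G0 + prim (fun s => f s * (G0 + prim g s) + g s * (F0 + prim f s)) T.
Proof.
move=> lf lg; have [C [fC gC]] := lbdd2 T lf lg.
exact: primM lf.1 lg.1 fC gC.
Qed.

Lemma prim_le_lb f g T : lbdd f -> lbdd g ->
  {ae mu, forall t, 0 <= t <= T -> f t <= g t} -> prim f T <= prim g T.
Proof.
move=> lf lg; have [C [fC gC]] := lbdd2 T lf lg.
exact: prim_le lf.1 lg.1 fC gC.
Qed.

Lemma primD_lb f g T : lbdd f -> lbdd g ->
  prim (fun s => f s + g s) T = prim f T + prim g T.
Proof.
move=> lf lg; have [C [fC gC]] := lbdd2 T lf lg.
rewrite /prim RintegralD//; first exact: (prim_int lf.1 fC).
exact: (prim_int lg.1 gC).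
Qed.

Lemma primZ_lb k f T : lbdd f -> prim (fun s => k * f s) T = k * prim f T.
Proof. by move=> lf; have [C fC] := lf.2 T; exact: primZ lf.1 fC. Qed.

Lemma prim_EFin f (T : R) : lbdd f -> (\int[mu]_(t in `[0%R, T]%classic) (f t)%:E = (prim f T)%:E)%E.
Proof.
move=> lf; have [C fC] := lf.2 T; rewrite /prim fineK//.
apply: (@integrable_fin_num _ (measurableTypeR R) R mu) => //; exact: (prim_int lf.1 fC).
Qed.
End lbdd.

(** The left-hand side collects the derivative of B u^2 / A along a
characteristic, the damping and a reserve B u^2 / q.  The equations of g and f
reduce it to B (2 S u - (u^2 / A) (2 d + ...) + u^2 / q); Young's inequality
bounds 2 S u by S^2 q + u^2 / q, and the two terms u^2 / q are absorbed by
2 d u^2 / A because A <= (1 + r) m. *)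
Lemma dissipation (R : realType) (r m g phi rg rf B lc eta gamma : R) :
  let A := (1 + r) * m - r * phi in
  let u := g - phi in let S := rg - rf in
  let d := 1 + lc - eta / 2 in
  let q := (1 + r) * m / d in
  let reacG := (m * rg - g) + r * rg * (m - g) in
  let reacF := (m * rf - phi) + r * rf * (m - phi) in
  0 < r -> 0 < m -> 0 <= phi <= m -> 0 <= rf -> gamma * rf <= rg -> 0 <= B -> 0 < d ->
  - (2 * lc) * B * (A^-1 * u ^+ 2) +
  (- (- r * reacF) * A^-1 ^+ 2 * u ^+ 2 + 2 * (reacG - reacF) * u * A^-1) * B
  + ((eta + r * (2 * gamma - 1) * rf) * (B * A^-1) * u ^+ 2 + B * (u ^+ 2 * d / ((1 + r) * m)))
  <= B * S ^+ 2 * q.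
Proof.
move=> A u S d q reacG reacF r0 m0 /andP[p0 p1] rf0 rfg B0 d0.
have Am : m <= A by rewrite /A; nra.
have AM : A <= (1 + r) * m by rewrite /A; nra.
have A0 : 0 < A by lra.
have An : A != 0 by rewrite gt_eqF.
have rm0 : 0 < (1 + r) * m by rewrite mulr_gt0// addr_gt0.
have q0 : 0 < q by rewrite divr_gt0.
have eG : reacG - reacF = A * S - (1 + r * rg) * u by rewrite /reacG /reacF /A /S /u; ring.
have eF : reacF = rf * A - phi by rewrite /reacF /A; ring.
have -> : - (2 * lc) * B * (A^-1 * u ^+ 2) +
  (- (- r * reacF) * A^-1 ^+ 2 * u ^+ 2 + 2 * (reacG - reacF) * u * A^-1) * B
  + ((eta + r * (2 * gamma - 1) * rf) * (B * A^-1) * u ^+ 2 + B * (u ^+ 2 * d / ((1 + r) * m))) =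
  B * (2 * S * u - A^-1 * u ^+ 2 * (2 * d + 2 * r * (rg - gamma * rf) + r * phi * A^-1)
   + u ^+ 2 * d / ((1 + r) * m)).
  rewrite eG eF /d; field.
  by rewrite An gt_eqF// gt_eqF// addr_gt0.
rewrite -[X in _ <= X]mulrA; apply: ler_wpM2l => //.
have y1 : 2 * S * u <= S ^+ 2 * q + u ^+ 2 / q.
  have : 0 <= (S * q - u) ^+ 2 / q by rewrite divr_ge0 ?sqr_ge0// ltW.
  have -> : (S * q - u) ^+ 2 / q = S ^+ 2 * q - 2 * S * u + u ^+ 2 / q.
    by field; rewrite gt_eqF.
  lra.
have uq : u ^+ 2 / q = u ^+ 2 * d / ((1 + r) * m).
  by rewrite /q; field; rewrite !gt_eqF// addr_gt0.
have iA : ((1 + r) * m)^-1 <= A^-1 by rewrite lef_pV2.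
have y2 : u ^+ 2 * d / ((1 + r) * m) * 2 <= A^-1 * u ^+ 2 * (2 * d + 2 * r * (rg - gamma * rf) + r * phi * A^-1).
  apply: (@le_trans _ _ (A^-1 * u ^+ 2 * (2 * d))).
    have -> : u ^+ 2 * d / ((1 + r) * m) * 2 = ((1 + r) * m)^-1 * u ^+ 2 * (2 * d) by ring.
    apply: ler_wpM2r; first by rewrite mulr_ge0// ltW.
    by apply: ler_wpM2r => //; exact: sqr_ge0.
  apply: ler_wpM2l; first by rewrite mulr_ge0 ?sqr_ge0// invr_ge0 ltW.
  rewrite -addrA lerDl addr_ge0//.
    by rewrite mulr_ge0 ?subr_ge0// mulr_ge0// ltW.
  by rewrite mulr_ge0 ?invr_ge0 ?(ltW A0)// mulr_ge0// ltW.
lra.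
Qed.

(** A characteristic slower than the lateral boundary of the cone leaves it once
and for all. *)
Lemma cone (R : realType) (N Lam z b : R) : `|b| < Lam ->
  exists tau, forall s, 0 <= s -> (`|z + b * s| + Lam * s <= N) = (s <= tau).
Proof.
rewrite ltr_norml => /andP[b1 b2].
have p1 : 0 < Lam + b by lra.
have p2 : 0 < Lam - b by lra.
exists (Num.min ((N - z) / (Lam + b)) ((N + z) / (Lam - b))) => s s0.
rewrite le_min !ler_pdivlMr// -lerBrDr ler_norml.
by apply/andP/andP => -[h1 h2]; split; lra.
Qed.

(** * Energy balance along one characteristic *)

Section inverse.
Context d (T : measurableType d) (R : realType).
Lemma measurable_inv (f : T -> R) : measurable_fun setT f -> (forall x, 0 <= f x) ->
  measurable_fun setT (fun x => (f x)^-1).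
Proof.
move=> mf f0; rewrite (_ : (fun x => _) = (fun x => f x `^ (-1))).
  exact: (measurableT_comp (measurable_powR (-1)) mf).
by apply/funext => x; rewrite powR_inv1.
Qed.
End inverse.

Section energy_line.
Context {R : realType}.
Notation mu := (@lebesgue_measure R).
Variables (r mv gamma eta lam lc z0 h phi C : R) (g f rg rf RG RF : R -> R).
Hypothesis r0 : 0 < r.
Hypothesis mv0 : 0 < mv.
Hypothesis d0 : 0 < 1 + lc - eta / 2.
Hypothesis mg : measurable_fun setT g.
Hypothesis mf : measurable_fun setT f.
Hypothesis mrg : measurable_fun setT rg.
Hypothesis mrf : measurable_fun setT rf.
Hypothesis mRG : measurable_fun setT RG.
Hypothesis mRF : measurable_fun setT RF.
Hypothesis RGC : forall s, `|RG s| <= C.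
Hypothesis RFC : forall s, `|RF s| <= C.
Hypothesis gm : forall s, 0 <= g s <= mv.
Hypothesis fm : forall s, 0 <= f s <= mv.
Hypothesis pm : 0 <= phi <= mv.
Hypothesis rgm : forall s, 0 <= rg s <= 1.
Hypothesis rfm : forall s, 0 <= rf s <= 1.
Hypothesis RGE : forall s, RG s = (mv * rg s - g s) + r * rg s * (mv - g s).
Hypothesis RFE : forall s, RF s = (mv * rf s - f s) + r * rf s * (mv - f s).
Hypothesis gE : {ae mu, forall s, 0 <= s -> g s = h + prim RG s}.
Hypothesis fE : {ae mu, forall s, 0 <= s -> f s = phi + prim RF s}.
Hypothesis cmp : {ae mu, forall s, 0 <= s -> gamma * rf s <= rg s}.

(** The exponential weight along the characteristic, where z moves at speed
v - c and lc stands for lam * (c - v). *)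
Definition line_weight s := expR (2 * lam * z0 + - (2 * lc) * s).
Definition line_dissipation s :=
  (eta + r * (2 * gamma - 1) * rf s) * (line_weight s * ((1 + r) * mv - r * f s)^-1) * (g s - f s) ^+ 2 +
  line_weight s * ((g s - f s) ^+ 2 * (1 + lc - eta / 2) / ((1 + r) * mv)).
Definition line_source s := line_weight s * (rg s - rf s) ^+ 2 * ((1 + r) * mv / (1 + lc - eta / 2)).

Let A s := (1 + r) * mv - r * f s.
Let Xi s := (A s)^-1.
Let e s := expR (- (2 * lc) * s).

Let weightE s : line_weight s = expR (2 * lam * z0) * e s.
Proof. by rewrite /line_weight expRD. Qed.

Let Am s : mv <= A s.
Proof. by have /andP[? ?] := fm s; rewrite /A; have := r0; nra. Qed.

Let lg : lbdd g.
Proof. by apply: (@lbdd_bnd _ _ mv) => // s; have /andP[? ?] := gm s; rewrite ger0_norm. Qed.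
Let lf : lbdd f.
Proof. by apply: (@lbdd_bnd _ _ mv) => // s; have /andP[? ?] := fm s; rewrite ger0_norm. Qed.
Let lrg : lbdd rg.
Proof. by apply: (@lbdd_bnd _ _ 1) => // s; have /andP[? ?] := rgm s; rewrite ger0_norm. Qed.
Let lrf : lbdd rf.
Proof. by apply: (@lbdd_bnd _ _ 1) => // s; have /andP[? ?] := rfm s; rewrite ger0_norm. Qed.
Let lRG : lbdd RG. Proof. exact: lbdd_bnd RGC. Qed.
Let lRF : lbdd RF. Proof. exact: lbdd_bnd RFC. Qed.
Let mXi : measurable_fun setT Xi.
Proof.
apply: measurable_inv => [|s]; last by rewrite (le_trans (ltW mv0)).
by apply: measurable_funB => //; exact: measurable_funM.
Qed.

Let Xi_bound s : `|Xi s| <= mv^-1.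
Proof.
have A0 : 0 < A s by rewrite (lt_le_trans mv0).
by rewrite ger0_norm ?invr_ge0 ?(ltW A0)// lef_pV2.
Qed.

Let lXi : lbdd Xi. Proof. exact: lbdd_bnd Xi_bound. Qed.
Let le_ : lbdd e. Proof. exact: lbdd_expR. Qed.
Let lw : lbdd line_weight.
Proof.
rewrite (_ : line_weight = fun s => expR (2 * lam * z0) * e s); last by apply/funext => s; rewrite weightE.
by apply: lbddM => //; exact: lbdd_cst.
Qed.

Lemma lbdd_line_dissipation : lbdd line_dissipation.
Proof.
have lu : lbdd (fun s => (g s - f s) ^+ 2) by apply: lbddM; exact: lbddB.
apply: lbddD; apply: lbddM => //.
- apply: lbddM; last exact: lbddM.
  by apply: lbddD; [exact: lbdd_cst|apply: lbddM => //; exact: lbdd_cst].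
- by apply: lbddM; [apply: lbddM => //|]; exact: lbdd_cst.
Qed.

Lemma lbdd_line_source : lbdd line_source.
Proof.
have lu : lbdd (fun s => (rg s - rf s) ^+ 2) by apply: lbddM; exact: lbddB.
by apply: lbddM; [exact: lbddM|exact: lbdd_cst].
Qed.

Let al s := - r * RF s.
Let a0 := (1 + r) * mv - r * phi.
Let lal : lbdd al. Proof. by apply: lbddM => //; exact: lbdd_cst. Qed.
Let a00 : 0 < a0.
Proof. by have /andP[? ?] := pm; rewrite /a0; have := r0; have := mv0; nra. Qed.

(** Stands for 1 / A at every time, while Xi equals 1 / A computed from f, that is
for almost every time only. *)
Let Y s := a0^-1 + prim (fun s => - al s * Xi s ^+ 2) s.
Let U s := (h - phi) + prim (fun s => RG s - RF s) s.

Let aE T : a0 + prim al T = (1 + r) * mv - r * (phi + prim RF T).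
Proof. by rewrite /al /a0 (@primZ_lb _ (- r) RF)//; ring. Qed.

Let UE T : U T = (h + prim RG T) - (phi + prim RF T).
Proof.
have -> : prim RG T = prim (fun s => (RG s - RF s) + RF s) T.
  by congr prim; apply/funext => s; rewrite subrK.
by rewrite /U (@primD_lb _ (fun s => RG s - RF s) RF)//; [ring|exact: lbddB].
Qed.

Let XiE : {ae mu, forall s, 0 <= s -> Xi s * (a0 + prim al s) = 1}.
Proof.
apply: (ae_mp fE) => s fs s0; rewrite aE -fs// /Xi -/(A s) mulVf//.
by rewrite gt_eqF// (lt_le_trans mv0).
Qed.

Let YE T : 0 <= T -> (a0 + prim al T) * Y T = 1.
Proof.
move=> T0; apply: (@reciprocal_prim _ _ _ _ _ (`|r| * C + mv^-1)) => //.
- exact: lal.1.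
- move=> s; rewrite /al normrM normrN (le_trans (ler_wpM2l _ (RFC s)))//.
  by rewrite lerDl invr_ge0 ltW.
- move=> s; rewrite (le_trans (Xi_bound s))// lerDr mulr_ge0//.
  exact: le_trans (normr_ge0 _) (RGC 0).
- by rewrite mulfV// gt_eqF.
Qed.

(* The time derivative of e * Y * U^2. *)
Let k s := - (2 * lc) * e s * (Y s * U s ^+ 2) +
  (- al s * Xi s ^+ 2 * U s ^+ 2 + 2 * (RG s - RF s) * U s * Y s) * e s.

Let lY : lbdd Y.
Proof.
apply: lbddD; first exact: lbdd_cst.
by apply: lbdd_prim; apply: lbddM; [exact: lbddN|exact: lbddM].
Qed.
Let lU : lbdd U.
Proof. by apply: lbddD; [exact: lbdd_cst|apply: lbdd_prim; exact: lbddB]. Qed.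
Let lU2 : lbdd (fun s => U s ^+ 2). Proof. exact: lbddM. Qed.
Let lk1 : lbdd (fun s => - al s * Xi s ^+ 2).
Proof. by apply: lbddM; [exact: lbddN|exact: lbddM]. Qed.
Let lD : lbdd (fun s => RG s - RF s). Proof. exact: lbddB. Qed.
Let lk2 : lbdd (fun s => 2 * (RG s - RF s) * U s).
Proof. by apply: lbddM => //; apply: lbddM => //; exact: lbdd_cst. Qed.
Let lk3 : lbdd (fun s => - al s * Xi s ^+ 2 * U s ^+ 2 + 2 * (RG s - RF s) * U s * Y s).
Proof. by apply: lbddD; apply: lbddM. Qed.
Let lk : lbdd k.
Proof.
apply: lbddD; apply: lbddM => //; first by apply: lbddM => //; exact: lbdd_cst.
exact: lbddM.
Qed.

(** Product rule for e * Y * U ^ 2, whose factors are all primitives. *)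
Let energy_prim T : 0 <= T ->
  e T * (Y T * U T ^+ 2) = a0^-1 * (h - phi) ^+ 2 + prim k T.
Proof.
move=> T0.
have U2 t : U t ^+ 2 = (h - phi) ^+ 2 + prim (fun s => 2 * (RG s - RF s) * U s) t.
  rewrite {1}expr2 {1 2}/U primM_lb// -expr2; congr (_ + prim _ t).
  by apply/funext => s; rewrite -/(U s); ring.
have YU t : Y t * U t ^+ 2 = a0^-1 * (h - phi) ^+ 2 +
    prim (fun s => - al s * Xi s ^+ 2 * U s ^+ 2 + 2 * (RG s - RF s) * U s * Y s) t.
  rewrite U2 {1}/Y primM_lb//; congr (_ + prim _ t).
  by apply/funext => s; rewrite -U2 -/(Y s).
have eE t : 0 <= t -> e t = 1 + prim (fun s => - (2 * lc) * e s) t.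
  by move=> t0; rewrite /e prim_expR// addrC subrK.
rewrite eE// YU primM_lb//; last by apply: lbddM => //; exact: lbdd_cst.
rewrite mul1r; congr (_ + _); apply: eq_Rintegral => s; rewrite inE/= in_itv/= => /andP[s0 _].
by rewrite -YU -eE.
Qed.

Lemma energy_line T : 0 <= T ->
  line_weight T * ((1 + r) * mv - r * (phi + prim RF T))^-1 *
    ((h + prim RG T) - (phi + prim RF T)) ^+ 2 + prim line_dissipation T <=
  expR (2 * lam * z0) * a0^-1 * (h - phi) ^+ 2 + prim line_source T.
Proof.
move=> T0; rewrite -UE -aE.
have -> : (a0 + prim al T)^-1 = Y T.
  have := YE T0; set x := a0 + _ => xY.
  have x0 : x != 0 by apply: contra_eqN xY => /eqP ->; rewrite mul0r eq_sym oner_eq0.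
  by rewrite -[Y T]mul1r -(mulVf x0) -mulrA xY mulr1.
have -> : line_weight T * Y T * U T ^+ 2 =
    expR (2 * lam * z0) * a0^-1 * (h - phi) ^+ 2 + prim (fun s => expR (2 * lam * z0) * k s) T.
  have assoc (x y z w : R) : x * y * z * w = x * (y * (z * w)) by rewrite !mulrA.
  by rewrite weightE primZ_lb// assoc energy_prim// mulrDr mulrA.
have lBk : lbdd (fun s => expR (2 * lam * z0) * k s) by apply: lbddM => //; exact: lbdd_cst.
rewrite -addrA lerD2l -primD_lb//; last exact: lbdd_line_dissipation.
apply: prim_le_lb; [|exact: lbdd_line_source|].
  by apply: lbddD => //; exact: lbdd_line_dissipation.
apply: (ae_mp2 (ae_mp2 gE fE (fun _ a b => conj a b)) (ae_mp2 cmp XiE (fun _ a b => conj a b))).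
move=> s [gs fs] [cs Xs] /andP[s0 _]; have {}gs := gs s0; have {}fs := fs s0; have {}cs := cs s0.
have YX : Y s = Xi s.
  have := YE s0; rewrite aE -fs -/(A s) => AY.
  have A0 : A s != 0 by rewrite gt_eqF// (lt_le_trans mv0).
  by rewrite -[Y s]mul1r -(mulVf A0) -mulrA AY mulr1.
have /andP[rf0 _] := rfm s.
have := @dissipation R r mv (g s) (f s) (rg s) (rf s) (line_weight s) lc eta gamma r0 mv0 (fm s) rf0 cs
  (expR_ge0 _) d0.
rewrite -RGE -RFE; apply: le_trans.
rewrite le_eqVlt; apply/orP; left; apply/eqP.
rewrite /k UE -gs -fs YX /line_dissipation /al -/(A s) -/(Xi s) weightE.
ring.
Qed.
End energy_line.

(** * Energy inequality in a backward cone *)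

Section energy_plane.
Context {R : realType}.
Notation mu := (@lebesgue_measure R).
Notation mu2 := (mu \x mu)%E.
Let T1 := measurableTypeR R.
Let T2 := (T1 * T1)%type.
Let T3 := (T1 * T2)%type.

Lemma prim_cut (f chi : R -> R) (tau T : R) : (forall s, 0 <= s -> chi s = (s <= tau)%R%:R) ->
  prim (fun s => chi s * f s) T = prim f (Num.min T tau).
Proof.
move=> chiE; rewrite /prim Rint_indic [RHS]Rint_indic; apply: eq_Rintegral => s _.
rewrite !indicE; case: (ltP s 0) => s0.
  have e x : (s \in `[0, x]%classic) = false.
    by apply/negbTE; rewrite notin_setE/= in_itv/= leNgt s0.
  by rewrite !e !mulr0.
have e x : (s \in `[0, x]%classic) = (s <= x).
  by apply/idP/idP; rewrite inE/= in_itv/= s0.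
by rewrite chiE// !e le_min -mulnb natrM; ring.
Qed.

Lemma prim_lt0 (f : R -> R) T : T < 0 -> prim f T = 0.
Proof. by move=> T0; rewrite /prim set_itv_ge ?Rintegral_set0// bnd_simp -ltNge. Qed.


Variables (m : R -> R) (Mx L r c gamma lam eta N : R).
Hypothesis pm : profile m Mx L.
Hypothesis r0 : 0 < r.
Hypothesis gamma12 : 2^-1 < gamma <= 1.
Hypothesis eta0 : 0 <= eta.
Hypothesis d0 : {ae mu, forall v, 0 < m v -> 0 < 1 + lam * (c - v) - eta / 2}.
Variables (h0 F0 : R * R -> R) (G : R * (R * R) -> R).
Hypothesis mh0 : measurable_fun setT (h0 : T2 -> R).
Hypothesis mF0 : measurable_fun setT (F0 : T2 -> R).
Let F (q : R * (R * R)) := F0 q.2.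
Hypothesis fG : field m G.
Hypothesis fF : field m F.
Hypothesis mG : mild m r c h0 G.
Hypothesis mF : mild m r c F0 F.
Hypothesis h0F0 : forall p, gamma * F0 p <= h0 p.

Definition weight (p : R * R) : R := expR (2 * lam * p.1) * ((1 + r) * m p.2 - r * F0 p)^-1.
(** The cone narrows at a speed exceeding all relative velocities, so that
characteristics can only leave it. *)
Definition in_cone (q : R * (R * R)) : R := (`|q.2.1| + (L + `|c| + 1) * q.1 <= N)%R%:R.
Definition drift v := Num.max (1 + lam * (c - v) - eta / 2) 0.
Definition rate z := eta + r * (2 * gamma - 1) * rhoG F 0 z.
Definition damping q := rate q.2.1 * (weight q.2 * (G q - F0 q.2) ^+ 2).
(** The part u^2 / q of the dissipation, kept aside to compensate the source after
integration in velocity. *)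
Definition fill q := expR (2 * lam * q.2.1) * ((G q - F0 q.2) ^+ 2 * drift q.2.2 / ((1 + r) * m q.2.2)).
Definition source q := expR (2 * lam * q.2.1) * (rhoG G q.1 q.2.1 - rhoG F 0 q.2.1) ^+ 2 *
  ((1 + r) * m q.2.2 / drift q.2.2).

Let r1 : 0 < 1 + r. Proof. by rewrite addr_gt0. Qed.

Let F0m p : 0 <= F0 p <= m p.2. Proof. exact: (fF.2 (0, p)). Qed.

Lemma weight_ge0 p : 0 <= weight p.
Proof.
rewrite mulr_ge0 ?expR_ge0// invr_ge0; have /andP[? ?] := F0m p.
by have := r0; have := pf_ge0 pm p.2; nra.
Qed.

Lemma in_cone_ge0 q : 0 <= in_cone q. Proof. exact: ler0n. Qed.

Lemma drift_ge0 v : 0 <= drift v. Proof. by rewrite le_max lexx orbT. Qed.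

Lemma rate_ge0 z : 0 <= rate z.
Proof.
have /andP[rf0 _] := rhoG_bound pm 0 z fF; have /andP[g12 _] := gamma12.
have g2 : 0 <= 2 * gamma - 1 by lra.
by rewrite addr_ge0// mulr_ge0// mulr_ge0// ltW.
Qed.

Lemma damping_ge0 q : 0 <= damping q.
Proof. by rewrite mulr_ge0 ?rate_ge0// mulr_ge0 ?weight_ge0 ?sqr_ge0. Qed.

Lemma fill_ge0 q : 0 <= fill q.
Proof.
rewrite mulr_ge0 ?expR_ge0// mulr_ge0//; first by rewrite mulr_ge0 ?sqr_ge0 ?drift_ge0.
by rewrite invr_ge0 mulr_ge0 ?(pf_ge0 pm)// ltW.
Qed.

Lemma source_ge0 q : 0 <= source q.
Proof.
rewrite mulr_ge0//; first by rewrite mulr_ge0 ?expR_ge0 ?sqr_ge0.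
by rewrite mulr_ge0 ?invr_ge0 ?drift_ge0// mulr_ge0 ?(pf_ge0 pm)// ltW.
Qed.

Let field0 (H : R * (R * R) -> R) t p : field m H -> m p.2 = 0 -> H (t, p) = 0.
Proof.
by move=> fH m0; have := fH.2 (t, p); rewrite /= m0 => /andP[? ?]; apply/eqP; rewrite eq_le; apply/andP.
Qed.

Let m_out v : 0 < m v -> `|v| <= L.
Proof.
move=> m0; have := lt_le_trans m0 (pf_le pm v); rewrite indicE.
case: (boolP (v \in _)); last by rewrite mulr0 ltxx.
by rewrite inE/= in_itv/= ler_norml.
Qed.

Let damping0 t p : m p.2 = 0 -> damping (t, p) = 0.
Proof. by move=> m0; rewrite /damping/= -/(F (t, p)) !field0// subrr expr0n/= !mulr0. Qed.
Let fill0 t p : m p.2 = 0 -> fill (t, p) = 0.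
Proof. by move=> m0; rewrite /fill/= -/(F (t, p)) !field0// subrr expr0n/= !mul0r mulr0. Qed.
Let source0 t p : m p.2 = 0 -> source (t, p) = 0.
Proof. by move=> m0; rewrite /source/= m0 mulr0 mul0r mulr0. Qed.

Let msnd : measurable_fun setT (fun q : T3 => q.2 : T2) := @measurable_snd _ _ T1 T2.
Let mpos3 : measurable_fun setT (fun q : T3 => q.2.1 : T1).
Proof. exact: (measurableT_comp (@measurable_fst _ _ T1 T1) msnd). Qed.
Let mvel3 : measurable_fun setT (fun q : T3 => q.2.2 : T1).
Proof. exact: (measurableT_comp (@measurable_snd _ _ T1 T1) msnd). Qed.
Let mm3 : measurable_fun setT (fun q : T3 => m q.2.2).
Proof. exact: (measurableT_comp (pf_meas pm) mvel3). Qed.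
Let mexp3 : measurable_fun setT (fun q : T3 => expR (2 * lam * q.2.1)).
Proof. by apply: measurableT_comp => //; exact: measurable_funM. Qed.

Lemma measurable_weight : measurable_fun setT (weight : T2 -> R).
Proof.
apply: measurable_funM.
  by apply: measurableT_comp => //; apply: measurable_funM => //; exact: (@measurable_fst _ _ T1 T1).
apply: measurable_inv; last first.
  by move=> p; have /andP[? ?] := F0m p; have := r0; have := pf_ge0 pm p.2; nra.
apply: measurable_funB; last exact: measurable_funM.
by apply: measurable_funM => //; exact: (measurableT_comp (pf_meas pm) (@measurable_snd _ _ T1 T1)).
Qed.

Lemma measurable_drift : measurable_fun setT drift.
Proof.
apply: measurable_maxr => //; apply: measurable_funB => //; apply: measurable_funD => //.
by apply: measurable_funM => //; exact: measurable_funB.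
Qed.

Let mdrift3 : measurable_fun setT (fun q : T3 => drift q.2.2).
Proof. exact: (measurableT_comp measurable_drift mvel3). Qed.

Lemma measurable_in_cone : measurable_fun setT (in_cone : T3 -> R).
Proof.
rewrite (_ : in_cone = \1_[set q : T3 | `|q.2.1| + (L + `|c| + 1) * q.1 <= N]).
  apply: measurable_indic; apply: (@measurable_leset _ T3) => //.
  by apply: measurable_funD; [exact: measurableT_comp|exact: measurable_funM].
by apply/funext => q; rewrite indicE mem_setE.
Qed.

Let mu3 : measurable_fun setT (fun q : T3 => (G q - F0 q.2) ^+ 2).
Proof. by apply: measurable_funX; apply: measurable_funB; [exact: fG.1|exact: (measurableT_comp mF0 msnd)]. Qed.

Let mrhoF3 : measurable_fun setT (fun q : T3 => rhoG F 0 q.2.1).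
Proof.
have mq : measurable_fun setT (fun q : T3 => (0, q.2.1) : T1 * T1).
  by apply: measurable_fun_pair => //; exact: measurable_cst.
exact: (measurableT_comp (measurable_rhoG fF.1) mq).
Qed.

Lemma measurable_damping : measurable_fun setT (damping : T3 -> R).
Proof.
apply: measurable_funM; last first.
  by apply: measurable_funM => //; exact: (measurableT_comp measurable_weight msnd).
by apply: measurable_funD => //; apply: measurable_funM.
Qed.

Lemma measurable_fill : measurable_fun setT (fill : T3 -> R).
Proof.
apply: measurable_funM => //; apply: measurable_funM; first exact: measurable_funM.
by apply: measurable_inv => [|q]; [exact: measurable_funM|rewrite mulr_ge0 ?(pf_ge0 pm)// ltW].
Qed.

Lemma measurable_source : measurable_fun setT (source : T3 -> R).
Proof.
apply: measurable_funM; last first.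
  apply: measurable_funM; first exact: measurable_funM.
  by apply: measurable_inv => // q; exact: drift_ge0.
apply: measurable_funM => //; apply: measurable_funX; apply: measurable_funB => //.
have mq : measurable_fun setT (fun q : T3 => (q.1, q.2.1) : T1 * T1) by exact: measurable_fun_pair.
exact: (measurableT_comp (measurable_rhoG fG.1) mq).
Qed.

Lemma comparison_along : {ae mu2, forall p, {ae mu, forall s, 0 <= s ->
  gamma * rhoG F s (char c s p).1 <= rhoG G s (char c s p).1}}.
Proof.
have /andP[g12 g1] := gamma12; have g01 : 0 <= gamma <= 1 by rewrite g1 andbT; lra.
have mrho H : field m H -> measurable_fun setT (fun q : T3 => rhoG H q.1 (char c q.1 q.2).1).
  move=> fH; have mp : measurable_fun setT (fun q : T3 => (q.1, (char c q.1 q.2).1) : T1 * T1).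
    apply: measurable_fun_pair => //.
    have mm := @measurable_fst _ _ T1 T1.
    exact: (measurableT_comp (measurableT_comp mm (@measurable_snd _ _ T1 T2)) (measurable_char3 c)).
  exact: (measurableT_comp (measurable_rhoG fH.1) mp).
apply: (@ae_exchange R (fun s p => gamma * rhoG F s (char c s p).1 <= rhoG G s (char c s p).1)).
  by apply: (@measurable_leset _ T3); [apply: measurable_funM|] => //; exact: mrho.
move=> t t0; have mc : measurable_fun setT (fun v : R => (v - c) * t).
  by apply: measurable_funM => //; exact: measurable_funB.
exact: (ae_shear mc (comparison pm r0 g01 mh0 mF0 fG fF mG mF h0F0 t0)).
Qed.


Definition coned f q := in_cone q * f q.

(** On one characteristic the cone is a time interval, so this is energy_line
up to the exit time, after which the cut-off terms vanish. *)
Lemma energy_pointwise T : 0 <= T -> {ae mu2, forall p,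
  [/\ lbdd (along c (coned damping) p), lbdd (along c (coned fill) p), lbdd (along c (coned source) p) &
  in_cone (T, char c T p) * (weight (char c T p) * (G (T, char c T p) - F0 (char c T p)) ^+ 2)
  + (prim (along c (coned damping) p) T + prim (along c (coned fill) p) T) <=
  weight p * (h0 p - F0 p) ^+ 2 + prim (along c (coned source) p) T]}.
Proof.
move=> T0.
have aeG := rep_ae pm mh0 fG mG; have aeF := rep_ae pm mF0 fF mF.
have aeGT := mG T0; have aeFT := mF T0.
have aeA := ae_mp2 aeG aeF (fun p a b => conj a b).
have aeB := ae_mp2 aeGT aeFT (fun p a b => conj a b).
have aeC := ae_mp2 comparison_along (@ae_prod_snd _ _ T1 T1 R mu mu _ d0) (fun p a b => conj a b).
have aeAB := ae_mp2 aeA aeB (fun p a b => conj a b).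
apply: (ae_mp2 aeAB aeC) => p [[aG aF] [GT FT]] [cmp dp].
have [m0|mpos] := eqVneq (m p.2) 0.
  (* Where m vanishes all the fields vanish, hence every term. *)
  have e1 f : (forall t p, m p.2 = 0 -> f (t, p) = 0) -> along c (coned f) p = fun=> 0.
    by move=> f0; apply/funext => s; rewrite /along /coned f0// mulr0.
  rewrite (e1 _ damping0) (e1 _ fill0) (e1 _ source0); split; [exact: lbdd_cst|exact: lbdd_cst|exact: lbdd_cst|].
  rewrite -/(F (T, char c T p)) (field0 T (p := char c T p) fG)// (field0 T (p := char c T p) fF)//.
  have p0 : prim (fun=> 0 : R) T = 0 by rewrite /prim /Rintegral integral0.
  by rewrite p0 subrr expr0n/= !mulr0 !addr0 mulr_ge0 ?weight_ge0 ?sqr_ge0.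
have mp : 0 < m p.2 by rewrite lt0r mpos (pf_ge0 pm).
have {}dp := dp mp.
have dE : drift p.2 = 1 + lam * (c - p.2) - eta / 2.
  by apply/max_idPl; exact: ltW.
have slope : `|p.2 - c| < L + `|c| + 1.
  by rewrite (le_lt_trans (ler_normB _ _))// ltr_pwDr// lerD2r; exact: m_out.
have [tau tauE] := @cone R N _ p.1 _ slope.
have coneE s : 0 <= s -> along c in_cone p s = (s <= tau)%R%:R.
  by move=> s0; rewrite /along /in_cone/= tauE.
pose rg s := rhoG G s (char c s p).1.
pose rf s := rhoG F s (char c s p).1.
have mrho H : field m H -> measurable_fun setT (fun s : T1 => rhoG H s (char c s p).1).
  move=> fH; have mq : measurable_fun setT (fun s : T1 => (s, (char c s p).1) : T1 * T1).
    apply: measurable_fun_pair => //; apply: measurable_funD => //; exact: measurable_funM.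
  exact: (measurableT_comp (measurable_rhoG fH.1) mq).
have mRG := measurable_along c p (measurable_Rg pm r fG).
have mRF := measurable_along c p (measurable_Rg pm r fF).
have bRG s := along_Rg_bound c pm r0 p s fG.
have bRF s := along_Rg_bound c pm r0 p s fF.
have bG s : 0 <= along c G p s <= m p.2 := fG.2 (s, char c s p).
have bF s : 0 <= along c F p s <= m p.2 := fF.2 (s, char c s p).
have brg s : 0 <= rg s <= 1 by exact: (rhoG_bound pm _ _ fG).
have brf s : 0 <= rf s <= 1 by exact: (rhoG_bound pm _ _ fF).
have mg := measurable_along c p fG.1; have mf := measurable_along c p fF.1.
pose ld := line_dissipation r (m p.2) gamma eta lam (lam * (c - p.2)) p.1 (along c G p) (along c F p) rf.
pose ls := line_source r (m p.2) eta lam (lam * (c - p.2)) p.1 rg rf.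
have wE s : line_weight lam (lam * (c - p.2)) p.1 s = expR (2 * lam * (char c s p).1).
  by rewrite /line_weight /char/=; congr expR; ring.
have ldE s : ld s = along c damping p s + along c fill p s.
  rewrite /ld /line_dissipation wE /along /damping /fill /weight /rate dE /=.
  by rewrite -/(F (s, char c s p)) /rf /rhoG /F /char/=; ring.
have lsE s : ls s = along c source p s.
  by rewrite /ls /line_source wE /along /source dE.
have lld : lbdd ld := lbdd_line_dissipation gamma eta lam (lam * (c - p.2)) p.1 r0 mp mg mf (mrho _ fF) bG bF brf.
have lls : lbdd ls := lbdd_line_source r (m p.2) eta lam (lam * (c - p.2)) p.1 (mrho _ fG) (mrho _ fF) brg brf.
have EL := @energy_line R r (m p.2) gamma eta lam (lam * (c - p.2)) p.1 (h0 p) (F0 p) ((1 + r) * Mx)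
  (along c G p) (along c F p) rg rf (along c (Rg m r G) p) (along c (Rg m r F) p)
  r0 mp dp mg mf (mrho _ fG) (mrho _ fF) mRG mRF bRG bRF bG bF (F0m p) brg brf
  (fun s => erefl) (fun s => erefl) aG aF cmp.
have lsub f : measurable_fun setT (f : T3 -> R) -> (forall s, 0 <= along c f p s <= ld s) ->
    lbdd (along c f p).
  move=> mf' fl; split; first exact: measurable_along.
  move=> S; have [C lC] := lld.2 S; exists C => s sS.
  have /andP[f0 f1] := fl s; rewrite ger0_norm// (le_trans f1)// (le_trans _ (lC _ sS))//.
  exact: ler_norm.
have ld1 : lbdd (along c damping p).
  by apply: lsub => [|s]; [exact: measurable_damping|rewrite ldE lerDl damping_ge0 fill_ge0].
have ld2 : lbdd (along c fill p).
  by apply: lsub => [|s]; [exact: measurable_fill|rewrite ldE lerDr damping_ge0 fill_ge0].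
have ld3 : lbdd (along c source p).
  by rewrite (_ : along c source p = ls)//; apply/funext => s; rewrite lsE.
have lco : lbdd (along c in_cone p).
  apply: (@lbdd_bnd _ _ 1); first exact: (measurable_along c p measurable_in_cone).
  by move=> s; rewrite /along ger0_norm ?in_cone_ge0// /in_cone lern1 leq_b1.
have cutE f : along c (coned f) p = (fun s => along c in_cone p s * along c f p s) by [].
split; rewrite ?cutE; [exact: lbddM|exact: lbddM|exact: lbddM|].
rewrite !(prim_cut _ _ coneE) -primD_lb//.
have -> : (fun s => along c damping p s + along c fill p s) = ld by apply/funext => s; rewrite ldE.
have -> : along c source p = ls by apply/funext => s; rewrite lsE.
have W0 : 0 <= weight p * (h0 p - F0 p) ^+ 2 by rewrite mulr_ge0 ?weight_ge0 ?sqr_ge0.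
have WT0 : 0 <= weight (char c T p) * (G (T, char c T p) - F0 (char c T p)) ^+ 2.
  by rewrite mulr_ge0 ?weight_ge0 ?sqr_ge0.
have -> : in_cone (T, char c T p) = (T <= tau)%R%:R := coneE T T0.
have [tau0|tau0] := ltP tau 0.
  have TN : (T <= tau) = false by apply/negbTE; rewrite -ltNge (lt_le_trans tau0).
  by rewrite TN mul0r !prim_lt0 ?gt_min ?tau0 ?orbT// !addr0.
have S0 : 0 <= Num.min T tau by rewrite le_min T0.
have EW : expR (2 * lam * p.1) * ((1 + r) * m p.2 - r * F0 p)^-1 * (h0 p - F0 p) ^+ 2 =
  weight p * (h0 p - F0 p) ^+ 2 by [].
rewrite -EW; apply: le_trans (EL _ S0); rewrite -/ld lerD2r.
case: (leP T tau) => Ttau; last first.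
  rewrite mul0r mulr_ge0 ?sqr_ge0// mulr_ge0 ?expR_ge0// invr_ge0.
  have aS : {ae mu, forall s, tau <= s -> 0 <= (1 + r) * m p.2 - r * (F0 p + prim (along c (Rg m r F) p) s)}.
    apply: (ae_mp aF) => s aFs ts; have s0 : 0 <= s by exact: le_trans ts.
    have := aFs s0; rewrite /rep => <-; have /andP[_ fs] := bF s.
    rewrite (_ : _ - _ = m p.2 + r * (m p.2 - along c F p s)); last by ring.
    by rewrite addr_ge0 ?(pf_ge0 pm)// mulr_ge0 ?(ltW r0)// subr_ge0.
  apply: (@ae_ge_right R _ (r * ((1 + r) * Mx))) aS.
    by rewrite mulr_ge0 ?(ltW r0)// (le_trans (normr_ge0 _) (bRF 0)).
  move=> s ts; rewrite -mulrA.
  have := @prim_lip R (along c (Rg m r F) p) ((1 + r) * Mx) tau s mRF bRF.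
  rewrite tau0 ts => /(_ isT) lip.
  set x := prim _ s in lip *; set y := prim _ tau in lip *.
  have -> : (1 + r) * m p.2 - r * (F0 p + x) - ((1 + r) * m p.2 - r * (F0 p + y)) = r * - (x - y) by ring.
  by rewrite normrM normrN (ger0_norm (ltW r0)) ler_wpM2l// ltW.
rewrite mul1r (_ : F0 (char c T p) = F (T, char c T p))//.
have eW : weight (char c T p) = line_weight lam (lam * (c - p.2)) p.1 T *
   ((1 + r) * m p.2 - r * (F0 p + prim (along c (Rg m r F) p) T))^-1.
  by rewrite wE /weight (_ : F0 (char c T p) = F (T, char c T p))// FT.
by rewrite eW FT GT.
Qed.

(** Integrating over starting points or over the points reached is the same,
since the flow preserves the measure. *)
Lemma flow_tonelli (f : R * (R * R) -> R) T : measurable_fun setT (f : T3 -> R) ->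
  (forall q, 0 <= f q) ->
  (\int[mu2]_p \int[mu]_t (\1_(`[0%R, T]%classic) t * along c f p t)%:E =
   \int[mu]_t \int[mu2]_p (\1_(`[0%R, T]%classic) t * f (t, p))%:E)%E.
Proof.
move=> mf f0.
pose k (w : T1 * T2) : \bar R := (\1_(`[0%R, T]%classic) w.1 * along c f w.2 w.1)%:E.
have mk : measurable_fun setT k.
  apply/measurable_EFinP; apply: measurable_funM; last exact: measurable_along3.
  exact: (measurableT_comp (measurable_indic _) (@measurable_fst _ _ T1 T2)).
have k0 w : (0 <= k w)%E by rewrite lee_fin mulr_ge0 ?f0// indicE ler0n.
rewrite -(@fubini_tonelli _ _ T1 T2 R mu plane k mk k0); apply: eq_integral => t _.
have mc : measurable_fun setT (fun v : R => (v - c) * t).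
  by apply: measurable_funM => //; exact: measurable_funB.
apply: (@ge0_integral_shear R (fun v => (v - c) * t) (fun p => (\1_(`[0%R, T]%classic) t * f (t, p))%:E)) => //.
- apply/measurable_EFinP; apply: measurable_funM => //.
  exact: (measurableT_comp mf (pair1_measurable t)).
- by move=> p; rewrite lee_fin mulr_ge0 ?f0// indicE ler0n.
Qed.

Let timeint f T (p : R * R) : \bar R := (\int[mu]_t (\1_(`[0%R, T]%classic) t * along c f p t)%:E)%E.

Let timeint_prim f T p : lbdd (along c f p) -> timeint f T p = (prim (along c f p) T)%:E.
Proof.
move=> lf; rewrite -prim_EFin// [RHS]integral_mkcond; apply: eq_integral => t _.
by rewrite patchE indicE; case: ifP => _; rewrite ?mul1r ?mul0r.
Qed.

Let timeint_ge0 f T p : (forall q, 0 <= f q) -> (0 <= timeint f T p)%E.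
Proof. by move=> f0; apply: integral_ge0 => t _; rewrite lee_fin mulr_ge0 ?f0// indicE ler0n. Qed.

Let measurable_timeint f T : measurable_fun setT (f : T3 -> R) -> (forall q, 0 <= f q) ->
  measurable_fun setT (timeint f T : T2 -> \bar R).
Proof.
move=> mf f0.
apply: (@measurable_fun_fubini_tonelli_G _ _ T1 T2 R mu
  (fun w => (\1_(`[0%R, T]%classic) w.1 * along c f w.2 w.1)%:E)).
  apply/measurable_EFinP; apply: measurable_funM; last exact: measurable_along3.
  exact: (measurableT_comp (measurable_indic _) (@measurable_fst _ _ T1 T2)).
by move=> w; rewrite lee_fin mulr_ge0 ?f0// indicE ler0n.
Qed.

Hypothesis q_int : mu.-integrable setT (fun v => ((1 + r) * m v / drift v)%:E).
Hypothesis q_le1 : \int[mu]_v ((1 + r) * m v / drift v) <= 1.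

Let u t p := G (t, p) - F0 p.

Let u_bound t p : `|u t p| <= m p.2.
Proof.
by rewrite /u; have /andP[? ?] := fG.2 (t, p); have /andP[? ?] := F0m p; rewrite ler_norml; apply/andP; split; lra.
Qed.

Let drift_bound v : m v != 0 -> drift v <= 1 + `|lam| * (`|c| + `|L|).
Proof.
move=> mv; have v0 : `|v| <= `|L|.
  by rewrite (le_trans _ (ler_norm L))//; apply: m_out; rewrite lt0r mv (pf_ge0 pm).
rewrite ge_max; apply/andP; split; last first.
  by rewrite addr_ge0// mulr_ge0// addr_ge0// (le_trans _ v0).
have h : lam * (c - v) <= `|lam| * (`|c| + `|L|).
  rewrite (le_trans (ler_norm _))// normrM ler_wpM2l// (le_trans (ler_normB _ _))// lerD2l//.
by have := eta0; lra.
Qed.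

Let filling (t z v : R) := u t (z, v) ^+ 2 * drift v / ((1 + r) * m v).

Let filling_ge0 t z v : 0 <= filling t z v.
Proof.
rewrite /filling mulr_ge0//; first by rewrite mulr_ge0 ?sqr_ge0 ?drift_ge0.
by rewrite invr_ge0 mulr_ge0 ?(pf_ge0 pm)// ltW.
Qed.

Let filling_bound t z v : filling t z v <= m v * (1 + `|lam| * (`|c| + `|L|)).
Proof.
rewrite /filling; have [m0|mv] := eqVneq (m v) 0; first by rewrite m0 !mulr0 mul0r invr0 mulr0.
have mp : 0 < m v by rewrite lt0r mv (pf_ge0 pm).
rewrite ler_pdivrMr ?mulr_gt0//.
have u2 : u t (z, v) ^+ 2 <= m v ^+ 2.
  by rewrite -(real_normK (num_real _)) ler_pXn2r ?nnegrE ?(pf_ge0 pm)// (u_bound t (z, v)).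
have d1 := drift_bound mv.
apply: (@le_trans _ _ (m v ^+ 2 * (1 + `|lam| * (`|c| + `|L|)))).
  by apply: ler_pM => //; [exact: sqr_ge0|exact: drift_ge0].
have -> : m v * (1 + `|lam| * (`|c| + `|L|)) * ((1 + r) * m v) =
  (m v ^+ 2 * (1 + `|lam| * (`|c| + `|L|))) * (1 + r) by ring.
rewrite ler_peMr ?lerDl ?(ltW r0)// mulr_ge0 ?sqr_ge0//.
Qed.

Let slice_int t z (H : R * (R * R) -> R) : field m H -> mu.-integrable setT (EFin \o (fun v => H (t, (z, v)))).
Proof.
move=> fH; apply: (pf_bdd pm); first exact: measurable_slice fH.1.
by move=> v; have /andP[? ?] := fH.2 (t, (z, v)); rewrite ger0_norm.
Qed.

Let filling_int t z : mu.-integrable setT (EFin \o filling t z).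
Proof.
have mf : measurable_fun setT (filling t z).
  apply: measurable_funM; last first.
    apply: measurable_inv => [|v]; last by rewrite mulr_ge0 ?(pf_ge0 pm)// ltW.
    by apply: measurable_funM => //; exact: pf_meas pm.
  apply: measurable_funM; last exact: measurable_drift.
  apply: measurable_funX; apply: measurable_funB; first exact: measurable_slice fG.1.
  exact: (@measurable_slice R F 0 z fF.1).
apply: (@bdd_integrable _ T1 R mu _ `[- L, L]%classic (Mx * (1 + `|lam| * (`|c| + `|L|)))) => //.
  exact: mu_itv_lty.
move=> v; rewrite ger0_norm ?filling_ge0// (le_trans (filling_bound t z v))//.
by rewrite mulrAC ler_wpM2r ?(pf_le pm)// addr_ge0// mulr_ge0// addr_ge0.
Qed.

(** Cauchy-Schwarz: the difference S of the densities is the integral of u, so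
2 S * S <= S^2 Q + (integral of u^2 / q) where Q <= 1 is the mass of
q = (1 + r) m / drift. *)
Let source_le_fill t z :
  (rhoG G t z - rhoG F 0 z) ^+ 2 * \int[mu]_v ((1 + r) * m v / drift v) <= \int[mu]_v filling t z v.
Proof.
have Q1 := q_le1; set S := rhoG G t z - rhoG F 0 z; set Q := Rintegral _ _ _ in Q1 *.
have iu : mu.-integrable setT (EFin \o (fun v => u t (z, v))).
  exact: (integrableB measurableT (slice_int t z fG) (slice_int 0 z fF)).
have SE : \int[mu]_v u t (z, v) = S.
  by rewrite /S /rhoG -RintegralB//; [exact: slice_int|exact: (slice_int 0 z fF)].
have i1 : mu.-integrable setT (EFin \o (fun v => 2 * S * u t (z, v))).
  exact: (@integrableZl _ T1 R mu setT measurableT (2 * S) _ iu).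
have i2 : mu.-integrable setT (EFin \o (fun v => S ^+ 2 * ((1 + r) * m v / drift v))).
  exact: (@integrableZl _ T1 R mu setT measurableT (S ^+ 2) _ q_int).
have i3 := integrableD measurableT i2 (filling_int t z).
have := @le_Rint_ae _ T1 R mu (fun v => 2 * S * u t (z, v))
  (fun v => S ^+ 2 * ((1 + r) * m v / drift v) + filling t z v) i1 i3.
rewrite (RintegralD measurableT i2 (filling_int t z)) RintegralZl// SE RintegralZl// -/Q => H.
have {}H : 2 * S * S <= S ^+ 2 * Q + \int[mu]_v filling t z v.
  apply: H; apply: (ae_mp d0) => v dv.
  have [m0|mv] := eqVneq (m v) 0.
    have u0 : u t (z, v) = 0.
      by apply/eqP; rewrite -normr_le0 (le_trans (u_bound t (z, v)))// m0.
    by rewrite u0 /filling u0 m0 mulr0 expr0n/= !mul0r mulr0 mul0r mulr0 addr0.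
  have mp : 0 < m v by rewrite lt0r mv (pf_ge0 pm).
  have {}dv : 0 < drift v by rewrite lt_max dv.
  rewrite /filling; set x := u t (z, v).
  set q := (1 + r) * m v / drift v.
  have q0 : 0 < q by rewrite divr_gt0// mulr_gt0.
  have -> : x ^+ 2 * drift v / ((1 + r) * m v) = x ^+ 2 / q.
    by rewrite /q; field; rewrite !gt_eqF.
  have : 0 <= (S * q - x) ^+ 2 / q by rewrite divr_ge0 ?sqr_ge0// ltW.
  have -> : (S * q - x) ^+ 2 / q = S ^+ 2 * q - 2 * S * x + x ^+ 2 / q.
    by field; rewrite gt_eqF.
  lra.
have S2 : 0 <= S ^+ 2 := sqr_ge0 S.
have SQ : S ^+ 2 * Q <= S ^+ 2 by rewrite ler_piMr.
have e2 : 2 * S * S = S ^+ 2 + S ^+ 2 by ring.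
rewrite -(lerD2l (S ^+ 2 * Q)) (le_trans _ H)// e2.
exact: lerD.
Qed.

Let EFin_Rint (k : R) (f : R -> R) : mu.-integrable setT (EFin \o f) ->
  (\int[mu]_v (k * f v)%:E = (k * \int[mu]_v f v)%:E)%E.
Proof.
move=> fi; rewrite -RintegralZl// /Rintegral fineK//.
apply: (@integrable_fin_num _ T1 R mu) => //.
exact: (@integrableZl _ T1 R mu setT measurableT k _ fi).
Qed.

Let cut_ge0 f q : (forall q, 0 <= f q) -> 0 <= coned f q.
Proof. by move=> f0; rewrite mulr_ge0 ?in_cone_ge0. Qed.

Let measurable_cut f : measurable_fun setT (f : T3 -> R) -> measurable_fun setT (coned f : T3 -> R).
Proof. by move=> mf; apply: measurable_funM => //; exact: measurable_in_cone. Qed.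

Let source_le_fill_plane t :
  (\int[mu2]_p (coned source (t, p))%:E <= \int[mu2]_p (coned fill (t, p))%:E)%E.
Proof.
have mcut f : measurable_fun setT (f : T3 -> R) -> measurable_fun setT (fun p : T2 => (coned f (t, p))%:E).
  move=> mf; apply/measurable_EFinP.
  exact: (measurableT_comp (measurable_cut mf) (pair1_measurable t)).
have c0 f : (forall q, 0 <= f q) -> forall p : T2, (0 <= (coned f (t, p))%:E)%E.
  by move=> f0 p; rewrite lee_fin cut_ge0.
rewrite (@fubini_tonelli1 _ _ T1 T1 R mu mu _ (mcut _ measurable_source) (c0 _ source_ge0)).
rewrite (@fubini_tonelli1 _ _ T1 T1 R mu mu _ (mcut _ measurable_fill) (c0 _ fill_ge0)).
apply: ge0_le_integral => //.
- by move=> z _; apply: integral_ge0 => v _; exact: c0 source_ge0 _.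
- exact: (@measurable_fun_fubini_tonelli_F _ _ T1 T1 R mu _ (mcut _ measurable_source) (c0 _ source_ge0)).
- exact: (@measurable_fun_fubini_tonelli_F _ _ T1 T1 R mu _ (mcut _ measurable_fill) (c0 _ fill_ge0)).
move=> z _; rewrite /fubini_F.
pose k := in_cone (t, (z, 0)) * expR (2 * lam * z).
have k0 : 0 <= k by rewrite mulr_ge0 ?in_cone_ge0 ?expR_ge0.
have -> : (\int[mu]_v (coned source (t, (z, v)))%:E =
  \int[mu]_v (k * (rhoG G t z - rhoG F 0 z) ^+ 2 * ((1 + r) * m v / drift v))%:E)%E.
  by apply: eq_integral => v _; rewrite /coned /source /k /in_cone/= !mulrA.
have -> : (\int[mu]_v (coned fill (t, (z, v)))%:E = \int[mu]_v (k * filling t z v)%:E)%E.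
  by apply: eq_integral => v _; rewrite /coned /fill /k /in_cone /filling /u/= !mulrA.
rewrite !EFin_Rint// lee_fin -mulrA ler_wpM2l//; exact: source_le_fill.
Qed.

Hypothesis L0 : 0 < L.

Let fill_fin T : (\int[mu]_t \int[mu2]_p (\1_(`[0%R, T]%classic) t * coned fill (t, p))%:E < +oo)%E.
Proof.
pose k (w : T1 * T2) := \1_(`[0%R, T]%classic) w.1 * coned fill w.
have mk : measurable_fun setT k.
  apply: measurable_funM; last exact: (measurable_cut measurable_fill).
  exact: (measurableT_comp (measurable_indic _) (@measurable_fst _ _ T1 T2)).
have k0 w : 0 <= k w by rewrite mulr_ge0 ?cut_ge0 ?indicE ?ler0n//; exact: fill_ge0.
have mEk : measurable_fun setT (EFin \o k) by exact/measurable_EFinP.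
have := @fubini_tonelli1 _ _ T1 T2 R mu plane (EFin \o k) mEk (fun w => k0 w).
rewrite /fubini_F => <-.
pose D : set T2 := `[- N, N]%classic `*` `[- L, L]%classic.
have mD : measurable D by exact: measurableX.
have tbox_lty : ((mu \x plane) (`[0%R, T]%classic `*` D) < +oo)%E.
  rewrite product_measure1E//; apply: lte_mul_pinfty; first exact: measure_ge0.
    by rewrite ge0_fin_numE; [exact: mu_itv_lty|exact: measure_ge0].
  exact: box_fin.
pose C := expR (2 * `|lam| * N) * (Mx * (1 + `|lam| * (`|c| + `|L|))).
have C0 : 0 <= C.
  apply: mulr_ge0; first exact: expR_ge0.
  apply: mulr_ge0; first by rewrite (le_trans (pf_ge0 pm 0))// (pf_Mx pm).
  by apply: addr_ge0 => //; apply: mulr_ge0 => //; apply: addr_ge0.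
have ik : (mu \x plane)%E.-integrable setT (EFin \o k).
  apply: (@bdd_integrable _ (T1 * T2)%type R (mu \x plane)%E k (`[0%R, T]%classic `*` D) C) => //.
    exact: measurableX.
  move=> [t [z v]]; rewrite ger0_norm// /k /=.
  have -> : \1_(`[0%R, T]%classic `*` D) (t, (z, v)) =
     \1_(`[0%R, T]%classic) t * (\1_(`[- N, N]%classic) z * \1_(`[- L, L]%classic) v) :> R.
    by rewrite !indicE !in_setX/= -!mulnb !natrM.
  rewrite [C * _]mulrCA !indicE; case: (boolP (t \in _)) => [|_]; last by rewrite !mul0r.
  rewrite inE/= in_itv/= => /andP[t0 _]; rewrite !mul1r.
  rewrite /coned /in_cone/=; case: (leP _ N) => coneN; last first.
    by rewrite mul0r mulr_ge0// mulr_ge0// ler0n.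
  have zN : `|z| <= N.
    rewrite (le_trans _ coneN)// lerDl mulr_ge0// !addr_ge0//; exact: ltW.
  have -> : (z \in `[- N, N]%classic) by rewrite inE/= in_itv/= -ler_norml.
  rewrite !mul1r /fill/= /C -[X in _ <= X]mulrA; apply: ler_pM; [exact: expR_ge0|exact: (filling_ge0 t z v)| |].
    rewrite ler_expR -!mulrA ler_wpM2l//; apply: (le_trans (ler_norm _)).
    by rewrite normrM ler_wpM2l.
  apply: (le_trans (filling_bound t z v)).
  rewrite mulrAC; apply: ler_wpM2r; first by rewrite addr_ge0// mulr_ge0// addr_ge0.
  by have := pf_le pm v; rewrite indicE.
have /integrableP[_] := ik; apply: le_lt_trans; apply: ge0_le_integral => //.
- by move=> w _; rewrite lee_fin.
- exact: measurableT_comp.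
- by move=> w _; rewrite /= lee_fin ler_norm.
Qed.

Let cancel_fin (a w so fi : \bar R) :
  (a + fi <= w + so -> so <= fi -> fi \is a fin_num -> a <= w)%E.
Proof. by move=> h sf fin; rewrite -(leeD2rE _ _ fin) (le_trans h)// leeD2l. Qed.

(** On the cone the fill term is finite, being bounded with bounded support in
time-space; it can therefore be cancelled against the source. *)
Lemma energy_cone T : 0 <= T ->
  (\int[mu2]_p (in_cone (T, p) * (weight p * u T p ^+ 2))%:E +
   \int[mu]_t \int[mu2]_p (\1_(`[0%R, T]%classic) t * coned damping (t, p))%:E <=
   \int[mu2]_p (weight p * (h0 p - F0 p) ^+ 2)%:E)%E.
Proof.
move=> T0.
have mcd := measurable_cut measurable_damping; have cd0 := cut_ge0 _ damping_ge0.
have mcf := measurable_cut measurable_fill; have cf0 := cut_ge0 _ fill_ge0.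
have mcs := measurable_cut measurable_source; have cs0 := cut_ge0 _ source_ge0.
pose e (p : T2) : \bar R := (in_cone (T, p) * (weight p * u T p ^+ 2))%:E.
have e0 p : (0 <= e p)%E by rewrite lee_fin mulr_ge0 ?in_cone_ge0// mulr_ge0 ?weight_ge0 ?sqr_ge0.
have muT : measurable_fun setT (u T : T2 -> R).
  by apply: measurable_funB => //; exact: (measurableT_comp fG.1 (pair1_measurable T)).
have me : measurable_fun setT e.
  apply/measurable_EFinP; apply: measurable_funM.
    exact: (measurableT_comp measurable_in_cone (pair1_measurable T)).
  by apply: measurable_funM; [exact: measurable_weight|exact: measurable_funX].
have mc : measurable_fun setT (fun v : R => (v - c) * T).
  by apply: measurable_funM => //; exact: measurable_funB.
have eE : (\int[mu2]_p e (char c T p) = \int[mu2]_p e p)%E := ge0_integral_shear mc me e0.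
have mec : measurable_fun setT (fun p : T2 => e (char c T p)).
  exact: (measurableT_comp me (measurable_shear mc)).
have tE f (mf : measurable_fun setT (f : T3 -> R)) f0 := @flow_tonelli f T mf f0.
pose w0 (p : T2) : \bar R := (weight p * (h0 p - F0 p) ^+ 2)%:E.
have w00 p : (0 <= w0 p)%E by rewrite lee_fin mulr_ge0 ?weight_ge0 ?sqr_ge0.
have mw0 : measurable_fun setT w0.
  apply/measurable_EFinP; apply: measurable_funM; first exact: measurable_weight.
  by apply: measurable_funX; exact: measurable_funB.
have le1 : (\int[mu2]_p (e (char c T p) + (timeint (coned damping) T p + timeint (coned fill) T p)) <=
   \int[mu2]_p (w0 p + timeint (coned source) T p))%E.
  apply: ae_ge0_le_integral => //.
  - by move=> p _; apply: adde_ge0 => //; apply: adde_ge0; exact: timeint_ge0.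
  - apply: emeasurable_funD => //; apply: emeasurable_funD; exact: measurable_timeint.
  - by move=> p _; apply: adde_ge0 => //; exact: timeint_ge0.
  - by apply: emeasurable_funD => //; exact: measurable_timeint.
  apply: (ae_mp (energy_pointwise T0)) => p [l1 l2 l3 le] _.
  by rewrite !timeint_prim// -!EFinD lee_fin.
have tm f : measurable_fun setT (f : T3 -> R) -> (forall q, 0 <= f q) ->
    (forall p : T2, setT p -> (0 <= timeint f T p)%E) /\ measurable_fun setT (timeint f T : T2 -> \bar R).
  by move=> mf f0; split; [move=> p _; exact: timeint_ge0|exact: measurable_timeint].
have [d1 d2] := tm _ mcd cd0; have [f1 f2] := tm _ mcf cf0; have [s1 s2] := tm _ mcs cs0.
have iD := @ge0_integralD _ T2 R mu2 setT measurableT.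
have df0 (p : T2) : setT p -> (0 <= timeint (coned damping) T p + timeint (coned fill) T p)%E.
  by move=> pT; apply: adde_ge0; [exact: d1|exact: f1].
move: le1; rewrite (iD _ _ (fun p _ => e0 (char c T p)) mec df0 (emeasurable_funD d2 f2)).
rewrite (iD _ _ d1 d2 f1 f2) (iD _ _ (fun p _ => w00 p) mw0 s1 s2).
rewrite /timeint !tE// eE addeA.
set Fi := (\int[mu]_t \int[mu2]_p (_ * coned fill _)%:E)%E.
set So := (\int[mu]_t \int[mu2]_p (_ * coned source _)%:E)%E => le1.
have Fi0 : (0 <= Fi)%E.
  by apply: integral_ge0 => t _; apply: integral_ge0 => p _; rewrite lee_fin mulr_ge0// indicE ler0n.
have Fi_fin : Fi \is a fin_num by rewrite (ge0_fin_numE Fi0) /Fi; exact: fill_fin.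
have SF : (So <= Fi)%E.
  have mF3 f : measurable_fun setT (f : T3 -> R) ->
      measurable_fun setT (fun w : T1 * T2 => (\1_(`[0%R, T]%classic) w.1 * f w)%:E).
    move=> mf; apply/measurable_EFinP; apply: measurable_funM => //.
    exact: (measurableT_comp (measurable_indic _) (@measurable_fst _ _ T1 T2)).
  have F0' (f : T3 -> R) : (forall q, 0 <= f q) -> forall w : T1 * T2, (0 <= (\1_(`[0%R, T]%classic) w.1 * f w)%:E)%E.
    by move=> f0 w; rewrite lee_fin mulr_ge0// indicE ler0n.
  apply: ge0_le_integral => //.
  - by move=> t _; apply: integral_ge0 => p _; exact: (F0' _ cs0 (t, p)).
  - exact: (@measurable_fun_fubini_tonelli_F _ _ T1 T2 R plane _ (mF3 _ mcs) (F0' _ cs0)).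
  - exact: (@measurable_fun_fubini_tonelli_F _ _ T1 T2 R plane _ (mF3 _ mcf) (F0' _ cf0)).
  move=> t _; rewrite indicE; case: (_ \in _); last by under eq_integral do rewrite mul0r; under [leRHS]eq_integral do rewrite mul0r.
  under eq_integral do rewrite mul1r; under [leRHS]eq_integral do rewrite mul1r.
  exact: source_le_fill_plane.
exact: (cancel_fin le1 SF Fi_fin).
Qed.
End energy_plane.

(** * Choice of the exponential rate *)

Section spectral.
Context {R : realType}.
Notation mu := (@lebesgue_measure R).
Notation mu2 := (mu \x mu)%E.
Let T1 := measurableTypeR R.
Let T2 := (T1 * T1)%type.
Let T3 := (T1 * T2)%type.
Variables (m : R -> R) (Mx L r c : R).
Hypothesis pm : profile m Mx L.
Hypothesis r0 : 0 < r.

(** The conditions on the rate lam and on the uniform damping eta under which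
the energy inequality holds: the weight q = (1 + r) m / drift of Young's
inequality is finite and of mass at most 1. *)
Definition admissible lam eta :=
  [/\ 0 <= eta, {ae mu, forall v, 0 < m v -> 0 < 1 + lam * (c - v) - eta / 2},
   mu.-integrable setT (fun v => ((1 + r) * m v / drift c lam eta v)%:E) &
   \int[mu]_v ((1 + r) * m v / drift c lam eta v) <= 1].

Lemma ae_neq (a : R) : {ae mu, forall v, v != a}.
Proof.
exists [set a]; split; [exact: measurable_set1|exact: lebesgue_measure_set1|].
by move=> v /= /negP; rewrite negbK => /eqP.
Qed.

Let r1 : 0 < 1 + r. Proof. by rewrite addr_gt0. Qed.

Lemma measurable_ratio lam eta :
  measurable_fun setT (fun v => (1 + r) * m v / drift c lam eta v).
Proof.
apply: measurable_funM; first by apply: measurable_funM => //; exact: pf_meas pm.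
apply: measurable_inv; first exact: measurable_drift.
by move=> v; exact: drift_ge0.
Qed.

Lemma ratio_ge0 lam eta v : 0 <= (1 + r) * m v / drift c lam eta v.
Proof. by rewrite mulr_ge0 ?invr_ge0 ?drift_ge0// mulr_ge0 ?(pf_ge0 pm)// ltW. Qed.

Lemma ratio_admissible lam eta :
  (\int[mu]_v ((1 + r) * m v / drift c lam eta v)%:E <= 1)%E ->
  mu.-integrable setT (fun v => ((1 + r) * m v / drift c lam eta v)%:E) /\
  \int[mu]_v ((1 + r) * m v / drift c lam eta v) <= 1.
Proof.
move=> le1; have i0 : (0 <= \int[mu]_v ((1 + r) * m v / drift c lam eta v)%:E)%E.
  by apply: integral_ge0 => v _; rewrite lee_fin ratio_ge0.
split.
  apply/integrableP; split; first by apply/measurable_EFinP; exact: measurable_ratio.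
  under eq_integral do rewrite gee0_abs ?lee_fin ?ratio_ge0//.
  by rewrite (le_lt_trans le1)// ltry.
rewrite /Rintegral -lee_fin fineK//.
by rewrite ge0_fin_numE// (le_lt_trans le1)// ltry.
Qed.

(** For almost every v with m v > 0 one has v < c, so that
(1 + r) m / (1 / 2 + lam (c - v)) tends to 0 as lam grows. *)
Lemma admissible_no_fast : {ae mu, forall v, c < v -> m v = 0} -> exists lam, admissible lam 1.
Proof.
move=> m0.
pose q (n : nat) v := \1_(`]-oo, c[%classic) v * ((1 + r) * m v / (2^-1 + n%:R * Num.max (c - v) 0)).
have d0 (n : nat) v : 2^-1 <= 2^-1 + n%:R * Num.max (c - v) 0 :> R.
  by rewrite lerDl mulr_ge0// le_max lexx orbT.
have d1 (n : nat) v : 0 < 2^-1 + n%:R * Num.max (c - v) 0 :> R by rewrite (lt_le_trans _ (d0 n v)).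
have mq n : measurable_fun setT (q n).
  apply: measurable_funM; first exact: measurable_indic.
  apply: measurable_funM; first by apply: measurable_funM => //; exact: pf_meas pm.
  apply: measurable_inv => [|v]; last exact: ltW.
  apply: measurable_funD => //; apply: measurable_funM => //; apply: measurable_maxr => //.
  exact: measurable_funB.
have cv : (\int[mu]_v (q n v)%:E @[n --> \oo] --> \int[mu]_v (0 : R)%:E)%E.
  apply: (@dominated_cvg _ T1 R mu setT measurableT _ _ (fun v => (2 * (1 + r) * m v)%:E)) => //.
  - by move=> n; apply/measurable_EFinP; exact: mq.
  - move=> v _; apply: cvg_EFin; first exact: nearW.
    rewrite /q indicE; case: (boolP (v \in _)) => [|_]; last first.
      by apply: cvg_near_cst; apply: nearW => n; rewrite /= mul0r.
    rewrite inE/= in_itv/= => vc.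
    have cv0 : 0 < c - v by rewrite subr_gt0.
    rewrite [X in X @ _ --> _](_ : _ = (fun n : nat => (1 + r) * m v * (2^-1 + n%:R * (c - v))^-1)); last first.
      by apply/funext => n; rewrite /= mul1r (max_idPl _)// ltW.
    rewrite -[X in _ --> X](mulr0 ((1 + r) * m v)); apply: cvgMl_tmp.
    apply/gtr0_cvgV0.
      by apply: nearW => n; rewrite ltr_pwDl// mulr_ge0// ltW.
    apply/cvgryPge => A.
    have : \forall n \near \oo, A / (c - v) <= n%:R by exact: nbhs_infty_ger.
    apply: filterS => n; rewrite ler_pdivrMr// => h; rewrite (le_trans h)// lerDr.
    by rewrite invr_ge0.
  - exact: (@integrableZl _ T1 R mu setT measurableT (2 * (1 + r)) _ (pf_int pm)).
  - move=> n v _; rewrite lee_fin /q indicE.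
    have mv := pf_ge0 pm v.
    have b : (1 + r) * m v / (2^-1 + n%:R * Num.max (c - v) 0) <= 2 * (1 + r) * m v.
      rewrite ler_pdivrMr//; have := d0 n v; set x := _ + _ => x2.
      have := mulr_ge0 (ltW r1) mv; nra.
    have b0 : 0 <= (1 + r) * m v / (2^-1 + n%:R * Num.max (c - v) 0).
      by rewrite divr_ge0 ?(ltW (d1 _ _))// mulr_ge0// ltW.
    by case: (_ \in _); rewrite ?mul1r ?mul0r ?normr0 ?ger0_norm// mulr_ge0// mulr_ge0// ltW.
have : \forall n \near \oo, (\int[mu]_v (q n v)%:E <= 1)%E.
  rewrite integral0 in cv.
  have H : \forall n \near \oo, (\int[mu]_v (q n v)%:E < 1)%E := cv _ (@open_ereal_lt' R 0%E 1%E lte01).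
  by apply: filterS H => n; exact: ltW.
case=> N _ /(_ N (leqnn N)) le1.
have ae0 := ae_mp2 m0 (ae_neq c) (fun v a b => conj a b).
exists N%:R.
have le1' : (\int[mu]_v ((1 + r) * m v / drift c N%:R 1 v)%:E <= 1)%E.
  apply: le_trans le1; apply: ae_ge0_le_integral => //.
  - by move=> v _; rewrite lee_fin ratio_ge0.
  - by apply/measurable_EFinP; exact: measurable_ratio.
  - move=> v _; rewrite lee_fin /q mulr_ge0 ?indicE//.
    by rewrite divr_ge0 ?(ltW (d1 _ _))// mulr_ge0 ?(pf_ge0 pm)// ltW.
  - by apply/measurable_EFinP; exact: mq.
  apply: (ae_mp ae0) => v [mv vc] _; rewrite lee_fin.
  case: (ltgtP v c) vc => // [vc _|/mv mv0 _]; last by rewrite /q mv0 !(mulr0, mul0r).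
  rewrite /q indicE mem_set ?mul1r; last by rewrite /= in_itv/=.
  have cv0 : 0 <= c - v by rewrite subr_ge0 ltW.
  rewrite (max_idPl cv0) /drift (_ : 1 + N%:R * (c - v) - 1 / 2 = 2^-1 + N%:R * (c - v)); last by field.
  by rewrite (max_idPl _)// addr_ge0// mulr_ge0.
have [h1 h2] := ratio_admissible le1'; split => //.
apply: (ae_mp ae0) => v [mv vc] mp; have {}vc : v < c.
  by case: (ltgtP v c) vc => // /mv mv0; rewrite mv0 ltxx in mp.
have : 0 <= N%:R * (c - v) :> R by rewrite mulr_ge0// subr_ge0 ltW.
set x := _ * _; lra.
Qed.

(** At the minimal speed the mass of (1 + r) M / (1 + lam (cstar - v)) is 1;
replacing cstar by the larger c only increases the denominator.  The bound on
lam makes the denominator nonnegative, and it vanishes at most at vmax V. *)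
Lemma admissible_dispersion (V : set R) (M : R -> R) (cstar : R) :
  velocity_data V M -> m = M \_ V -> dispersion V M r cstar -> cstar <= c ->
  cstar < vmax V -> exists lam, admissible lam 0.
Proof.
move=> vd mE [lam [/andP[l0 l1] disp]] cc cv; exists lam.
have hsup : has_sup V.
  split; first exact: V_neq0 vd.
  by have [K VK] := V_bounded vd; exists K => v /VK; rewrite /= in_itv/= => /andP[].
(* Hence 1 + lam (cstar - v) >= 1 - lam (vmax V - cstar) >= 0 on V. *)
have lv : lam * (vmax V - cstar) <= 1.
  by rewrite -ler_pdivlMr ?subr_gt0// mul1r.
have pos : {ae mu, forall v, V v -> 0 < 1 + lam * (cstar - v)}.
  apply: (ae_mp (ae_neq (vmax V))) => w wne Vw.
  have wV : 0 < vmax V - w by rewrite subr_gt0 lt_neqAle wne/= (sup_upper_bound hsup).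
  have := mulr_gt0 l0 wV; have e : lam * (cstar - w) = lam * (vmax V - w) - lam * (vmax V - cstar) by ring.
  by rewrite e => ?; lra.
have posc v : 0 < 1 + lam * (cstar - v) -> 1 + lam * (cstar - v) <= 1 + lam * (c - v) - 0 / 2.
  by move=> _; rewrite mul0r subr0 lerD2l ler_wpM2l ?(ltW l0)// lerD2r.
have mV v : 0 < m v -> V v.
  by rewrite mE patchE; case: ifP => [/set_mem//|]; rewrite ltxx.
have le1 : (\int[mu]_v ((1 + r) * m v / drift c lam 0 v)%:E <= 1)%E.
  have -> : (1 = \int[mu]_v ((1 + r) * m v / drift cstar lam 0 v)%:E :> \bar R)%E.
    have PE : (fun v => (M v / (1 + lam * (cstar - v)))%:E) \_ V =
        (fun v => (m v / drift cstar lam 0 v)%:E).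
      apply/funext => v; rewrite patchE mE patchE; case: ifPn => [/set_mem Vv|_]; last by rewrite mul0r.
      rewrite /drift mul0r subr0 (max_idPl _)//.
      have vV : 0 <= vmax V - v by rewrite subr_ge0 (sup_upper_bound hsup).
      have := mulr_ge0 (ltW l0) vV.
      have e : lam * (cstar - v) = lam * (vmax V - v) - lam * (vmax V - cstar) by ring.
      by rewrite e => ?; lra.
    rewrite -disp integral_mkcond PE -ge0_integralZl//.
    - by apply: eq_integral => v _; rewrite -EFinM mulrA.
    - apply/measurable_EFinP; apply: measurable_funM; first exact: pf_meas pm.
      by apply: measurable_inv => [|v]; [exact: measurable_drift|exact: drift_ge0].
    - by move=> v _; rewrite lee_fin mulr_ge0 ?invr_ge0 ?drift_ge0// (pf_ge0 pm).
    - by rewrite lee_fin ltW.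
  apply: ae_ge0_le_integral => //.
  - by move=> v _; rewrite lee_fin ratio_ge0.
  - by apply/measurable_EFinP; exact: measurable_ratio.
  - move=> v _; rewrite lee_fin mulr_ge0 ?invr_ge0 ?drift_ge0// mulr_ge0 ?(pf_ge0 pm)//; exact: ltW.
  - apply/measurable_EFinP; apply: measurable_funM.
      by apply: measurable_funM => //; exact: pf_meas pm.
    by apply: measurable_inv => [|v]; [exact: measurable_drift|exact: drift_ge0].
  apply: (ae_mp pos) => v pv _; rewrite lee_fin.
  have [->|mv0] := eqVneq (m v) 0; first by rewrite mulr0 !mul0r.
  have mv : 0 < m v by rewrite lt0r mv0 (pf_ge0 pm).
  have p := pv (mV _ mv); have dle := posc _ p.
  apply: ler_wpM2l; first by rewrite mulr_ge0 ?(ltW r1)// ltW.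
  have d0 : 0 < drift cstar lam 0 v by rewrite lt_max mul0r subr0 p.
  have dd : drift cstar lam 0 v <= drift c lam 0 v.
    by rewrite /drift !mul0r !subr0 ge_max !le_max lexx orbT andbT -[X in _ <= X]subr0 -(mul0r 2^-1) dle.
  by rewrite lef_pV2 ?posrE// (lt_le_trans d0).
have [h1 h2] := ratio_admissible le1; split => //.
apply: (ae_mp pos) => v pv /mV/pv p; exact: lt_le_trans p (posc _ p).
Qed.

Variable F0 : R * R -> R.
Hypothesis mF0 : measurable_fun setT (F0 : T2 -> R).
Let F (q : R * (R * R)) := F0 q.2.
Hypothesis fF : field m F.
Hypothesis mF : mild m r c F0 F.
Hypothesis F_left : forall v, F0 (z, v) @[z --> -oo] --> m v.

Let F0m p : 0 <= F0 p <= m p.2. Proof. exact: (fF.2 (0, p)). Qed.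

(** The reaction term of a field is at least - (1 + r) times the field itself. *)
Let decay T : 0 <= T -> {ae mu2, forall p,
  F0 p * expR (- ((1 + r) * T)) <= F0 (char c T p)}.
Proof.
move=> T0; apply: (ae_mp2 (rep_ae pm mF0 fF mF) (mF T0)) => p aF FT.
rewrite -[F0 (char c T p)]/(F (T, char c T p)) FT.
set a := along c (Rg m r F) p; rewrite -[Rintegral _ _ _]/(prim a T).
have ma : measurable_fun setT a := measurable_along c p (measurable_Rg pm r fF).
have la : lbdd a.
  by apply: (lbdd_bnd ma) => s; exact: (along_Rg_bound c pm r0 p s fF).
have le_ : lbdd (fun s => (1 + r) * expR ((1 + r) * s)).
  by apply: lbddM; [exact: lbdd_cst|exact: lbdd_expR].
have lpa : lbdd (fun s => F0 p + prim a s) by apply: lbddD; [exact: lbdd_cst|exact: lbdd_prim].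
have lpe : lbdd (fun s => 1 + prim (fun s => (1 + r) * expR ((1 + r) * s)) s).
  by apply: lbddD; [exact: lbdd_cst|exact: lbdd_prim].
have H : F0 p <= (F0 p + prim a T) * expR ((1 + r) * T).
  have -> : expR ((1 + r) * T) = 1 + prim (fun s => (1 + r) * expR ((1 + r) * s)) T.
    by rewrite prim_expR//; ring.
  rewrite primM_lb// mulr1 lerDl.
  have -> : 0 = prim (fun=> 0 : R) T by rewrite /prim /Rintegral integral0.
  apply: prim_le_lb; [exact: lbdd_cst|by apply: lbddD; exact: lbddM|].
  apply: (ae_mp aF) => s aFs /andP[s0 sT]; rewrite prim_expR//.
  have := aFs s0; rewrite /rep -/a => <-.
  have -> : a s * (1 + (expR ((1 + r) * s) - 1)) + (1 + r) * expR ((1 + r) * s) * along c F p s =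
    expR ((1 + r) * s) * (a s + (1 + r) * along c F p s) by ring.
  rewrite mulr_ge0 ?expR_ge0// /a /along /Rg /reac/= -/(rhoG F s (char c s p).1).
  have /andP[rf0 rf1] := rhoG_bound pm s (char c s p).1 fF.
  rewrite /F/=; have /andP[f0 f1] := F0m (char c s p).
  rewrite /char/= in f1 rf0 rf1 f0 *.
  set x := rhoG _ _ _ in rf0 rf1 *; set f := F0 _ in f0 f1 *; set mv := m _ in f1 *.
  have -> : mv * x - f + r * x * (mv - f) + (1 + r) * f = mv * x + r * (x * (mv - f) + f) by ring.
  have mv0 : 0 <= mv := le_trans f0 f1.
  by rewrite addr_ge0 ?mulr_ge0// ?(ltW r0)// addr_ge0// mulr_ge0// subr_ge0.
by rewrite expRN ler_pdivrMr ?expR_gt0.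
Qed.

(** Particles faster than c found at z were at z - (v - c) n a time n earlier,
with at most the loss e^{- (1 + r) n}.  If rho_f were not bounded below, a
sequence z_n < z0 with rho_f (z_n) < e^{- (1 + r) n} / (n + 1) would exist; as
z_n - (v - c) n tends to - oo, dominated convergence would give no mass to the
velocities above c. *)
Lemma wave_lower_bound (z0 : R) : ~ {ae mu, forall v, c < v -> m v = 0} ->
  exists rho0, 0 < rho0 /\ {ae mu, forall z, z < z0 -> rho0 <= rhoG F 0 z}.
Proof.
move=> fast; apply: contrapT => none; apply: fast.
pose chi v : R := \1_(`]c, +oo[%classic) v.
have mchi : measurable_fun setT chi by exact: measurable_indic.
(* Dividing by n + 1 leaves a null sequence after the loss e^{- (1 + r) n}. *)
pose eps (n : nat) := expR (- ((1 + r) * n%:R)) / n.+1%:R.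
have eps0 n : 0 < eps n by rewrite divr_gt0 ?expR_gt0.
have pick n : exists z, z < z0 /\ \int[mu]_v (chi v * F0 (z - (v - c) * n%:R, v)) <= n.+1%:R^-1.
  have mc : measurable_fun setT (fun v : R => - ((v - c) * n%:R)).
    by apply: measurableT_comp => //; apply: measurable_funM => //; exact: measurable_funB.
  have := ae_shear mc (decay (ler0n R n)) => /(@ae_prod_split _ _ T1 T1 R mu mu) dec.
  apply: contrapT => nz; apply: none; exists (eps n); split => //.
  apply: (ae_mp dec) => z decz zz0; rewrite leNgt; apply/negP => small; apply: nz; exists z; split => //.
  have iF : mu.-integrable setT (EFin \o (fun v => F0 (z, v))).
    apply: (pf_bdd pm); first exact: (@measurable_slice R F 0 z fF.1).
    by move=> v; have /andP[? ?] := F0m (z, v); rewrite ger0_norm.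
  have mS : measurable_fun setT (fun v : T1 => F0 (z - (v - c) * n%:R, v)).
    have mq : measurable_fun setT (fun v : T1 => (z - (v - c) * n%:R, v) : T2).
      by apply: measurable_fun_pair => //; exact: measurable_funD.
    exact: (measurableT_comp mF0 mq).
  have iS : mu.-integrable setT (EFin \o (fun v => chi v * F0 (z - (v - c) * n%:R, v))).
    apply: (pf_bdd pm); first exact: measurable_funM.
    move=> v; have /andP[? ?] := F0m (z - (v - c) * n%:R, v).
    by rewrite ger0_norm ?mulr_ge0// /chi indicE; case: (_ \in _); rewrite ?mul1r ?mul0r ?(pf_ge0 pm).
  have ieS := @integrableZl _ T1 R mu setT measurableT (expR (- ((1 + r) * n%:R))) _ iS.
  have le : expR (- ((1 + r) * n%:R)) * \int[mu]_v (chi v * F0 (z - (v - c) * n%:R, v)) <= rhoG F 0 z.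
    rewrite -RintegralZl//; apply: le_Rint_ae => //.
    apply: (ae_mp decz) => v; rewrite /shear /char/= subrK => h.
    rewrite /chi indicE; case: (_ \in _); last by rewrite mul0r mulr0; have /andP[] := F0m (z, v).
    by rewrite mul1r mulrC.
  rewrite -(ler_pM2l (expR_gt0 (- ((1 + r) * n%:R)))) (le_trans le)//; exact: ltW.
have [zs zsP] := choice pick.
pose a n v := chi v * F0 (zs n - (v - c) * n%:R, v).
have chi0 v : 0 <= chi v by rewrite /chi indicE ler0n.
have chi1 v : chi v <= 1 by rewrite /chi indicE lern1 leq_b1.
have ma n : measurable_fun setT (a n).
  apply: measurable_funM => //.
  have mq : measurable_fun setT (fun v : T1 => (zs n - (v - c) * n%:R, v) : T2).
    apply: measurable_fun_pair => //; apply: measurable_funB => //; apply: measurable_funM => //.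
    exact: measurable_funB.
  exact: (measurableT_comp mF0 mq).
have am n v : 0 <= a n v <= m v.
  have /andP[f0 f1] := F0m (zs n - (v - c) * n%:R, v).
  by rewrite mulr_ge0//= (le_trans _ f1)// ler_piMl.
have ia n : mu.-integrable setT (EFin \o a n).
  by apply: (pf_bdd pm) => // v; have /andP[? ?] := am n v; rewrite ger0_norm.
have cv : (\int[mu]_v (a n v)%:E @[n --> \oo] --> \int[mu]_v (chi v * m v)%:E)%E.
  apply: (@dominated_cvg _ T1 R mu setT measurableT (fun n v => (a n v)%:E) _ (EFin \o m)) => //.
  - by move=> n; apply/measurable_EFinP; exact: ma.
  - move=> v _; apply: cvg_EFin; first exact: nearW.
    rewrite /a /chi indicE; case: (boolP (v \in _)) => [|_]; last first.
      by rewrite mul0r; apply: cvg_near_cst; apply: nearW => n; rewrite /= mul0r.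
    rewrite inE/= in_itv/= andbT => vc.
    rewrite mul1r [X in X @ _ --> _](_ : _ = (fun n : nat => F0 (zs n - (v - c) * n%:R, v))); last first.
      by apply/funext => n; rewrite /= mul1r.
    have vc0 : 0 < v - c by rewrite subr_gt0.
    have zn : (zs n - (v - c) * n%:R) @[n --> \oo] --> -oo.
      apply/cvgrNyPle => A.
      have : \forall n \near \oo, (z0 - A) / (v - c) <= n%:R by exact: nbhs_infty_ger.
      apply: filterS => n; rewrite ler_pdivrMr// => h.
      by have [zn _] := zsP n; lra.
    exact: (cvg_comp _ _ zn (@F_left v)).
  - exact: pf_int pm.
  - by move=> n v _; rewrite lee_fin; have /andP[? ?] := am n v; rewrite ger0_norm.
have ae0 : {ae mu, forall v, (chi v * m v)%:E = 0%E}.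
  apply/integral0_ae.
  - by apply/measurable_EFinP; apply: measurable_funM => //; exact: pf_meas pm.
  - by move=> v; rewrite lee_fin mulr_ge0// (pf_ge0 pm).
  apply/eqP; rewrite eq_le; apply/andP; split; last first.
    by apply: integral_ge0 => v _; rewrite lee_fin mulr_ge0// (pf_ge0 pm).
  have icm : mu.-integrable setT (EFin \o (fun v => chi v * m v)).
    apply: (pf_bdd pm); first by apply: measurable_funM => //; exact: pf_meas pm.
    by move=> v; rewrite ger0_norm ?mulr_ge0 ?(pf_ge0 pm)// ler_piMl ?(pf_ge0 pm).
  have Efin f : mu.-integrable setT (EFin \o f) -> (\int[mu]_v (f v)%:E = (\int[mu]_v f v)%:E)%E.
    by move=> fi; rewrite /Rintegral fineK//; exact: (@integrable_fin_num _ T1 R mu).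
  rewrite Efin// in cv *; rewrite lee_fin.
  have cv' : \int[mu]_v a n v @[n --> \oo] --> \int[mu]_v (chi v * m v).
    by have /fine_cvg := cv; apply: cvg_trans; apply: near_eq_cvg; apply: nearW => n; rewrite /= Efin.
  apply: (ler_cvg_to cv' (@cvg_harmonic R)); apply: nearW => n.
  by have [_] := zsP n.
apply: (ae_mp ae0) => v [] + vc; rewrite /chi indicE mem_set ?mul1r//.
by rewrite /= in_itv/= vc.
Qed.
End spectral.

(** * Removing the cone *)

Lemma ge0_integral_exhaust d (T : measurableType d) (R : realType) (mu : {measure set T -> \bar R})
    (f : T -> R) (chi : nat -> T -> R) (C : \bar R) :
  measurable_fun setT f -> (forall x, 0 <= f x) ->
  (forall n, measurable_fun setT (chi n)) -> (forall n x, 0 <= chi n x) ->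
  (forall x, {homo chi ^~ x : n k / (n <= k)%N >-> n <= k}) ->
  (forall x, 0 < f x -> chi n x @[n --> \oo] --> (1 : R)) ->
  (forall n, \int[mu]_x (chi n x * f x)%:E <= C)%E -> (\int[mu]_x (f x)%:E <= C)%E.
Proof.
move=> mf f0 mchi chi0 nd chi1 le.
have H := @cvg_monotone_convergence _ T R mu setT measurableT (fun n x => (chi n x * f x)%:E).
have {}H : (\int[mu]_x (chi n x * f x)%:E @[n --> \oo] --> \int[mu]_x (f x)%:E)%E.
  have -> : (\int[mu]_x (f x)%:E = \int[mu]_x limn (fun n => (chi n x * f x)%:E))%E.
    apply: eq_integral => x _; apply/esym/cvg_lim => //; apply: cvg_EFin; first exact: nearW.
    have [fx0|fx] := ltP 0 (f x).
      rewrite -[X in _ --> X]mul1r; apply: cvgMr_tmp; exact: chi1.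
    have -> : f x = 0 by apply/eqP; rewrite eq_le fx f0.
    by apply: cvg_near_cst; apply: nearW => n; rewrite /= mulr0.
  apply: H.
  - by move=> n; apply/measurable_EFinP; exact: measurable_funM.
  - by move=> n x _; rewrite lee_fin mulr_ge0.
  - by move=> x _ n k nk; rewrite lee_fin ler_wpM2r// nd.
rewrite -(cvg_lim _ H)//; apply: lime_le; first by apply/cvg_ex; exists (\int[mu]_x (f x)%:E)%E.
exact: nearW.
Qed.

Lemma le_poweR_half (R : realType) (x y : \bar R) : (0 <= x -> x <= y -> x `^ 2^-1 <= y `^ 2^-1)%E.
Proof.
move=> x0 xy; apply: gt0_ler_poweR => //.
- by rewrite in_itv/= x0 leey.
- by rewrite in_itv/= (le_trans x0 xy) leey.
Qed.

Lemma poweR_half_lty (R : realType) (x : \bar R) : (x `^ 2^-1 < +oo -> x < +oo)%E.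
Proof.
case: x => [x _|+|//]; first by rewrite ltry.
by rewrite poweRyr ?ltxx// invr_neq0// pnatr_eq0.
Qed.

Section conclusion.
Context {R : realType}.
Notation mu := (@lebesgue_measure R).
Notation mu2 := (mu \x mu)%E.
Let T1 := measurableTypeR R.
Let T2 := (T1 * T1)%type.
Let T3 := (T1 * T2)%type.
Variables (m : R -> R) (Mx L r c lam eta gamma : R).
Hypothesis pm : profile m Mx L.
Hypothesis L0 : 0 < L.
Hypothesis r0 : 0 < r.
Hypothesis adm : admissible m r c lam eta.
Hypothesis gamma12 : 2^-1 < gamma <= 1.
Variables (h0 F0 : R * R -> R) (G : R * (R * R) -> R).
Hypothesis mh0 : measurable_fun setT (h0 : T2 -> R).
Hypothesis mF0 : measurable_fun setT (F0 : T2 -> R).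
Let F (q : R * (R * R)) := F0 q.2.
Hypothesis fG : field m G.
Hypothesis fF : field m F.
Hypothesis mG : mild m r c h0 G.
Hypothesis mF : mild m r c F0 F.
Hypothesis h0F0 : forall p, gamma * F0 p <= h0 p.

Notation W := (weight m r lam F0).
Notation damp := (damping m r gamma lam eta F0 G).
Let E0 : \bar R := (\int[mu2]_p (W p * (h0 p - F0 p) ^+ 2)%:E)%E.

Let energy n T : 0 <= T ->
  (\int[mu2]_p (in_cone L c n%:R (T, p) * (W p * (G (T, p) - F0 p) ^+ 2))%:E +
   \int[mu]_t \int[mu2]_p (\1_(`[0%R, T]%classic) t * coned L c n%:R damp (t, p))%:E <= E0)%E.
Proof.
have [e0 d0 qi q1] := adm => T0.
exact: (energy_cone n%:R pm r0 gamma12 e0 d0 mh0 mF0 fG fF mG mF h0F0 qi q1 L0 T0).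
Qed.

Let mW : measurable_fun setT (W : T2 -> R) := measurable_weight lam pm r0 mF0 fF.
Let W0 p : 0 <= W p := weight_ge0 lam pm r0 fF p.
Let eta0 : 0 <= eta. Proof. by have [] := adm. Qed.
Let damp0 q : 0 <= damp q := damping_ge0 lam pm r0 gamma12 eta0 G fF q.
Let mdamp : measurable_fun setT (damp : T3 -> R) := measurable_damping gamma lam eta pm r0 mF0 fG fF.

Let mu2T T : measurable_fun setT (fun p : T2 => W p * (G (T, p) - F0 p) ^+ 2).
Proof.
apply: measurable_funM => //; apply: measurable_funX; apply: measurable_funB => //.
exact: (measurableT_comp fG.1 (pair1_measurable T)).
Qed.

Let cone_homo q : {homo (fun n : nat => in_cone L c n%:R q) : n k / (n <= k)%N >-> n <= k}.
Proof.
move=> n k nk; rewrite /in_cone ler_nat; case: (leP _ n%:R) => // h.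
by rewrite (le_trans h) ?ler_nat.
Qed.

Let cone_cvg q : in_cone L c n%:R q @[n --> \oo] --> (1 : R).
Proof.
apply: cvg_near_cst.
have : \forall n \near \oo, `|q.2.1| + (L + `|c| + 1) * q.1 <= n%:R by exact: nbhs_infty_ger.
by apply: filterS => n h; rewrite /in_cone h.
Qed.

Lemma energy_bound T : 0 <= T ->
  (\int[mu2]_p (W p * (G (T, p) - F0 p) ^+ 2)%:E <= E0)%E.
Proof.
move=> T0; apply: (@ge0_integral_exhaust _ T2 R mu2 _ (fun n p => in_cone L c n%:R (T, p))) => //.
- by move=> p; rewrite mulr_ge0 ?sqr_ge0.
- move=> n; exact: (measurableT_comp (measurable_in_cone L c n%:R) (pair1_measurable T)).
- move=> n; apply: le_trans (energy n T0); apply: leeDl.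
  by apply: integral_ge0 => t _; apply: integral_ge0 => p _; rewrite lee_fin mulr_ge0 ?indicE ?ler0n// mulr_ge0 ?in_cone_ge0.
Qed.

Let pos_time (t : R) : R := \1_(`[0%R, +oo[%classic) t.

Let mpos_time : measurable_fun setT (fun w : T1 * T2 => pos_time w.1).
Proof. exact: (measurableT_comp (measurable_indic _) (@measurable_fst _ _ T1 T2)). Qed.

Let pos_time0 t : 0 <= pos_time t. Proof. by rewrite /pos_time indicE ler0n. Qed.

(** The cones of radius n restricted to times at most n fill the half-space of
nonnegative times. *)
Lemma damping_bound : (\int[(mu \x plane)%E]_w (pos_time w.1 * damp w)%:E <= E0)%E.
Proof.
pose chi n (w : T1 * T2) : R := \1_(`[0%R, n%:R]%classic) w.1 * in_cone L c n%:R w.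
have mchi n : measurable_fun setT (chi n).
  apply: measurable_funM; last exact: measurable_in_cone.
  exact: (measurableT_comp (measurable_indic _) (@measurable_fst _ _ T1 T2)).
have i01 (A : set R) t : 0 <= (\1_A t : R) <= 1 by rewrite indicE ler0n lern1 leq_b1.
have chi0 n w : 0 <= chi n w.
  by rewrite mulr_ge0 ?in_cone_ge0//; have /andP[] := i01 `[0%R, n%:R]%classic w.1.
have mf : measurable_fun setT (fun w : T1 * T2 => pos_time w.1 * damp w) by exact: measurable_funM.
have f0 (w : T1 * T2) : 0 <= pos_time w.1 * damp w by rewrite mulr_ge0.
apply: (@ge0_integral_exhaust _ (T1 * T2)%type R (mu \x plane)%E _ chi) => //.
- move=> w n k nk; apply: ler_pM; [|exact: in_cone_ge0| |exact: cone_homo].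
    by have /andP[] := i01 `[0%R, n%:R]%classic w.1.
  rewrite !indicE ler_nat; case: (boolP (_ \in `[0%R, n%:R]%classic)) => //.
  rewrite inE/= in_itv/= => /andP[w0 wn]; rewrite mem_set//= in_itv/= w0 (le_trans wn)//.
  by rewrite ler_nat.
- move=> w fw; rewrite -[X in _ --> X]mulr1; apply: cvgM; last exact: cone_cvg.
  have w0 : 0 <= w.1.
    move: fw; rewrite /pos_time indicE; case: (boolP (_ \in _)); last by rewrite mul0r ltxx.
    by rewrite inE/= in_itv/= andbT.
  apply: cvg_near_cst.
  have : \forall n \near \oo, w.1 <= n%:R by exact: nbhs_infty_ger.
  by apply: filterS => n h; rewrite indicE mem_set//= in_itv/= w0.
- move=> n.
  have mk : measurable_fun setT (fun w : T1 * T2 => (chi n w * (pos_time w.1 * damp w))%:E).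
    by apply/measurable_EFinP; exact: measurable_funM.
  have k0 (w : T1 * T2) : (0 <= (chi n w * (pos_time w.1 * damp w))%:E)%E by rewrite lee_fin mulr_ge0.
  rewrite (@fubini_tonelli1 _ _ T1 T2 R mu plane _ mk k0).
  apply: le_trans (energy n (ler0n _ n)).
  rewrite [X in (X <= _)%E](_ : _ =
     \int[mu]_t \int[mu2]_p (\1_(`[0%R, n%:R]%classic) t * coned L c n%:R damp (t, p))%:E)%E.
    by apply: leeDr; apply: integral_ge0 => p _; rewrite lee_fin mulr_ge0 ?in_cone_ge0// mulr_ge0 ?sqr_ge0.
  apply: eq_integral => t _; rewrite /fubini_F; apply: eq_integral => p _; congr EFin.
  rewrite /chi /coned /pos_time /=; rewrite !indicE.
  case: (boolP (t \in `[0%R, n%:R]%classic)) => [|_]; last by rewrite !mul0r.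
  by rewrite inE/= in_itv/= => /andP[t0 _]; rewrite mem_set/= ?in_itv/= ?t0// !mul1r.
Qed.

Lemma localized_bound (kap : R -> R) (K : R) : measurable_fun setT kap -> (forall z, 0 <= kap z) ->
  0 <= K -> {ae mu, forall z, kap z <= K * rate r gamma eta F0 z} ->
  (\int[mu]_t \int[mu2]_p (pos_time t * (kap p.1 * (W p * (G (t, p) - F0 p) ^+ 2)))%:E <= K%:E * E0)%E.
Proof.
move=> mkap kap0 K0 kapK.
pose k (w : T1 * T2) := pos_time w.1 * (kap w.2.1 * (W w.2 * (G w - F0 w.2) ^+ 2)).
have mk : measurable_fun setT (EFin \o k).
  apply/measurable_EFinP; apply: measurable_funM => //.
  have ms := @measurable_snd _ _ T1 T2.
  apply: measurable_funM; first exact: (measurableT_comp mkap (measurableT_comp (@measurable_fst _ _ T1 T1) ms)).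
  apply: measurable_funM; first exact: (measurableT_comp mW ms).
  by apply: measurable_funX; apply: measurable_funB; [exact: fG.1|exact: (measurableT_comp mF0 ms)].
have k0 w : (0 <= (EFin \o k) w)%E.
  by rewrite lee_fin mulr_ge0// mulr_ge0// mulr_ge0 ?sqr_ge0.
rewrite -[X in (X <= _)%E](@fubini_tonelli1 _ _ T1 T2 R mu plane _ mk k0).
apply: (@le_trans _ _ (K%:E * \int[(mu \x plane)%E]_w (pos_time w.1 * damp w)%:E)%E); last first.
  by apply: lee_wpmul2l; [rewrite lee_fin|exact: damping_bound].
have mpd : measurable_fun setT (fun w : T1 * T2 => (pos_time w.1 * damp w)%:E).
  by apply/measurable_EFinP; exact: measurable_funM.
rewrite -ge0_integralZl//; last by move=> w _; rewrite lee_fin mulr_ge0.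
apply: ae_ge0_le_integral => //.
- by move=> w _; rewrite -EFinM lee_fin mulr_ge0// mulr_ge0.
- by apply/measurable_EFinP; apply: measurable_funM => //; exact: measurable_funM.
have := @ae_prod_snd _ _ T1 T2 R mu plane _ (@ae_prod_fst _ _ T1 T1 R mu mu _ kapK) => aeK.
apply: (ae_mp aeK) => w kw _; rewrite -EFinM lee_fin /k [X in _ <= X]mulrCA; apply: ler_wpM2l => //.
by rewrite /damping [X in _ <= X]mulrA; apply: ler_wpM2r => //; rewrite mulr_ge0 ?sqr_ge0.
Qed.
End conclusion.

(** * The stability theorem *)

Section weighted_norm.
Context {R : realType}.
Notation mu := (@lebesgue_measure R).
Notation mu2 := (mu \x mu)%E.
Let T1 := measurableTypeR R.
Let T2 := (T1 * T1)%type.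
Variables (V : set R) (M : R -> R) (r c : R) (f : R * R -> R).
Hypothesis vd : velocity_data V M.
Hypothesis r0 : 0 < r.
Hypothesis tw : travelling_wave V M r c f.
Notation m := (M \_ V).
Notation F0 := (ftot V f).

(** The exponential of -2 times this function is the weight of the energy
estimates, wherever M does not vanish (expR_log_weight). *)
Definition log_weight lam (p : R * R) : R := - lam * p.1 + ln ((1 + r) * m p.2 - r * F0 p) / 2.

Let A0 p : m p.2 != 0 -> 0 < (1 + r) * m p.2 - r * F0 p.
Proof.
have /andP[f0 f1] := ftot_bound tw p; move=> m0.
have mp : 0 < m p.2 by rewrite lt0r m0 (le_trans f0 f1).
rewrite (_ : _ - _ = m p.2 + r * (m p.2 - F0 p)); last by ring.
by rewrite ltr_pwDl// mulr_ge0 ?(ltW r0)// subr_ge0.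
Qed.

Lemma measurable_log_weight lam : measurable_fun setT (log_weight lam : T2 -> R).
Proof.
have [Mx [L [L0 [VL pm]]]] := profileM vd.
apply: measurable_funD.
  by apply: measurable_funM => //; exact: (@measurable_fst _ _ T1 T1).
apply: measurable_funM => //; apply: measurableT_comp; first exact: measurable_ln.
apply: measurable_funB; apply: measurable_funM => //; last exact: measurable_ftot vd tw.
exact: (measurableT_comp (pf_meas pm) (@measurable_snd _ _ T1 T1)).
Qed.

Lemma expR_log_weight lam p : m p.2 != 0 -> expR (- 2 * log_weight lam p) = weight m r lam F0 p.
Proof.
move=> m0; rewrite /weight /log_weight.
set A := _ - _; have Ap : 0 < A := A0 m0.
have -> : - 2 * (- lam * p.1 + ln A / 2) = 2 * lam * p.1 - ln A by field.
by rewrite expRB lnK// posrE.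
Qed.

(** Where M vanishes so does the perturbation, which makes the value of the
weight there immaterial; the integral over a part of the phase space is thus an
integral over the plane. *)
Lemma weighted_sq_plane lam (D : set R) (k u U : R * R -> R) (kap : R -> R) :
  (forall p, D p.1 -> V p.2 -> u p = U p) -> (forall p, D p.1 -> V p.2 -> k p = kap p.1) ->
  (forall p, `|U p| <= m p.2) ->
  weighted_sq (D `*` V) k (log_weight lam) u =
  (\int[mu2]_p (\1_D p.1 * kap p.1 * (weight m r lam F0 p * U p ^+ 2))%:E)%E.
Proof.
move=> uU kk Um; rewrite /weighted_sq integral_mkcond; apply: eq_integral => p _.
rewrite patchE; have [m0|m0] := eqVneq (m p.2) 0.
  have U0 : U p = 0 by apply/eqP; rewrite -normr_le0 -m0.
  rewrite U0 expr0n/= !mulr0; case: ifPn => // /set_mem[Dp Vp].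
  by rewrite uU// U0 normr0 expr0n/= mulr0 mul0r.
have Vp : V p.2 by apply: contra_neqP m0 => nV; rewrite patchE memNset.
rewrite indicE; case: ifPn => [/set_mem[Dp _]|nDV].
  rewrite mem_set// uU// kk// expR_log_weight// real_normK ?num_real// mul1r; congr EFin; ring.
rewrite memNset ?mul0r// => Dp; move/negP: nDV; apply; exact/mem_set.
Qed.
End weighted_norm.

Theorem corollary1p8 (R : realType) (V : set R) (M : R -> R) (r cstar c : R)
    (f : R * R -> R) :
  0 < r ->
  velocity_data V M ->
  is_minimal_speed V M r cstar ->
  cstar <= c < vmax V ->
  travelling_wave V M r c f ->
  exists phi : R * R -> R, measurable_fun (phase V) phi /\
    forall (g0 : R * R -> R) (g : R * R * R -> R) (gamma : R),
      measurable_fun (phase V) g0 ->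
      (forall x v, V v -> 0 <= g0 (x, v) <= M v) ->
      cauchy_solution V M r g0 g ->
      wL2 V phi (fun p => g0 p - f p) ->
      2^-1 < gamma <= 1 ->
      (forall x v, V v -> gamma * f (x, v) <= g0 (x, v)) ->
      let u := moving_perturbation c f g in
      (forall t, 0 <= t ->
         (wL2norm V phi (u t) <= wL2norm V phi (fun p => (g0 p - f p)%R))%E) /\
      (forall z0 : R,
         leb1.-integrable `[0%R, +oo[%classic
           (fun t => (weighted_sq ([set z | (z < z0)%R] `*` V) (cst 1%R)
                        phi (u t) +
                      weighted_sq ([set z | (z0 < z)%R] `*` V)
                        (fun p => rho V (fun v => f (p.1, v)))
                        phi (u t))%E)).
Proof.
move=> r0 vd [/andP[cs0 cs1] disp _] /andP[cc cv] tw.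
pose mu := @lebesgue_measure R; pose mu2 := (mu \x mu)%E.
pose T1 := measurableTypeR R; pose T2 := (T1 * T1)%type; pose T3 := (T1 * T2)%type.
have [Mx [L [L0 [VL pm]]]] := profileM vd.
pose m := M \_ V; pose F0 := ftot V f; pose F (q : R * (R * R)) := F0 q.2.
have fF : field m F := field_fG vd tw.
have mF : mild m r c F0 F := mild_wave vd r0 tw.
have mF0 : measurable_fun setT (F0 : T2 -> R) := measurable_ftot vd tw.
have F_left v : F0 (z, v) @[z --> -oo] --> m v.
  rewrite /F0 /m patchE; case: ifPn => [/set_mem Vv|nVv].
    rewrite [X in X @ _ --> _](_ : _ = (fun z => f (z, v))); first exact: tw_left tw v Vv.
    by apply/funext => z; rewrite ftotE mem_set.
  rewrite [X in X @ _ --> _](_ : _ = cst 0); first exact: cvg_cst.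
  by apply/funext => z; rewrite ftotE (negbTE nVv).
have [lam [eta [adm low]]] : exists lam eta, admissible m r c lam eta /\
    forall z0, exists rho0, 0 < rho0 /\ {ae mu, forall z, z < z0 -> rho0 <= eta + rhoG F 0 z}.
  (* Without velocities above c a large rate gives a uniform damping; otherwise the
     rate of the minimal speed is used and the density of the wave takes over. *)
  have [slow|fast] := pselect {ae mu, forall v, c < v -> m v = 0}.
    have [lam adm] := admissible_no_fast pm r0 slow; exists lam, 1; split => // z0.
    exists 1; split => //; apply: aeW => z _.
    by rewrite lerDl; have /andP[] := rhoG_bound pm 0 z fF.
  have [lam adm] := admissible_dispersion pm r0 vd (erefl _) disp cc cs1.
  exists lam, 0; split => // z0.
  have [rho0 [rp rl]] := wave_lower_bound pm r0 mF0 fF mF F_left z0 fast.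
  by exists rho0; split => //; apply: (ae_mp rl) => z; rewrite add0r.
exists (log_weight V M r f lam); split.
  have mlw : measurable_fun setT (log_weight V M r f lam : T2 -> R) := measurable_log_weight vd tw lam.
  exact: (measurable_funTS mlw).
move=> g0 g gamma mg0 g0M cs [_ u0L2] gamma12 g0f u.
pose h0 := g0 \_ (phase V); pose G := gmov V c g.
have mh0 : measurable_fun setT (h0 : T2 -> R).
  by apply/(measurable_restrict _ (measurable_phase vd) measurableT); rewrite setTI.
have fG : field m G := field_gmov c vd cs.
have mG : mild m r c h0 G := mild_cauchy c vd r0 cs mg0 g0M.
have h0F0 p : gamma * F0 p <= h0 p.
  case: p => z v; rewrite /F0 ftotE /h0 patchE mem_phase/=; case: ifPn => [/set_mem Vv|_].
    exact: g0f.
  by rewrite mulr0.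
have EB := energy_bound pm L0 r0 adm gamma12 mh0 mF0 fG fF mG mF h0F0.
have LB := localized_bound pm L0 r0 adm gamma12 mh0 mF0 fG fF mG mF h0F0.
pose E0 : \bar R := (\int[mu2]_p (weight m r lam F0 p * (h0 p - F0 p) ^+ 2)%:E)%E.
pose U t (p : R * R) := G (t, p) - F0 p.
have F0m p : 0 <= F0 p <= m p.2 := ftot_bound tw p.
have Um t p : `|U t p| <= m p.2.
  have /andP[? ?] := F0m p; have /andP[? ?] := fG.2 (t, p).
  by rewrite ler_norml; apply/andP; split; rewrite /U /=; lra.
have uU t p : 0 <= t -> V p.2 -> u t p = U t p.
  move=> t0 Vp; case: p Vp => z v /= Vv.
  by rewrite /u /moving_perturbation /U /G /gmov gtotE /F0 ftotE/= t0 mem_set.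
have h0m p : `|h0 p - F0 p| <= m p.2.
  have /andP[f0 f1] := F0m p; case: p f0 f1 => z v /= f0 f1.
  have /andP[h1 h2] : 0 <= h0 (z, v) <= m v.
    rewrite /h0 patchE mem_phase/= /m patchE; case: ifPn => [/set_mem Vv|_]; first exact: g0M.
    by rewrite lexx.
  by rewrite ler_norml; apply/andP; split; lra.
have E0E : weighted_sq (phase V) (cst 1) (log_weight V M r f lam) (fun p => g0 p - f p) = E0.
  rewrite /phase (@weighted_sq_plane R V M r c f r0 tw lam setT _ _ (fun p => h0 p - F0 p) (cst 1))//.
    by apply: eq_integral => p _; rewrite indicE mem_set// mul1r mul1r.
  move=> [z v] _ /= Vv; rewrite /h0 patchE mem_phase/= mem_set//.
  by rewrite /F0 ftotE mem_set.
have utE t : 0 <= t -> weighted_sq (phase V) (cst 1) (log_weight V M r f lam) (u t) =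
    (\int[mu2]_p (weight m r lam F0 p * U t p ^+ 2)%:E)%E.
  move=> t0; rewrite /phase (@weighted_sq_plane R V M r c f r0 tw lam setT _ _ (U t) (cst 1))//.
    by apply: eq_integral => p _; rewrite indicE mem_set// mul1r mul1r.
  by move=> p _; exact: uU.
split.
  move=> t t0; rewrite /wL2norm E0E utE//; apply: le_poweR_half; last exact: EB.
  apply: integral_ge0 => p _; rewrite lee_fin mulr_ge0 ?sqr_ge0//; exact: (weight_ge0 lam pm r0 fF p).
move=> z0.
have E0_lty : (E0 < +oo)%E by move: u0L2; rewrite /wL2norm E0E; exact: poweR_half_lty.
pose rf z := rhoG F 0 z.
have rf01 z : 0 <= rf z <= 1 := rhoG_bound pm 0 z fF.
have mrf : measurable_fun setT (rf : T1 -> R).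
  have mp : measurable_fun setT (fun z : T1 => (0, z) : T1 * T1).
    by apply: measurable_fun_pair => //; exact: measurable_cst.
  exact: (measurableT_comp (measurable_rhoG fF.1) mp).
have rhoE z : rho V (fun v => f (z, v)) = rf z.
  by rewrite /rho /rf /rhoG /F/= /F0 ftot_slice -Rintegral_mkcond.
pose lo : R -> R := \1_[set z | z < z0]; pose hi : R -> R := \1_[set z | z0 < z].
have mlo : measurable_fun setT (lo : T1 -> R).
  have e : [set z | z < z0] = `]-oo, z0[%classic by apply/seteqP; split => z; rewrite /= in_itv.
  by apply: measurable_indic; rewrite e.
have mhi : measurable_fun setT (hi : T1 -> R).
  have e : [set z | z0 < z] = `]z0, +oo[%classic.
    by apply/seteqP; split => z; rewrite /= in_itv/= andbT.
  by apply: measurable_indic; rewrite e.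
have lo0 z : 0 <= lo z by rewrite /lo indicE ler0n.
have hi0 z : 0 <= hi z by rewrite /hi indicE ler0n.
pose kap z := lo z + hi z * rf z.
have rf0 z : 0 <= rf z by have /andP[] := rf01 z.
have kap0 z : 0 <= kap z by rewrite addr_ge0// mulr_ge0.
have mkap : measurable_fun setT kap by apply: measurable_funD => //; exact: measurable_funM.
have /andP[g12 _] := gamma12; have s0 : 0 < r * (2 * gamma - 1) by rewrite mulr_gt0//; lra.
set s := r * (2 * gamma - 1) in s0.
have [rho0 [rho00 rho_low]] := low z0.
have mn0 : 0 < Num.min 1 s by rewrite lt_min ltr01.
set mn := Num.min 1 s in mn0.
(* The damping rate eta + s rho_f is at least mn * rho0 to the left of z0, and at
   least s rho_f everywhere. *)
pose K := (mn * rho0)^-1 + s^-1.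
have K0 : 0 <= K by apply: addr_ge0; rewrite invr_ge0; apply: ltW => //; exact: mulr_gt0.
have [eta0 _ _ _] := adm.
have kapK : {ae mu, forall z, kap z <= K * rate r gamma eta F0 z}.
  apply: (ae_mp rho_low) => z lowz.
  have r2 : 0 <= s * rf z by rewrite mulr_ge0// ltW.
  rewrite /rate -/(rf z) -/s /kap /lo /hi !indicE.
  have rate0 : 0 <= eta + s * rf z by rewrite addr_ge0.
  have [zz|zz|zz] := ltgtP z z0.
  - rewrite mem_set// memNset/= ?mul0r ?addr0; last by apply/negP; rewrite -leNgt ltW.
    apply: (@le_trans _ _ ((mn * rho0)^-1 * (eta + s * rf z))); last first.
      by apply: ler_wpM2r => //; rewrite lerDl invr_ge0 ltW.
    rewrite ler_pdivlMl ?mulr_gt0// mulr1.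
    apply: (@le_trans _ _ (mn * (eta + rf z))); first by rewrite ler_pM2l// lowz.
    rewrite mulrDr lerD//; first by rewrite ler_piMl// ge_min lexx.
    by rewrite ler_wpM2r// ge_min lexx orbT.
  - rewrite memNset/= ?add0r; last by apply/negP; rewrite -leNgt ltW.
    rewrite mem_set// mul1r.
    apply: (@le_trans _ _ (s^-1 * (eta + s * rf z))); last first.
      by apply: ler_wpM2r => //; rewrite lerDr invr_ge0 mulr_ge0// ltW.
    by rewrite ler_pdivlMl// lerDr.
  - by rewrite !memNset/= ?zz ?ltxx// mul0r addr0 mulr_ge0// -zz.
have mW : measurable_fun setT (weight m r lam F0 : T2 -> R) := measurable_weight lam pm r0 mF0 fF.
have W0 p : 0 <= weight m r lam F0 p := weight_ge0 lam pm r0 fF p.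
have mfst := @measurable_fst _ _ T1 T1; have msnd := @measurable_snd _ _ T1 T2.
pose k (w : T1 * T2) : R := \1_(`[0%R, +oo[%classic) w.1 * (kap w.2.1 * (weight m r lam F0 w.2 * U w.1 w.2 ^+ 2)).
have mk : measurable_fun setT (EFin \o k).
  apply/measurable_EFinP; apply: measurable_funM.
    exact: (measurableT_comp (measurable_indic _) (@measurable_fst _ _ T1 T2)).
  apply: measurable_funM; first exact: (measurableT_comp mkap (measurableT_comp mfst msnd)).
  apply: measurable_funM; first exact: (measurableT_comp mW msnd).
  apply: measurable_funX; apply: measurable_funB; last exact: (measurableT_comp mF0 msnd).
  by rewrite (_ : (fun w => G _) = G); [exact: fG.1|apply/funext; case].
have k0 w : (0 <= (EFin \o k) w)%E.
  by rewrite lee_fin mulr_ge0 ?indicE ?ler0n// mulr_ge0// mulr_ge0 ?sqr_ge0.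
pose H t := (\int[mu2]_p (k (t, p))%:E)%E.
have mH : measurable_fun setT (H : T1 -> \bar R).
  exact: (@measurable_fun_fubini_tonelli_F _ _ T1 T2 R plane _ mk k0).
have H0 t : (0 <= H t)%E by apply: integral_ge0 => p _; exact: (k0 (t, p)).
have HE t : 0 <= t -> H t =
    (weighted_sq ([set z | (z < z0)%R] `*` V) (cst 1%R) (log_weight V M r f lam) (u t) +
     weighted_sq ([set z | (z0 < z)%R] `*` V) (fun p => rho V (fun v => f (p.1, v)))
       (log_weight V M r f lam) (u t))%E.
  move=> t0.
  rewrite (@weighted_sq_plane R V M r c f r0 tw lam _ _ _ (U t) (cst 1))//; last first.
    by move=> p _; exact: uU.
  rewrite (@weighted_sq_plane R V M r c f r0 tw lam _ _ _ (U t) rf)//; last first.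
    by move=> p _; exact: uU.
  have mWU : measurable_fun setT (fun p : T2 => weight m r lam F0 p * U t p ^+ 2).
    apply: measurable_funM => //; apply: measurable_funX; apply: measurable_funB => //.
    exact: (measurableT_comp fG.1 (pair1_measurable t)).
  have WU0 p : 0 <= weight m r lam F0 p * U t p ^+ 2 by rewrite mulr_ge0 ?sqr_ge0.
  have m1 : measurable_fun setT (fun p : T2 => (lo p.1 * 1 * (weight m r lam F0 p * U t p ^+ 2))%:E).
    apply/measurable_EFinP; apply: measurable_funM => //; apply: measurable_funM => //.
    exact: (measurableT_comp mlo mfst).
  have m2 : measurable_fun setT (fun p : T2 => (hi p.1 * rf p.1 * (weight m r lam F0 p * U t p ^+ 2))%:E).
    apply/measurable_EFinP; apply: measurable_funM => //; apply: measurable_funM.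
      exact: (measurableT_comp mhi mfst).
    exact: (measurableT_comp mrf mfst).
  have p1 (p : T2) : setT p -> (0 <= (lo p.1 * 1 * (weight m r lam F0 p * U t p ^+ 2))%:E)%E.
    by move=> _; rewrite lee_fin mulr_ge0// mulr_ge0.
  have p2 (p : T2) : setT p -> (0 <= (hi p.1 * rf p.1 * (weight m r lam F0 p * U t p ^+ 2))%:E)%E.
    by move=> _; rewrite lee_fin mulr_ge0// mulr_ge0.
  rewrite -[RHS](@ge0_integralD _ T2 R mu2 setT measurableT _ _ p1 m1 p2 m2).
  apply: eq_integral => p _; rewrite -EFinD; congr EFin.
  rewrite /k /= indicE mem_set/= ?in_itv/= ?t0// /kap; ring.
apply/integrableP; split.
  apply: (@eq_measurable_fun _ _ T1 _ `[0%R, +oo[%classic H).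
    by move=> t; rewrite inE/= in_itv/= andbT; exact: HE.
  exact: measurable_funTS.
rewrite [X in (X < _)%E](_ : _ = \int[mu]_(t in `[0%R, +oo[%classic) H t)%E; last first.
  apply: eq_integral => t; rewrite inE/= in_itv/= andbT => t0.
  by rewrite -HE// gee0_abs.
apply: (@le_lt_trans _ _ (\int[mu]_t H t)%E).
  by apply: (@ge0_subset_integral _ T1 R mu).
apply: (le_lt_trans (LB _ _ mkap kap0 K0 kapK)).
by rewrite lte_mul_pinfty.
Qed.
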